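(* Let $T>0$, $\beta\in\mathbb{R}$, $0\le\alpha<2$, $\mu<\mu(\alpha+\beta)$ where $\mu(\delta):=(1-\delta)^2/4$, and $a:=\frac{\alpha+\beta-1}{2}-\sqrt{\mu(\alpha+\beta)-\mu}$. Let $f\in L^2(0,T)$ and $u_0\in L^2_\beta(0,1)$. Then the formula $$\langle u(\tau),z^\tau\rangle_\beta=\langle u_0,S(\tau)z^\tau\rangle_\beta+\int_0^\tau f(t)\lim_{x\to1^-}(S(\tau-t)z^\tau)(x)\,dt\quad\text{for all }z^\tau\in L^2_\beta(0,1)\qquad(\ast)$$ defines for each $\tau\in[0,T]$ a unique element $u(\tau)\in L^2_\beta(0,1)$ that can be written as $$u(\tau)-S(\tau)u_0=\mathcal{B}(\tau)f,\quad\tau\in(0,T],$$ where $\mathcal{B}(\tau)$ is the strongly continuous family of bounded operators $\mathcal{B}(\tau):L^2(0,T)\to L^2_\beta(0,1)$ given by $$\langle\mathcal{B}(\tau)f,z^\tau\rangle_\beta=\int_0^\tau f(t)\lim_{x\to1^-}(S(\tau-t)z^\tau)(x)\,dt\quad\text{for all }z^\tau\in L^2_\beta(0,1).$$ Furthermore, the unique weak solution $u$ on $[0,T]$ (in the sense of $(\ast)$) of the system $$\begin{cases}u_t-(x^\alpha u_x)_x-\beta x^{\alpha-1}u_x-\dfrac{\mu}{x^{2-\alpha}}u=0 & \text{in }(0,1)\times(0,T),\\ [u(\cdot,t),x^{-a}](0)=0,\quad a\,u(1,t)+u_x(1,t)=f(t) & \text{on }(0,T),\\ u(x,0)=u_0(x)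 & \text{in }(0,1)\end{cases}$$ belongs to $C^0([0,T];L^2_\beta(0,1))$ and satisfies $$\|u\|_{L^\infty([0,T];L^2_\beta(0,1))}\le C\left(\|u_0\|_\beta+\|f\|_{L^2(0,T)}\right)$$ for a constant $C>0$ independent of $u_0$ and $f$.
   Context: $\kappa_\alpha:=\frac{2-\alpha}{2}$ and $\nu:=\sqrt{\mu(\alpha+\beta)-\mu}/\kappa_\alpha$. $J_\nu$ is the Bessel function of the first kind and $0<j_{\nu+1,1}<j_{\nu+1,2}<\dots$ are the positive zeros of $J_{\nu+1}$. $L^2_\beta(0,1):=L^2((0,1);x^\beta dx)$ with inner product $\langle f,g\rangle_\beta=\int_0^1f(x)g(x)x^\beta dx$ and norm $\|\cdot\|_\beta$. The Lagrange form is $[u,v](x)=(u\,p\,v'-v\,p\,u')(x)$ with $p(x)=x^{\alpha+\beta}$, and $[u,v](0)$ is its limit as $x\to0^+$. Put $\Phi_0(x)=\sqrt{2(\nu+1)\kappa_\alpha}\,x^{-a}$ and, for $k\ge1$, $\Phi_k(x)=\frac{\sqrt{2\kappa_\alpha}}{|J_\nu(j_{\nu+1,k})|}x^{(1-\alpha-\beta)/2}J_\nu(j_{\nu+1,k}x^{\kappa_\alpha})$; put $\lambda_0=0$ and $\lambda_k=\kappa_\alpha^2j_{\nu+1,k}^2$ for $k\ge1$. The family $\{\Phi_k\}_{k\ge0}$ is an orthonormal basis of $L^2_\beta(0,1)$, and $S(t)\sum_ka_k\Phi_k:=\sum_ke^{-\lambda_kt}a_k\Phi_k$. A weak solution of the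 system is a function $u\in C^0([0,T];L^2_\beta(0,1))$ such that $(\ast)$ holds for every $\tau\in(0,T]$ and every $z^\tau\in L^2_\beta(0,1)$. *)

(* Defs.v *)
From HB Require Import structures.
From mathcomp Require Import all_boot all_order all_algebra.
From mathcomp Require Import all_classical all_reals all_analysis.
From mathcomp Require Import measurable_realfun.

Set Implicit Arguments.
Unset Strict Implicit.
Unset Printing Implicit Defensive.

Import Order.TTheory GRing.Theory Num.Theory.
Import numFieldNormedType.Exports.

Local Open Scope classical_set_scope.
Local Open Scope ring_scope.

Section measures.
Context {R : realType}.

Definition lebesgue_on (i : interval R) : {measure set (measurableTypeR R) -> \bar R} :=
  mrestr lebesgue_measure (measurable_itv i).

Definition weight_fun (beta : R) (A : set (measurableTypeR R)) : \bar R :=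
  (\int[lebesgue_on `]0%R, 1%R[]_(x in A) (x `^ beta)%:E)%E.

Let weight_fun0 beta : weight_fun beta set0 = 0%E.
Proof. exact: integral_set0. Qed.

Let weight_fun_ge0 beta A : (0 <= weight_fun beta A)%E.
Proof. by apply: integral_ge0 => x _; rewrite lee_fin powR_ge0. Qed.

Let weight_fun_sigma_additive beta : semi_sigma_additive (weight_fun beta).
Proof.
rewrite /weight_fun; apply: semi_sigma_additive_nng_induced => [|x].
  by apply/measurable_EFinP; exact: measurable_powR.
by rewrite lee_fin powR_ge0.
Qed.

HB.instance Definition _ (beta : R) := isMeasure.Build _ _ _ (weight_fun beta)
  (weight_fun0 beta) (weight_fun_ge0 beta) (@weight_fun_sigma_additive beta).

(* The measure x^beta dx on (0,1), extended by 0 to the real line. *)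
Definition weight (beta : R) : {measure set (measurableTypeR R) -> \bar R} := weight_fun beta.

End measures.

(* Elements of the L2 spaces are square-integrable functions; equality of
   classes is always written explicitly as equality almost everywhere. *)
Section L2.
Context {R : realType}.

Definition L2 (m : {measure set (measurableTypeR R) -> \bar R}) := LfunType m (lee1n 2).

Definition L2inner (m : {measure set (measurableTypeR R) -> \bar R}) (f g : R -> R) : R :=
  (\int[m]_x (f x * g x))%R.

Definition L2norm (m : {measure set (measurableTypeR R) -> \bar R}) (f : L2 m) : R :=
  fine ('N[m]_2%:E[EFin \o f])%E.

Definition bounded_operator (m n : {measure set (measurableTypeR R) -> \bar R})
    (B : L2 m -> L2 n) : Prop :=
  (forall (c : R) (f g : L2 m), B (c *: f + g) = c *: B f + B g %[ae n]) /\
  (exists M : R, forall f : L2 m, L2norm (B f) <= M * L2norm f).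

Definition L2continuous (m : {measure set (measurableTypeR R) -> \bar R})
    (D : set R) (u : R -> L2 m) : Prop :=
  forall s, D s -> L2norm (u t - u s) @[t --> within D (nbhs s)] --> (0 : R).

Definition Linf_norm (m : {measure set (measurableTypeR R) -> \bar R}) (T : R)
    (u : R -> L2 m) : \bar R :=
  Lnorm (lebesgue_on `[0, T]) +oo%E (fun t => (L2norm (u t))%:E).

End L2.

Section bessel.
Context {R : realType}.

(* Only used for s > 0, where the integral converges. *)
Definition Gamma (s : R) : R :=
  (\int[lebesgue_measure]_(t in `]0%R, +oo[) (t `^ (s - 1) * expR (- t)))%R.

(* Only used for nu > 0 and x > 0. *)
Definition besselJ (nu x : R) : R :=
  limn (series (fun m : nat =>
    (-1) ^+ m / (m`!%:R * Gamma (m%:R + nu + 1)) *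
    (x / 2) `^ (2 * m%:R + nu))).

(* For k >= 1, the k-th positive zero of J_nu: the zeros are isolated and
   unbounded, so each infimum is the least zero beyond the previous one. *)
Fixpoint bessel_zero (nu : R) (k : nat) : R :=
  if k is k'.+1 then
    inf [set x : R | bessel_zero nu k' < x /\ besselJ nu x = 0]
  else 0.

End bessel.

Section problem.
Context {R : realType}.
Variables alpha beta mu : R.

Definition mu_crit (delta : R) : R := (1 - delta) ^+ 2 / 4.

Definition kappa : R := (2 - alpha) / 2.

Definition bessel_order : R :=
  Num.sqrt (mu_crit (alpha + beta) - mu) / kappa.

Definition exponent_a : R :=
  (alpha + beta - 1) / 2 - Num.sqrt (mu_crit (alpha + beta) - mu).

Definition Phi (k : nat) (x : R) : R :=
  if k is 0 then
    Num.sqrt (2 * (bessel_order + 1) * kappa) * x `^ (- exponent_a)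
  else
    Num.sqrt (2 * kappa) / `|besselJ bessel_order (bessel_zero (bessel_order + 1) k)| *
    x `^ ((1 - alpha - beta) / 2) *
    besselJ bessel_order (bessel_zero (bessel_order + 1) k * x `^ kappa).

Definition lambda (k : nat) : R :=
  if k is 0 then 0 else kappa ^+ 2 * bessel_zero (bessel_order + 1) k ^+ 2.

(* The L2-limit of the series \sum_k e^(-lambda_k t) <z, Phi_k> Phi_k, the
   Fourier coefficients being the coordinates in the orthonormal basis (Phi_k).
   Lnorm is extended-real valued, so it has no junk value if the argument is not
   square-integrable. *)
Definition semigroup (t : R) (z : L2 (weight beta)) : L2 (weight beta) :=
  xget 0 [set w : L2 (weight beta) |
    Lnorm (weight beta) 2%:E (fun x : R =>
      (\sum_(k < n) expR (- lambda k * t) *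
         L2inner (weight beta) z (Phi k) * Phi k x - w x)%:E)
      @[n --> \oo] --> 0%E].

(* The limit as x -> 1^- of a class in L2, taken along its representative that
   is continuous on (0,1). *)
Definition left_limit1 (w : R -> R) (l : R) : Prop :=
  exists g : R -> R,
    [/\ w = g %[ae weight beta],
        {in `]0, 1[, continuous g} &
        g x @[x --> 1^'-] --> l].

Definition lim1 (w : R -> R) : R := xget 0 (left_limit1 w).

Definition boundary_integrand (tau : R) (f : R -> R) (z : L2 (weight beta))
    (t : R) : R := f t * lim1 (semigroup (tau - t) z).

Definition boundary_term (tau : R) (f : R -> R) (z : L2 (weight beta)) : R :=
  (\int[lebesgue_measure]_(t in `]0%R, tau[) boundary_integrand tau f z t)%R.

Definition transposition (f : R -> R) (u0 : L2 (weight beta)) (tau : R)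
    (v : L2 (weight beta)) : Prop :=
  forall z : L2 (weight beta),
    L2inner (weight beta) v z =
    L2inner (weight beta) u0 (semigroup tau z) + boundary_term tau f z.

(* Solutions by transposition of
     u_t - (x^alpha u_x)_x - beta x^(alpha-1) u_x - mu x^(alpha-2) u = 0
   on (0,1) x (0,T), with [u(.,t), x^(-a)](0) = 0, a u(1,t) + u_x(1,t) = f(t)
   and u(x,0) = u0(x), where [u,v] = u p v' - v p u' for p(x) = x^(alpha+beta).
   The operator, the boundary conditions and the initial datum enter only
   through the semigroup and the boundary term of the tested identity. *)
Definition weak_solution (T : R) (f : R -> R) (u0 : L2 (weight beta))
    (u : R -> L2 (weight beta)) : Prop :=
  L2continuous `[0, T] u /\
  (forall tau, 0 < tau <= T -> transposition f u0 tau (u tau)).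

End problem.

(* Main.v *)
(* On (0,1) one has Phi_k = c_k x^(-a) C_nu(q_k x^(2 kappa)) with q_0 = 0 and
   q_k = j_(nu+1,k)^2 / 4, where C_nu(y) = y^(-nu/2) J_nu(2 sqrt y) is entire and
   C_nu' = - C_(nu+1). Explicit primitives show that (Phi_k) is orthonormal.
   Bessel's inequality for the analogous family of order nu+1 against the constant
   node 0 gives sum_(k>=1) 1/lambda_k < oo, and the monotonicity of an energy of C_nu
   bounds |Phi_k(x)| by a power of x uniformly in k; in particular Phi_k(1) is
   bounded. Hence the series of S(t)z converges locally uniformly up to x = 1 for
   t > 0, and its left limit there is sum_k e^(-lambda_k t) <z, Phi_k> Phi_k(1).

   As t |-> e^(-lambda_k (tau - t)) has squared norm at most 1/lambda_k (k >= 1) in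
   L^2(0,tau), the coefficients
     b_k(tau) = Phi_k(1) int_0^tau f(t) e^(-lambda_k (tau - t)) dt
   satisfy b_k(tau)^2 <= C |f|^2 / lambda_k, so that B(tau) f = sum_k b_k(tau) Phi_k
   exists by the Riesz-Fischer theorem, is bounded in f, and is continuous in tau by
   Tannery's theorem. The solution is S(tau) u_0 + B(tau) f. Completeness of (Phi_k)
   is never needed. *)

(* In the variable y = x^(2 kappa) the eigenvalue problem reads (y^(nu+1) w')' + q y^nu w = 0 with
   solution w(y) = C_nu(q y), and a Phi + Phi' at x = 1 is a multiple of q C_(nu+1)(q). The single
   condition q C_(nu+1)(q) = 0 thus covers the node 0 and the Bessel zeros alike. The zeros are
   defined as successive infima, so their existence has to be proved. A Sturm comparison with
   sin(x/2) makes them unbounded; the energy, nonnegative and nondecreasing, excludes a common zero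
   of C_nu and C_(nu+1), which makes them isolated. At a zero of C_(nu+1) the second term of the
   energy drops out and leaves |C_nu(q_k)|, the very factor by which Phi_k is normalised: hence a
   bound uniform in k. The series of 1/lambda_k is the common majorant: e^(-lambda_k t) <=
   1/(lambda_k t) settles every fixed t > 0, while the squared norms of the kernels settle the end t
   = tau of the boundary integral, where that bound blows up. *)
Require Import Defs.
From HB Require Import structures.
From mathcomp Require Import all_boot all_order all_algebra.
From mathcomp Require Import all_classical all_reals all_analysis.
From mathcomp Require Import measurable_realfun ring lra.

Set Implicit Arguments.
Unset Strict Implicit.
Unset Printing Implicit Defensive.

Import Order.TTheory GRing.Theory Num.Theory.
Import numFieldNormedType.Exports.

Local Open Scope classical_set_scope.
Local Open Scope ring_scope.

(** * Improper integrals *)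

Section improper_ftc.
Context {R : realType}.
Let mu := @lebesgue_measure R.

Section setup.
Variables (D : set R) (a b : R^nat) (f F : R -> R) (L : R).
Hypotheses (oD : open D) (ab : forall n, a n < b n)
  (abD : forall n, `[a n, b n]%classic `<=` D)
  (Dab : forall x, D x -> \forall n \near \oo, a n <= x <= b n)
  (cf : forall x, D x -> {for x, continuous f})
  (dF : forall x, D x -> is_derive x 1 F (f x))
  (FL : F (b n) - F (a n) @[n --> \oo] --> L).

Let mD : measurable D. Proof. exact: open_measurable. Qed.

Let mf : measurable_fun D f.
Proof. by apply: open_continuous_measurable_fun => // x /set_mem; exact: cf. Qed.

Let g n := (EFin \o f) \_ `[a n, b n].

Let intg n : (\int[mu]_(x in D) g n x = (F (b n) - F (a n))%:E)%E.
Proof.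
rewrite /g -integral_mkcondr (_ : D `&` _ = `[a n, b n]%classic); last first.
  by apply: setIidr; exact: abD.
rewrite (continuous_FTC2 (ab n) (F := F)) //.
- by apply: continuous_in_subspaceT => x /set_mem /abD; exact: cf.
- have dab x : x \in `[a n, b n] -> derivable F x 1.
    by move=> xab; case: (dF (abD xab)).
  have /(continuous_within_itvP _ (ab n)) [_ ? ?] :=
    derivable_within_continuous dab.
  split => // x xab; apply: dab; exact: subset_itv_oo_cc xab.
- move=> x xab; rewrite derive1E; apply: derive_val.
  by apply: dF; apply: (abD (n := n)); exact: subset_itv_oo_cc xab.
Qed.

Let mg n : measurable_fun D (g n).
Proof.
rewrite /g; apply/measurable_restrict => //.
by apply: measurable_funS mD _ _ => //; exact/measurable_EFinP.
Qed.

Let gf x : D x -> g n x @[n --> \oo] --> (f x)%:E.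
Proof.
move=> Dx; apply: cvg_near_cst.
near=> n; rewrite /g patchE mem_set//= in_itv/=.
by near: n; exact: Dab.
Unshelve. all: by end_near. Qed.

(** Dominated convergence along the segments [[a n, b n]], which lie in [D] and eventually contain
    each of its points; |f| itself is the majorant. *)
Lemma improper_FTC : mu.-integrable D (EFin \o f) ->
  (\int[mu]_(x in D) (f x)%:E = L%:E)%E.
Proof.
move=> fi.
have : (\int[mu]_(x in D) g n x)%E @[n --> \oo] --> (\int[mu]_(x in D) (f x)%:E)%E.
  apply: (@dominated_cvg _ _ _ mu D mD g (EFin \o f) (abse \o (EFin \o f)) mg).
  - by move=> x Dx; exact: gf.
  - by [].
  - exact: integrable_abse.
  - move=> n x Dx; rewrite /g patchE; case: ifP => // _.
    by rewrite /= normr0 lee_fin.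
move=> /(cvg_lim (@ereal_hausdorff R)) <-; apply/cvg_lim => //.
under eq_fun do rewrite intg.
by apply: cvg_EFin FL; exact: nearW.
Qed.

(** Fatou's lemma: the integrals of the truncations converge to [L], so the integral of their
    pointwise limit is finite. *)
Lemma ge0_improper_FTC_integrable : (forall x, D x -> 0 <= f x) ->
  mu.-integrable D (EFin \o f).
Proof.
move=> f0; apply/integrableP; split; first exact/measurable_EFinP.
have -> : (\int[mu]_(x in D) `|(EFin \o f) x| =
    \int[mu]_(x in D) limn_einf (g ^~ x))%E.
  apply: eq_integral => x /set_mem Dx.
  have [-> _] := cvg_limn_einf_sup (gf Dx).
  by rewrite gee0_abs//= lee_fin f0.
apply: le_lt_trans (fatou mu mD mg _) _.
  move=> n x Dx; rewrite /g patchE; case: ifP => // _.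
  by rewrite lee_fin f0.
under eq_fun do rewrite intg.
have FL' : (F (b n) - F (a n))%:E @[n --> \oo] --> L%:E.
  by apply: cvg_EFin FL; exact: nearW.
have [-> _] := cvg_limn_einf_sup FL'.
exact: ltry.
Qed.

End setup.
End improper_ftc.

Section improper_ftc_intervals.
Context {R : realType}.
Let mu := @lebesgue_measure R.
Variables (f F : R -> R) (l0 l1 : R).

Let near_natSinv_le (x : R) : 0 < x -> \forall n \near \oo, n.+1%:R^-1 <= x.
Proof.
move=> x0; near=> n; apply/ltW; near: n.
exact: (@near_infty_natSinv_lt R (PosNum x0)).
Unshelve. all: by end_near. Qed.

Let near_natSSinv_le (x : R) : 0 < x -> \forall n \near \oo, n.+3%:R^-1 <= x.
Proof.
move=> x0; near=> n.
have : n.+1%:R^-1 <= x by near: n; exact: near_natSinv_le.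
by apply: le_trans; rewrite lef_pV2 ?posrE// ler_nat leqW.
Unshelve. all: by end_near. Qed.

Let cvg_harmonic3 : (n.+3%:R^-1 : R) @[n --> \oo] --> 0.
Proof. by have := @cvg_harmonic R; rewrite -(cvg_shiftn 2)/=; under eq_fun do rewrite addn2. Qed.

Section half_line.
Hypotheses (cf : forall x : R, 0 < x -> {for x, continuous f})
  (dF : forall x : R, 0 < x -> is_derive x 1 F (f x))
  (F0 : F x @[x --> 0^'+] --> l0) (F1 : F x @[x --> +oo] --> l1).

Let a (n : nat) : R := n.+1%:R^-1.
Let b (n : nat) : R := n.+2%:R.

Let ab n : a n < b n.
Proof. by rewrite (@le_lt_trans _ _ 1)// ?invf_le1// ?ler1n// ltr1n. Qed.

Let abD n : `[a n, b n]%classic `<=` `]0, +oo[.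
Proof.
move=> x /=; rewrite !in_itv/= andbT => /andP[+ _].
by apply: lt_le_trans; rewrite invr_gt0.
Qed.

Let Dab (x : R) : `]0%R, +oo[%classic x -> \forall n \near \oo, a n <= x <= b n.
Proof.
rewrite /= in_itv/= andbT => x0.
near=> n; apply/andP; split; first by near: n; exact: near_natSinv_le.
have : x <= n%:R by near: n; exact: nbhs_infty_ger.
by move=> /le_trans; apply; rewrite ler_nat leqW.
Unshelve. all: by end_near. Qed.

Let Fl : F (b n) - F (a n) @[n --> \oo] --> l1 - l0.
Proof.
apply: cvgB.
  have b_oo : b n @[n --> \oo] --> +oo.
    by have := @cvgr_idn R; rewrite -(cvg_shiftn 2)/=; under eq_fun do rewrite addn2.
  exact: (cvg_comp b F b_oo F1).
move/cvg_at_rightP : F0; apply; split; last exact: cvg_harmonic.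
by move=> n; rewrite invr_gt0.
Qed.

Let cf' (x : R) : `]0%R, +oo[%classic x -> {for x, continuous f}.
Proof. by rewrite /= in_itv/= andbT; exact: cf. Qed.

Let dF' (x : R) : `]0%R, +oo[%classic x -> is_derive x 1 F (f x).
Proof. by rewrite /= in_itv/= andbT; exact: dF. Qed.

Lemma improper_FTC_0y : mu.-integrable `]0, +oo[ (EFin \o f) ->
  (\int[mu]_(x in `]0%R, +oo[) (f x)%:E = (l1 - l0)%:E)%E.
Proof.
by move=> fi; apply: (improper_FTC _ ab abD Dab cf' dF' Fl) => //; exact: interval_open.
Qed.

Lemma ge0_improper_FTC_0y_integrable : (forall x : R, 0 < x -> 0 <= f x) ->
  mu.-integrable `]0, +oo[ (EFin \o f).
Proof.
move=> f0; apply: (ge0_improper_FTC_integrable _ ab abD Dab cf' dF' Fl).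
  exact: interval_open.
by move=> x; rewrite /= in_itv/= andbT; exact: f0.
Qed.

End half_line.

Section unit_interval.
Hypotheses (cf : forall x : R, 0 < x < 1 -> {for x, continuous f})
  (dF : forall x : R, 0 < x < 1 -> is_derive x 1 F (f x))
  (F0 : F x @[x --> 0^'+] --> l0) (F1 : F x @[x --> 1^'-] --> l1).

(** The offset 3 keeps [a n] below 1/2, hence below [b n], already at n = 0. *)
Let a (n : nat) : R := n.+3%:R^-1.
Let b (n : nat) : R := 1 - n.+3%:R^-1.

Let a_lt n : a n < 2^-1.
Proof. by rewrite ltf_pV2 ?posrE// ltr_nat. Qed.

Let a_gt0 n : 0 < a n.
Proof. by rewrite invr_gt0. Qed.

Let ab n : a n < b n.
Proof. by rewrite /b -/(a n); have := a_lt n; lra. Qed.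

Let abD n : `[a n, b n]%classic `<=` `]0, 1[.
Proof.
by move=> x /=; rewrite !in_itv/= /b -/(a n); have := a_gt0 n; lra.
Qed.

Let Dab (x : R) : `]0%R, 1%R[%classic x -> \forall n \near \oo, a n <= x <= b n.
Proof.
rewrite /= in_itv/= => /andP[x0 x1].
near=> n; apply/andP; split; first by near: n; exact: near_natSSinv_le.
rewrite lerBrDr -lerBrDl.
by near: n; apply: near_natSSinv_le; rewrite subr_gt0.
Unshelve. all: by end_near. Qed.

Let Fl : F (b n) - F (a n) @[n --> \oo] --> l1 - l0.
Proof.
apply: cvgB.
  move/cvg_at_leftP : F1; apply; split.
    by move=> n; rewrite ltrBlDr ltrDl a_gt0.
  rewrite -[X in _ --> X]subr0; apply: cvgB; first exact: cvg_cst.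
  exact: cvg_harmonic3.
move/cvg_at_rightP : F0; apply; split => //.
Qed.

Let cf' (x : R) : `]0%R, 1%R[%classic x -> {for x, continuous f}.
Proof. by rewrite /= in_itv/=; exact: cf. Qed.

Let dF' (x : R) : `]0%R, 1%R[%classic x -> is_derive x 1 F (f x).
Proof. by rewrite /= in_itv/=; exact: dF. Qed.

Lemma improper_FTC_01 : mu.-integrable `]0, 1[ (EFin \o f) ->
  (\int[mu]_(x in `]0%R, 1%R[) (f x)%:E = (l1 - l0)%:E)%E.
Proof.
by move=> fi; apply: (improper_FTC _ ab abD Dab cf' dF' Fl) => //; exact: interval_open.
Qed.

Lemma ge0_improper_FTC_01_integrable : (forall x : R, 0 < x < 1 -> 0 <= f x) ->
  mu.-integrable `]0, 1[ (EFin \o f).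
Proof.
move=> f0; apply: (ge0_improper_FTC_integrable _ ab abD Dab cf' dF' Fl).
  exact: interval_open.
by move=> x; rewrite /= in_itv/=; exact: f0.
Qed.

End unit_interval.
End improper_ftc_intervals.

(** * The Gamma function *)

Section gamma.
Context {R : realType}.
Implicit Types (s t p : R).
Let mu := @lebesgue_measure R.

(** Write t = 2 p u and use ln u < u. Only half of the exponent is spent, so that a factor exp(-t/2)
    survives against exp(-t). *)
Lemma powR_le_expR p t : 0 < p -> 0 < t ->
  t `^ p <= (2 * p) `^ p * expR (t / 2).
Proof.
move=> p0 t0; have p20 : 0 < 2 * p by rewrite mulr_gt0.
have -> : t = (2 * p) * (t / (2 * p)) by rewrite mulrC divfK// gt_eqF.
set u := t / (2 * p); have u0 : 0 < u by rewrite divr_gt0.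
rewrite (@powRM _ (2 * p) u) ?(ltW p20) ?(ltW u0)// ler_pM2l ?powR_gt0//.
rewrite /powR gt_eqF// ler_expR.
rewrite (_ : 2 * p * u / 2 = p * u); last by field.
by rewrite ler_pM2l// ltW// ln_sublinear.
Qed.

Lemma is_derive_expRN (c t : R) :
  is_derive t 1 (fun x => expR (- (c * x))) (- (c * expR (- (c * t)))).
Proof.
have d1 : is_derive t 1 (fun x : R => - (c * x)) (- c).
  by apply: is_derive_eq; rewrite /GRing.scale/= ?mulr1 ?mulr0 ?addr0.
have := @is_derive1_comp R expR (fun x => - (c * x)) t _ _ (is_derive_expR _) d1.
by rewrite mulrN mulrC; exact.
Qed.

Lemma cvg_expRN_pinfty (c : R) : 0 < c -> expR (- (c * x)) @[x --> +oo] --> 0.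
Proof.
move=> c0; have cx : c * x @[x --> +oo] --> +oo by exact: gt0_cvgMry.
exact: (cvg_comp (fun x => c * x) (fun x => expR (- x)) cx (@cvgr_expR R)).
Qed.

Lemma integrable_expRN (c : R) : 0 < c ->
  mu.-integrable `]0, +oo[ (EFin \o (fun t => expR (- (c * t)))).
Proof.
move=> c0.
pose F t := - (c^-1 * expR (- (c * t))).
have dF (x : R) : is_derive x 1 F (expR (- (c * x))).
  have ? := is_derive_expRN c x; apply: is_derive_eq.
  by rewrite /GRing.scale/=; field; rewrite gt_eqF.
apply: (@ge0_improper_FTC_0y_integrable _ _ F (- c^-1) 0).
- move=> x _; apply: differentiable_continuous; apply/derivable1_diffP.
  by case: (is_derive_expRN c x).
- apply: cvg_at_right_filter.
  rewrite (_ : - c^-1 = F 0); last by rewrite /F mulr0 oppr0 expR0 mulr1.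
  apply: differentiable_continuous; apply/derivable1_diffP.
  by case: (dF 0).
- rewrite -oppr0 -(mulr0 c^-1); apply: cvgN; apply: cvgMr.
  exact: cvg_expRN_pinfty.
- by move=> x _; exact: expR_ge0.
Qed.

Lemma Gamma_integrable s : 1 < s ->
  mu.-integrable `]0, +oo[ (EFin \o (fun t => t `^ (s - 1) * expR (- t))).
Proof.
move=> s1; have p0 : 0 < s - 1 by rewrite subr_gt0.
have ig : mu.-integrable `]0, +oo[
    (fun t => ((2 * (s - 1)) `^ (s - 1))%:E * (expR (- (2^-1 * t)))%:E)%E.
  by apply: integrableZl => //; apply: integrable_expRN.
apply: (le_integrable _ _ _ ig) => //.
- apply/measurable_EFinP; apply: measurable_funM.
    by apply: measurable_funS (measurable_powR _).
  apply: measurableT_comp => //; exact: measurable_funN.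
- move=> x; rewrite /= in_itv/= andbT => x0.
  rewrite lee_fin !ger0_norm ?mulr_ge0 ?powR_ge0 ?expR_ge0//.
  apply: (@le_trans _ _ ((2 * (s - 1)) `^ (s - 1) * expR (x / 2) * expR (- x))).
    by rewrite ler_wpM2r ?expR_ge0// powR_le_expR.
  rewrite -mulrA ler_wpM2l ?powR_ge0// -expRD ler_expR; lra.
Qed.

(** Integration by parts: t^s exp(-t) tends to 0 at both ends, and its derivative [f] is the
    difference of the two integrands. *)
Lemma Gamma_rec s : 1 < s -> Gamma (s + 1) = s * Gamma s.
Proof.
move=> s1; have s0 : 0 < s by rewrite (lt_trans _ s1).
pose f t := s * (t `^ (s - 1) * expR (- t)) - t `^ (s + 1 - 1) * expR (- t).
pose F t := t `^ s * expR (- t).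
have i1 := Gamma_integrable s1.
have i2 : mu.-integrable `]0, +oo[ (EFin \o (fun t => t `^ (s + 1 - 1) * expR (- t))).
  by apply: Gamma_integrable; rewrite ltrDr.
have i1' : mu.-integrable `]0, +oo[ (EFin \o (fun t => s * (t `^ (s - 1) * expR (- t)))).
  rewrite [X in integrable _ _ X](_ : _ = fun t => (s%:E * (t `^ (s - 1) * expR (- t))%:E)%E); last first.
    by apply/funext => t; rewrite /= EFinM.
  by apply: integrableZl.
suff : \int[mu]_(t in `]0%R, +oo[) f t = 0.
  rewrite /f RintegralB// RintegralZl//.
  by move/eqP; rewrite subr_eq0 => /eqP.
have dexp (x : R) : is_derive x 1 (fun x => expR (- x)) (- expR (- x)).
  have := @is_derive1_comp R expR -%R x _ _ (is_derive_expR _) (is_deriveNid _ _).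
  by rewrite mulrN1; exact.
have dF (x : R) : 0 < x -> is_derive x 1 F (f x).
  move=> x0; have ? := is_derive1_powR s x0.
  apply: is_derive_eq.
  by rewrite /GRing.scale/= /f addrK; ring.
suff H : (\int[mu]_(x in `]0%R, +oo[) (f x)%:E = (0 - 0)%:E)%E.
  by rewrite /Rintegral H subrr.
apply: (@improper_FTC_0y _ f F 0 0) => //.
- move=> x x0; apply: differentiable_continuous; apply/derivable1_diffP.
  have ? := is_derive1_powR (s - 1) x0; have ? := is_derive1_powR (s + 1 - 1) x0.
  by rewrite /f; apply: ex_derive.
- rewrite -[X in _ --> X](mul0r (expR (- 0))); apply: cvgM.
    exact: powR_cvg0.
  apply: cvg_at_right_filter; apply: (@continuous_comp _ _ _ -%R expR).
    exact: oppr_continuous.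
  exact: continuous_expR.
- apply: (@squeeze_cvgr _ _ _ _ (fun=> 0) (fun t => (2 * s) `^ s * expR (- (2^-1 * t)))).
  + near=> x; have x0 : 0 < x by near: x; exact: nbhs_pinfty_gt.
    rewrite mulr_ge0 ?powR_ge0 ?expR_ge0//=.
    rewrite (@le_trans _ _ ((2 * s) `^ s * expR (x / 2) * expR (- x)))//.
      by rewrite ler_wpM2r ?expR_ge0// powR_le_expR.
    rewrite -mulrA ler_wpM2l ?powR_ge0// -expRD ler_expR; lra.
  + exact: cvg_cst.
  + by rewrite -(mulr0 ((2 * s) `^ s)); apply: cvgMr; exact: cvg_expRN_pinfty.
- have := integrableB _ i1' i2; exact.
Unshelve. all: by end_near. Qed.

Lemma Gamma_gt0 s : 1 < s -> 0 < Gamma s.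
Proof.
move=> s1; have i := Gamma_integrable s1.
have I12 : `[1%R : R, 2]%classic `<=` `]0, +oo[.
  by move=> x /=; rewrite !in_itv/=; lra.
(* On [1, 2] one has t^(s-1) >= 1 and exp(-t) >= exp(-2). *)
apply: (@lt_le_trans _ _ (\int[mu]_(t in `[1%R, 2%R]) expR (- 2))).
  rewrite Rintegral_cst//= mulr_gt0 ?expR_gt0// lebesgue_measure_itv/=.
  by rewrite lte_fin ltr1n -EFinD/=; lra.
rewrite -lee_fin /Gamma /Rintegral !fineK.
- rewrite (@le_trans _ _ (\int[mu]_(t in `[1%R, 2%R]) (t `^ (s - 1) * expR (- t))%:E)%E)//.
    apply: ge0_le_integral => //.
    + apply/measurable_EFinP; apply: measurable_funM.
        by apply: measurable_funS (measurable_powR _).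
      apply: measurableT_comp => //; exact: measurable_funN.
    + move=> x; rewrite /= in_itv/= => /andP[x1 x2]; rewrite lee_fin.
      rewrite -[leLHS]mul1r ler_pM// ?expR_ge0 ?ler_expR; last by lra.
      by rewrite -[leLHS](powRr0 x) ler_powR// subr_ge0 ltW.
  apply: ge0_subset_integral => //.
  + by case/integrableP : i.
  + by move=> x _; rewrite lee_fin mulr_ge0 ?powR_ge0 ?expR_ge0.
- by apply: integrable_fin_num.
- by rewrite integral_cst//= lebesgue_measure_itv/= lte_fin ltr1n.
Qed.

End gamma.

(** * Bessel functions and their zeros *)

Section clifford_functions.
Context {R : realType}.
Implicit Types (nu x y : R).
Local Opaque Gamma.

(* C_nu(y) = y^(-nu/2) J_nu(2 sqrt y), a Bessel-Clifford function. *)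
Definition clifford_coef nu (m : nat) : R :=
  (-1) ^+ m / (m`!%:R * Gamma (m%:R + nu + 1)).

Definition clifford nu y : R := limn (pseries (clifford_coef nu) y).

Lemma GammaS nu m : 0 < nu ->
  Gamma (m.+1%:R + nu + 1) = (m%:R + nu + 1) * Gamma (m%:R + nu + 1).
Proof.
move=> nu0; rewrite -Gamma_rec; last by rewrite ltrDr ltr_wpDl.
by congr Gamma; rewrite -natr1; ring.
Qed.

Lemma Gamma_nat_gt0 nu m : 0 < nu -> 0 < Gamma (m%:R + nu + 1).
Proof. by move=> nu0; apply: Gamma_gt0; rewrite ltrDr ltr_wpDl. Qed.

Lemma Gamma_nat_ge nu m : 0 < nu -> Gamma (nu + 1) <= Gamma (m%:R + nu + 1).
Proof.
move=> nu0; elim: m => [|m ih]; first by rewrite mulr0n add0r.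
rewrite GammaS//; apply: (le_trans ih).
rewrite ler_peMl ?(ltW (Gamma_nat_gt0 m nu0))//.
by rewrite lerDr addr_ge0// ltW.
Qed.

(** The Gamma factors do not fall below the one at m = 0, so the exponential series is a majorant on
    the whole line. *)
Lemma clifford_coef_le nu m : 0 < nu ->
  `|clifford_coef nu m| <= (Gamma (nu + 1))^-1 / m`!%:R.
Proof.
move=> nu0; rewrite /clifford_coef normrM normrX normrN1 expr1n mul1r.
have G0 : 0 < Gamma (nu + 1) by have := Gamma_nat_gt0 0 nu0; rewrite add0r.
have -> : `|(m`!%:R * Gamma (m%:R + nu + 1))^-1| = (Gamma (m%:R + nu + 1))^-1 / m`!%:R.
  by rewrite ger0_norm ?invfM 1?mulrC// mulr_ge0// invr_ge0 ltW// Gamma_nat_gt0.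
apply: ler_wpM2r; first by rewrite invr_ge0 ler0n.
have Gm := Gamma_nat_gt0 m nu0.
by rewrite lef_pV2 ?posrE//; exact: Gamma_nat_ge.
Qed.

Lemma is_cvg_clifford nu y : 0 < nu -> cvgn (pseries (clifford_coef nu) y).
Proof.
move=> nu0; apply: normed_cvg.
have G0 : 0 < Gamma (nu + 1) by have := Gamma_nat_gt0 0 nu0; rewrite add0r.
pose v := (Gamma (nu + 1))^-1 *: exp_coeff `|y|.
apply: (@series_le_cvg _ _ v) => //=.
- by move=> n; rewrite /v /= mulr_ge0 ?invr_ge0 ?(ltW G0)// exp_coeff_ge0.
- move=> n; rewrite normrM normrX /v /exp_coeff/= /GRing.scale/=.
  rewrite [leRHS]mulrCA mulrC ler_wpM2l ?exprn_ge0//.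
  exact: clifford_coef_le.
- by apply: is_cvg_seriesZ; exact: is_cvg_series_exp_coeff.
Qed.

Lemma clifford_coef_diffs nu : 0 < nu ->
  pseries_diffs (clifford_coef nu) = - clifford_coef (nu + 1).
Proof.
move=> nu0; apply/funext => m; rewrite /pseries_diffs /clifford_coef.
rewrite fctE exprS factS natrM.
have -> : m.+1%:R + nu + 1 = m%:R + (nu + 1) + 1 :> R by rewrite -natr1; ring.
have := Gamma_nat_gt0 m (ltr_wpDr ler01 nu0).
set G := Gamma _ => G0; field.
by rewrite gt_eqF//= pnatr_eq0 -lt0n fact_gt0 /= lt0r_neq0 // -[X in 0 < X]/(1 + m%:R) natr1.
Qed.

Lemma pseriesN (c : R^nat) y : pseries (- c) y = - pseries c y.
Proof.
apply/funext => n; rewrite /pseries /series /= !fctE -sumrN.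
by apply: eq_bigr => i _; rewrite mulNr.
Qed.

Lemma is_cvg_clifford_diffs nu y : 0 < nu ->
  cvgn (pseries (pseries_diffs (clifford_coef nu)) y).
Proof.
move=> nu0; have nu1 : 0 < nu + 1 by rewrite ltr_wpDr.
by rewrite clifford_coef_diffs// pseriesN; apply: is_cvgN; exact: is_cvg_clifford.
Qed.

Lemma lim_clifford_diffs nu y : 0 < nu ->
  limn (pseries (pseries_diffs (clifford_coef nu)) y) = - clifford (nu + 1) y.
Proof.
move=> nu0; have nu1 : 0 < nu + 1 by rewrite ltr_wpDr.
by rewrite clifford_coef_diffs// pseriesN limN//; exact: is_cvg_clifford.
Qed.

Lemma is_derive_clifford nu y : 0 < nu ->
  is_derive y 1 (clifford nu) (- clifford (nu + 1) y).
Proof.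
move=> nu0; have nu1 : 0 < nu + 1 by rewrite ltr_wpDr.
rewrite -lim_clifford_diffs//.
apply: (@pseries_snd_diffs _ _ (`|y| + 1)).
- exact: is_cvg_clifford.
- exact: is_cvg_clifford_diffs.
- rewrite clifford_coef_diffs// pseries_diffsN clifford_coef_diffs// opprK.
  by apply: is_cvg_clifford; rewrite ltr_wpDr.
- have y1 : 0 <= `|y| + 1 by rewrite addr_ge0.
  by rewrite [ltRHS]ger0_norm// ltrDl.
Qed.

(** This is C_nu = (nu+1) C_(nu+1) + y C_(nu+1)', true coefficient by coefficient because
    Gamma(m+nu+2) = (m+nu+1) Gamma(m+nu+1). Combined with C_nu' = - C_(nu+1) it is the differential
    equation y C'' + (nu+1) C' + C = 0, and every later identity uses the equation in this form. *)
Lemma clifford_rec nu y : 0 < nu ->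
  clifford nu y = (nu + 1) * clifford (nu + 1) y - y * clifford (nu + 1 + 1) y.
Proof.
move=> nu0; have nu1 : 0 < nu + 1 by rewrite ltr_wpDr.
have c1 := @is_cvg_clifford _ y nu1.
have c2 : series (fun i => i%:R * clifford_coef (nu + 1) i * y ^+ i.-1) @ \oo
    --> - clifford (nu + 1 + 1) y.
  rewrite -lim_clifford_diffs//; apply: pseries_diffs_equiv.
  exact: is_cvg_clifford_diffs.
apply/cvg_lim => //.
rewrite -mulrN.
have -> : pseries (clifford_coef nu) y = fun n =>
    (nu + 1) * pseries (clifford_coef (nu + 1)) y n +
    y * series (fun i => i%:R * clifford_coef (nu + 1) i * y ^+ i.-1) n.
  apply/funext => n; rewrite /pseries /series/= !mulr_sumr -big_split/=.
  apply: eq_bigr => i _.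
  have -> : y * (i%:R * clifford_coef (nu + 1) i * y ^+ i.-1) =
            i%:R * clifford_coef (nu + 1) i * y ^+ i.
    by case: i => [|i]; rewrite ?mul0r ?mulr0// mulrCA -exprS.
  rewrite mulrA -mulrDl; congr (_ * _).
  rewrite /clifford_coef.
  have -> : i%:R + (nu + 1) + 1 = i.+1%:R + nu + 1 :> R by rewrite -natr1; ring.
  rewrite GammaS//; have := Gamma_nat_gt0 i nu0; set G := Gamma _ => G0.
  have i0 : i%:R + nu + 1 != 0 :> R by rewrite gt_eqF// ltr_wpDr// ltr_wpDl.
  by field; rewrite i0 gt_eqF//= pnatr_eq0 -lt0n fact_gt0.
by apply: cvgD; [exact: cvgMr|exact: cvgMr].
Qed.

Lemma clifford0_gt0 nu : 0 < nu -> 0 < clifford nu 0.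
Proof.
move=> nu0; suff -> : clifford nu 0 = (Gamma (nu + 1))^-1.
  by rewrite invr_gt0; have := Gamma_nat_gt0 0 nu0; rewrite add0r.
apply: lim_near_cst => //; near=> n.
have n0 : (0 < n)%N by near: n; exact: nbhs_infty_gt.
rewrite -(prednK n0) /pseries /series/= big_nat_recl//= big1 ?addr0.
  by rewrite /clifford_coef expr0 fact0 !mul1r add0r mulr1.
by move=> i _; rewrite expr0n mulr0.
Unshelve. all: by end_near. Qed.

Lemma besselJE nu x : 0 < nu -> 0 <= x ->
  besselJ nu x = (x / 2) `^ nu * clifford nu (x ^+ 2 / 4).
Proof.
move=> nu0 x0; rewrite /besselJ; apply/cvg_lim => //.
rewrite [X in X @ _ --> _](_ : _ = fun n =>
  (x / 2) `^ nu * pseries (clifford_coef nu) (x ^+ 2 / 4) n); last first.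
  apply/funext => n; rewrite /pseries /series/= mulr_sumr; apply: eq_bigr => m _.
  rewrite powRD; last first.
    by apply/implyP; rewrite gt_eqF// ltr_wpDl// mulr_ge0.
  rewrite -natrM powR_mulrn ?divr_ge0// exprM -/(clifford_coef nu m).
  have -> : (x / 2) ^+ 2 = x ^+ 2 / 4 by field.
  move: (clifford_coef nu m) ((x ^+ 2 / 4) ^+ m) ((x / 2) `^ nu) => c P X.
  by ring.
by apply: cvgMr; exact: is_cvg_clifford.
Qed.

End clifford_functions.

(** * Existence, isolation and unboundedness of the zeros *)

Section bessel_zeros.
Context {R : realType}.
Implicit Types (nu x y t z : R).
Local Opaque Gamma clifford.

Lemma is_derive_cvg (f : R -> R) (x d : R) :
  is_derive x 1 f d -> f y @[y --> x] --> f x.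
Proof.
by case=> df _; apply: differentiable_continuous; apply/derivable1_diffP.
Qed.

Lemma powRDgt0 x (r s : R) : 0 < x -> x `^ (r + s) = x `^ r * x `^ s.
Proof. by move=> x0; rewrite powRD// (gt_eqF x0) implybT. Qed.

Lemma powRS x (r : R) : 0 < x -> x `^ (r + 1) = x * x `^ r.
Proof. by move=> x0; rewrite powRDgt0// powRr1 1?mulrC// ltW. Qed.

Lemma ge0_is_derive_le (f df : R -> R) (a b : R) : a <= b ->
  (forall x : R, a <= x <= b -> is_derive x 1 f (df x)) ->
  (forall x : R, a < x < b -> 0 <= df x) -> f a <= f b.
Proof.
move=> ab dfE df0; move: ab; rewrite le_eqVlt => /predU1P[->//|ab].
have [|| c] := @MVT _ f df a b ab.
- by move=> x /[!in_itv]/= /andP[ax xb]; apply: dfE; rewrite !ltW.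
- apply: derivable_within_continuous => x /[!in_itv]/= xab.
  by case: (dfE _ xab).
rewrite in_itv/= => cab fab; rewrite -subr_ge0 fab.
by rewrite mulr_ge0 ?df0// subr_ge0 ltW.
Qed.

Lemma continuous_clifford nu : 0 < nu -> continuous (clifford nu).
Proof.
move=> nu0 x; apply: differentiable_continuous; apply/derivable1_diffP.
by case: (is_derive_clifford x nu0).
Qed.

(* The derivative of the energy is (2 nu + 1) y^(2 nu) C_nu(y)^2. *)
Lemma clifford_energy_le nu (s t : R) : 0 < nu -> 0 < s <= t ->
  s `^ (2 * nu + 1) * (clifford nu s ^+ 2 + s * clifford (nu + 1) s ^+ 2) <=
  t `^ (2 * nu + 1) * (clifford nu t ^+ 2 + t * clifford (nu + 1) t ^+ 2).
Proof.
move=> nu0 /andP[s0 st]; have nu1 : 0 < nu + 1 by rewrite ltr_wpDr.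
have : forall x : R, is_derive x 1 (clifford nu) (- clifford (nu + 1) x).
  by move=> x; exact: is_derive_clifford.
have : forall x : R, is_derive x 1 (clifford (nu + 1)) (- clifford (nu + 1 + 1) x).
  by move=> x; exact: is_derive_clifford.
have : forall x, clifford nu x = (nu + 1) * clifford (nu + 1) x - x * clifford (nu + 1 + 1) x.
  by move=> x; exact: clifford_rec.
move: (clifford nu) (clifford (nu + 1)) (clifford (nu + 1 + 1)) => G H K GE dH dG.
pose e x := x `^ (2 * nu + 1) * (G x ^+ 2 + x * H x ^+ 2).
apply: (@ge0_is_derive_le e (fun x => (2 * nu + 1) * x `^ (2 * nu) * G x ^+ 2)) => //.
  move=> x /andP[sx _]; have x0 := lt_le_trans s0 sx.
  have ? := is_derive1_powR (2 * nu + 1) x0.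
  apply: is_derive_eq.
  rewrite /GRing.scale/= addrK.
  rewrite powRS// GE; ring.
move=> x /andP[sx _]; rewrite mulr_ge0 ?sqr_ge0// mulr_ge0 ?powR_ge0//.
by rewrite addr_ge0// mulr_ge0// ltW.
Qed.

(** A common zero at t > 0 makes the energy vanish there, hence on all of (0, t] by monotonicity;
    then C_nu = 0 on (0, t], against C_nu(0) > 0 and continuity. *)
Lemma clifford_zero_neq0 nu t : 0 < nu -> 0 <= t -> clifford (nu + 1) t = 0 ->
  clifford nu t != 0.
Proof.
move=> nu0; rewrite le_eqVlt => /predU1P[<- _|t0 Ht].
  by rewrite gt_eqF// clifford0_gt0.
apply/negP => /eqP Gt.
have G0 (s : R) : 0 < s <= t -> clifford nu s = 0.
  move=> st; have := clifford_energy_le nu0 st.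
  rewrite Ht Gt expr0n/= mulr0 addr0 mulr0 pmulr_rle0; last first.
    by rewrite powR_gt0; case/andP : st.
  have s0 : 0 < s by case/andP : st.
  move=> le0; apply/eqP; rewrite -sqrf_eq0 eq_le sqr_ge0 andbT.
  apply: le_trans le0; rewrite lerDl mulr_ge0 ?sqr_ge0//; exact: ltW.
have : clifford nu s @[s --> 0^'+] --> clifford nu 0.
  by apply: cvg_at_right_filter; exact: continuous_clifford.
have : clifford nu s @[s --> 0^'+] --> (0 : R).
  apply: cvg_near_cst; near=> s; apply: G0; apply/andP; split.
    by near: s; exact: nbhs_right_gt.
  by near: s; exact: nbhs_right_le.
move=> h1 h2; have /eqP : 0 = clifford nu 0.
  exact: (cvg_unique (@norm_hausdorff _ R) h1 h2).
by rewrite lt_eqF// clifford0_gt0.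
Unshelve. all: by end_near. Qed.

Lemma is_derive_clifford_sqr nu x : 0 < nu ->
  is_derive x 1 (fun x => clifford nu (x ^+ 2 / 4))
    (- (x / 2) * clifford (nu + 1) (x ^+ 2 / 4)).
Proof.
move=> nu0; have d1 : is_derive x 1 (fun x : R => x ^+ 2 / 4) (x / 2).
  apply: is_derive_eq; rewrite /GRing.scale/=; by field.
have := @is_derive1_comp R (clifford nu) (fun x => x ^+ 2 / 4) x _ _
  (is_derive_clifford _ nu0) d1.
by rewrite mulNr mulrC -mulNr mulrC.
Qed.

Lemma besselJ_eq0 nu x : 0 < nu -> 0 < x ->
  (besselJ nu x == 0) = (clifford nu (x ^+ 2 / 4) == 0).
Proof.
move=> nu0 x0; rewrite besselJE//; last exact: ltW.
have x2 : 0 < x / 2 by rewrite divr_gt0.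
by rewrite mulf_eq0 (gt_eqF (powR_gt0 _ x2)).
Qed.

(* x^(nu+1/2) h(x) solves u'' = - (1 - (nu^2 - 1/4) / x^2) u when h(x) is the
   power series of x^(-nu) J_nu(x); this differentiates its Wronskian against
   S(x) = sin((x - B) / 2). *)
Lemma is_derive_bessel_wronskian nu x (s L : R) (h K S C : R -> R) : 0 < x ->
  is_derive x 1 h (- (x / 2) * K x) -> is_derive x 1 K (- (x / 2) * L) ->
  is_derive x 1 S (C x / 2) -> is_derive x 1 C (- S x / 2) ->
  h x = (nu + 1) * K x - x ^+ 2 / 4 * L ->
  is_derive x 1 (fun x => s * (x `^ (nu + 2^-1) * h x * (C x / 2) -
    ((nu + 2^-1) * x `^ (nu + 2^-1 - 1) * h x - x `^ (nu + 2^-1 + 1) / 2 * K x) * S x))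
  ((3 / 4 - (nu ^+ 2 - 4^-1) / x ^+ 2) * x `^ (nu + 2^-1) * (s * h x) * S x).
Proof.
move=> x0 dh dK dS dC hE.
have ? := is_derive1_powR (nu + 2^-1) x0.
have ? := is_derive1_powR (nu + 2^-1 - 1) x0.
have ? := is_derive1_powR (nu + 2^-1 + 1) x0.
apply: is_derive_eq; rewrite /GRing.scale/= addrK.
set d := nu + 2^-1 - 1 - 1.
have -> : nu + 2^-1 - 1 = d + 1 by rewrite /d; ring.
have -> : nu + 2^-1 + 1 = d + 1 + 1 + 1 by rewrite /d; ring.
have -> : x `^ (nu + 2^-1) = x `^ (d + 1 + 1) by congr (_ `^ _); rewrite /d; ring.
have nuE : nu = d + 1 + 2^-1 by rewrite /d; field.
rewrite !powRS// hE; clearbody d; rewrite nuE; field.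
by rewrite gt_eqF.
Qed.

(** Sturm comparison on [B, B + 2 pi], the half period of sin((x - B)/2). Were there no zero beyond
    A, [h] would keep its sign there and the Wronskian [W] would be nondecreasing, although it is
    positive at the left end and negative at the right end. *)
Lemma besselJ_zero_unbounded nu (A : R) : 0 < nu ->
  exists x : R, A < x /\ besselJ nu x = 0.
Proof.
move=> nu0; have nu1 : 0 < nu + 1 by rewrite ltr_wpDr.
have nu2 : 0 < nu + 1 + 1 by rewrite ltr_wpDr.
(* For x >= 2 nu the coefficient 1 - (nu^2 - 1/4)/x^2 is at least 1/4, the coefficient of the
   comparison equation S'' = - S/4. *)
pose B := Num.max (A + 1) (2 * nu + 1).
have AB : A < B by rewrite lt_max ltrDl ltr01.
have B1 : 2 * nu + 1 <= B by rewrite le_max lexx orbT.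
have B0 : 0 < B by apply: lt_le_trans B1; rewrite ltr_wpDl// mulr_ge0// ltW.
apply: contrapT => /forallNP Jn0.
have h0 x : B <= x -> clifford nu (x ^+ 2 / 4) != 0.
  move=> Bx; have x0 := lt_le_trans B0 Bx.
  rewrite -besselJ_eq0//; apply/negP => /eqP Jx.
  by apply: (Jn0 x); split => //; exact: lt_le_trans Bx.
pose h x := clifford nu (x ^+ 2 / 4).
have dh (x : R) : is_derive x 1 h (- (x / 2) * clifford (nu + 1) (x ^+ 2 / 4)).
  exact: is_derive_clifford_sqr.
(* Multiplying by the sign treats h > 0 and h < 0 together. *)
pose s := Num.sg (h B).
have hs x : B <= x -> 0 < s * h x.
  move=> Bx; rewrite ltNge; apply/negP => shx.
  have shB : 0 < s * h B by rewrite /s -normrEsg normr_gt0 h0.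
  have [| | c] := @IVT _ (fun x => s * h x) B x 0 Bx.
  - apply: derivable_within_continuous => y _.
    by have ? := dh y; apply: ex_derive.
  - by rewrite ge_min shx orbT/= le_max (ltW shB).
  rewrite in_itv/= => /andP[Bc _] /eqP; rewrite mulf_eq0 (negPf (h0 _ Bc)) orbF.
  by rewrite sgr_eq0 (negPf (h0 _ (lexx B))).
pose c := nu + 2^-1.
pose K x := clifford (nu + 1) (x ^+ 2 / 4).
pose u x := x `^ c * h x.
(* [u1] is the derivative of [u], since h'(x) = - (x/2) K(x). *)
pose u1 x := c * x `^ (c - 1) * h x - x `^ (c + 1) / 2 * K x.
pose W x := s * (u x * (cos ((x - B) / 2) / 2) - u1 x * sin ((x - B) / 2)).
have dK (x : R) : is_derive x 1 K (- (x / 2) * clifford (nu + 1 + 1) (x ^+ 2 / 4)).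
  exact: is_derive_clifford_sqr.
have dl (x : R) : is_derive x 1 (fun x : R => (x - B) / 2) 2^-1.
  by apply: is_derive_eq; rewrite /GRing.scale/=; field.
have dsin (x : R) : is_derive x 1 (fun x => sin ((x - B) / 2)) (cos ((x - B) / 2) / 2).
  exact: (@is_derive1_comp R sin (fun x => (x - B) / 2) x _ _ (is_derive_sin _) (dl x)).
have dcos (x : R) : is_derive x 1 (fun x => cos ((x - B) / 2)) (- sin ((x - B) / 2) / 2).
  exact: (@is_derive1_comp R cos (fun x => (x - B) / 2) x _ _ (is_derive_cos _) (dl x)).
have := @ge0_is_derive_le W (fun x => (3 / 4 - (nu ^+ 2 - 4^-1) / x ^+ 2) *
  x `^ c * (s * h x) * sin ((x - B) / 2)) B (B + 2 * pi).
have Bpi : B <= B + 2 * pi by rewrite lerDl mulr_ge0// pi_ge0.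
move/(_ Bpi).
have -> : W B = s * h B * (B `^ c / 2).
  by rewrite /W subrr mul0r cos0 sin0 /u; ring.
have -> : W (B + 2 * pi) = - (s * h (B + 2 * pi) * ((B + 2 * pi) `^ c / 2)).
  have -> : W (B + 2 * pi) = s * (u (B + 2 * pi) * (cos pi / 2) - u1 (B + 2 * pi) * sin pi).
    by rewrite /W; have -> : (B + 2 * pi - B) / 2 = pi by field.
  by rewrite cospi sinpi /u; ring.
move=> WW; suff : s * h B * (B `^ c / 2) <= - (s * h (B + 2 * pi) * ((B + 2 * pi) `^ c / 2)).
  apply/negP; rewrite -ltNge (@lt_trans _ _ 0)//.
    rewrite oppr_lt0 mulr_gt0 ?hs// divr_gt0// powR_gt0//.
    exact: lt_le_trans Bpi.
  by rewrite mulr_gt0 ?hs// divr_gt0// powR_gt0.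
apply: WW.
- move=> x /andP[Bx _]; have x0 := lt_le_trans B0 Bx.
  have hE : h x = (nu + 1) * K x - x ^+ 2 / 4 * clifford (nu + 1 + 1) (x ^+ 2 / 4).
    exact: clifford_rec.
  exact: (is_derive_bessel_wronskian s x0 (dh x) (dK x) (dsin x) (dcos x) hE).
- move=> x /andP[Bx xB]; have x0 := lt_trans B0 Bx.
  rewrite mulr_ge0//; last first.
    apply: sin_ge0_pi; lra.
  rewrite mulr_ge0//; last by rewrite ltW// hs// ltW.
  rewrite mulr_ge0 ?powR_ge0// subr_ge0 ler_pdivrMr ?exprn_gt0//.
  have : (2 * nu) ^+ 2 <= x ^+ 2.
    by rewrite lerXn2r// ?nnegrE; lra.
  rewrite exprMn => ?; nra.
Qed.

(** A positive zero is simple: if C_(nu+1) and its derivative - C_(nu+2) vanished together, the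
    recurrence would give C_nu = 0 too, against [clifford_zero_neq0]. At z = 0, the start of the
    recursion for the zeros, C_(nu+1)(0) > 0 suffices. Isolation to the right is what the successive
    infima require. *)
Lemma bessel_zero_isolated nu z : 0 < nu -> 0 <= z ->
  z = 0 \/ besselJ (nu + 1) z = 0 ->
  exists2 d : R, 0 < d & forall x, z < x < z + d -> besselJ (nu + 1) x != 0.
Proof.
move=> nu0 z0 Jz; have nu1 : 0 < nu + 1 by rewrite ltr_wpDr.
suff : \forall x \near z^'+, clifford (nu + 1) (x ^+ 2 / 4) != 0.
  move=> [d /= d0 dz]; exists d => // x /andP[zx xd].
  rewrite besselJ_eq0//; last exact: le_lt_trans zx.
  by apply: dz => //=; rewrite ltr0_norm ?opprB ?subr_lt0// ltrBlDl.
have dh := is_derive_clifford_sqr z nu1.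
have [z00|zn0] := eqVneq z 0.
  apply: (@cvgr_neq0 _ _ _ _ _ _ (clifford (nu + 1) 0)); last first.
    by rewrite gt_eqF// clifford0_gt0.
  apply: cvg_at_right_filter; have := is_derive_cvg dh.
  by rewrite z00 expr0n mul0r.
have zgt0 : 0 < z by rewrite lt_neqAle eq_sym zn0.
have Hz : clifford (nu + 1) (z ^+ 2 / 4) = 0.
  by apply/eqP; case: Jz => [/eqP|/eqP]; rewrite ?(negPf zn0)// besselJ_eq0.
have Gz := clifford_zero_neq0 nu0 (_ : 0 <= z ^+ 2 / 4) Hz.
have zq : 0 < z ^+ 2 / 4 by rewrite divr_gt0// exprn_gt0.
have Kz : clifford (nu + 1 + 1) (z ^+ 2 / 4) != 0.
  apply: contra_neq (Gz (ltW zq)) => Kz.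
  by rewrite clifford_rec// Hz Kz !mulr0 subr0.
have dn0 : - (z / 2) * clifford (nu + 1 + 1) (z ^+ 2 / 4) != 0.
  by rewrite mulf_neq0// oppr_eq0 gt_eqF// divr_gt0.
have [dx dxE] := dh.
have := dx; rewrite /derivable => /cvg_ex [l /= hl].
(* The difference quotient at the zero has a nonzero limit, so it, and hence the function, is
   nonzero close to z. *)
have lE : l = - (z / 2) * clifford (nu + 1 + 1) (z ^+ 2 / 4).
  by rewrite -dxE; apply/esym/cvg_lim.
rewrite lE in hl.
have := @cvgr_neq0 _ _ _ _ _ _ _ hl dn0.
move=> [d /= d0 dz]; exists d => //= x /= xd zx.
have := dz (x - z); rewrite /ball_/= sub0r normrN distrC => /(_ xd).
rewrite subr_eq0 gt_eqF// => /(_ isT).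
rewrite /GRing.scale/= mulr1 subrK Hz subr0 mulf_eq0 negb_or => /andP[_].
by [].
Qed.

(** Isolation puts the infimum strictly beyond the previous zero. The infimum is attained: otherwise
    continuity would leave an interval free of zeros to its right, contradicting that zeros come
    arbitrarily close to it. *)
Lemma bessel_zero_spec nu k : 0 < nu ->
  [/\ 0 <= bessel_zero (nu + 1) k,
      bessel_zero (nu + 1) k < bessel_zero (nu + 1) k.+1 &
      besselJ (nu + 1) (bessel_zero (nu + 1) k.+1) = 0].
Proof.
move=> nu0; have nu1 : 0 < nu + 1 by rewrite ltr_wpDr.
have step z : 0 <= z -> z = 0 \/ besselJ (nu + 1) z = 0 ->
    let w := inf [set x : R | z < x /\ besselJ (nu + 1) x = 0] in
    z < w /\ besselJ (nu + 1) w = 0.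
  move=> z0 Jz w; set S := [set x | _] in w *.
  have [d d0 dz] := bessel_zero_isolated nu0 z0 Jz.
  have S0 : S !=set0 by have [x [zx Jx]] := besselJ_zero_unbounded z nu1; exists x.
  have lbS : lbound S (z + d).
    move=> x [zx Jx]; rewrite leNgt; apply/negP => xd.
    by have := dz x; rewrite zx xd => /(_ isT); rewrite Jx eqxx.
  have zdw : z + d <= w by apply: lb_le_inf.
  have zw : z < w by apply: lt_le_trans zdw; rewrite ltrDl.
  have w0 : 0 < w by exact: le_lt_trans zw.
  split => //; apply/eqP; rewrite besselJ_eq0//; apply/negP => /negP Jw.
  pose h x := clifford (nu + 1) (x ^+ 2 / 4).
  have ch : h x @[x --> w] --> h w.
    exact: (is_derive_cvg (is_derive_clifford_sqr w nu1)).
  have [e /= e0 ew] := @cvgr_neq0 _ _ _ _ _ _ _ ch Jw.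
  have [|s [zs Js] sw] := @inf_adherent _ S e e0.
    by split => //; exists (z + d).
  have ws : w <= s by apply: ge_inf => //; exists (z + d).
  have := ew s; rewrite /ball_/= distrC ger0_norm ?subr_ge0// ltrBlDl => /(_ sw).
  by rewrite /h -besselJ_eq0 ?Js ?eqxx// (lt_le_trans w0).
have ge0 j : 0 <= bessel_zero (nu + 1) j /\
    (bessel_zero (nu + 1) j = 0 \/ besselJ (nu + 1) (bessel_zero (nu + 1) j) = 0).
  elim: j => [|j [j0 Jj]]; first by split => //; left.
  have [lt0 J0] := step _ j0 Jj; split; last by right.
  exact: le_trans j0 (ltW lt0).
have [k0 Jk] := ge0 k; have [ltk J0] := step _ k0 Jk.
by split.
Qed.

End bessel_zeros.

(** * Measures with density *)

Section density.
Context d (T : measurableType d) (R : realType).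
Variables (m n : {measure set T -> \bar R}) (w : T -> R).
Hypotheses (w0 : forall x, 0 <= w x) (mw : measurable_fun setT w)
  (nE : forall A, measurable A -> n A = (\int[m]_(x in A) (w x)%:E)%E).

Import HBNNSimple.

Let nnsfun_density (h : {nnsfun T >-> R}) :
  (\int[n]_x (h x)%:E = \int[m]_x (h x * w x)%:E)%E.
Proof.
rewrite integralT_nnsfun sintegralE.
transitivity (\int[m]_x (\sum_(y \in range h) ((y * \1_(h @^-1` [set y]) x * w x)%:E))%E)%E; last first.
  apply: eq_integral => x _; rewrite fsumEFin// [in RHS](fimfunE h x).
  by rewrite -mulr_fsuml.
rewrite ge0_integral_fsum//; last 2 first.
- move=> y; apply/measurable_EFinP; apply: measurable_funM => //.
  exact: measurable_funM.
- move=> y x _; rewrite lee_fin mulr_ge0//.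
  by have := nnfun_muleindic_ge0 h y x; rewrite -EFinM lee_fin.
apply: eq_fsbigr => y /[!inE] -[x _ <-].
rewrite nE//; have hx0 : (0 <= (h x)%:E)%E by rewrite lee_fin.
rewrite integral_mkcond -ge0_integralZl//; last 2 first.
- have mA : measurable (h @^-1` [set h x]) by exact: measurable_sfunP.
  apply/(measurable_restrictT _ mA); apply: measurable_funTS.
  exact/measurable_EFinP.
- by move=> z _; apply: erestrict_ge0 => t _; rewrite lee_fin.
apply: eq_integral => z _; rewrite patchE indicE.
by case: ifPn => /= zh; rewrite ?mulr1 ?mulr0 ?mul0r ?mule0// EFinM.
Qed.

Lemma ge0_integral_density (f : T -> R) : measurable_fun setT f ->
  (forall x, 0 <= f x) -> (\int[n]_x (f x)%:E = \int[m]_x (f x * w x)%:E)%E.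
Proof.
move=> mf f0.
have mEf : measurable_fun setT (EFin \o f) by exact/measurable_EFinP.
pose h := nnsfun_approx measurableT mEf.
have hcvg x : (h k x)%:E @[k --> \oo] --> (f x)%:E.
  by apply: cvg_nnsfun_approx => // t _; rewrite lee_fin.
transitivity (limn (fun k => \int[n]_x (h k x)%:E)%E).
  rewrite -monotone_convergence//=.
  - by apply: eq_integral => x _; apply/esym/cvg_lim => //; exact: hcvg.
  - by move=> k; exact/measurable_EFinP.
  - by move=> k x _; rewrite lee_fin.
  - by move=> x _ a b ab; rewrite lee_fin//; exact/lefP/nd_nnsfun_approx.
under eq_fun do rewrite nnsfun_density.
rewrite -monotone_convergence//=.
- apply: eq_integral => x _; apply/cvg_lim => //.
  under eq_fun do rewrite EFinM; rewrite EFinM.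
  by apply: cvgeZr => //; exact: hcvg.
- by move=> k; apply/measurable_EFinP; exact: measurable_funM.
- by move=> k x _; rewrite lee_fin mulr_ge0.
- move=> x _ a b ab; rewrite lee_fin ler_wpM2r//.
  exact/lefP/nd_nnsfun_approx.
Qed.

(** Multiplication by w >= 0 commutes with taking positive and negative parts. *)
Lemma integral_density (f : T -> R) : measurable_fun setT f ->
  (\int[n]_x (f x)%:E = \int[m]_x (f x * w x)%:E)%E.
Proof.
move=> mf; rewrite integralE [in RHS]integralE; congr (_ - _)%E.
- transitivity (\int[n]_x (Num.max (f x) 0)%:E)%E.
    by apply: eq_integral => x _; rewrite funeposE -EFin_max.
  rewrite ge0_integral_density; last 2 first.
  + exact: measurable_funrpos.
  + by move=> x; rewrite le_max lexx orbT.
  apply: eq_integral => x _.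
  by rewrite funeposE -EFin_max maxr_pMl// mul0r.
- transitivity (\int[n]_x (Num.max (- f x) 0)%:E)%E.
    by apply: eq_integral => x _; rewrite funenegE -EFinN -EFin_max.
  rewrite ge0_integral_density; last 2 first.
  + exact: measurable_funrneg.
  + by move=> x; rewrite le_max lexx orbT.
  apply: eq_integral => x _.
  by rewrite funenegE -EFinN -EFin_max maxr_pMl// mul0r mulNr.
Qed.

Lemma integrable_density (f : T -> R) : measurable_fun setT f ->
  n.-integrable setT (EFin \o f) <-> m.-integrable setT (fun x => (f x * w x)%:E).
Proof.
move=> mf.
have E : (\int[n]_x `|(f x)%:E| = \int[m]_x `|(f x * w x)%:E|)%E.
  rewrite (@ge0_integral_density (fun x => `|f x|))//; last exact: measurableT_comp.
  by apply: eq_integral => x _; rewrite /= normrM (ger0_norm (w0 x)).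
split => /integrableP[_]; rewrite ?E => fi; apply/integrableP; split => //.
- by apply/measurable_EFinP; exact: measurable_funM.
- exact/measurable_EFinP.
- by rewrite E.
Qed.

End density.

(** * Lebesgue measure on an interval and the weighted measure on (0,1) *)

Section weighted_measures.
Context {R : realType}.
Implicit Types (f g : R -> R).
Let leb := @lebesgue_measure R.

Let ind01 (beta x : R) : R := \1_(`]0, 1[%classic) x * x `^ beta.

Lemma lebesgue_on_densityE (i : interval R) (A : set (measurableTypeR R)) :
  measurable A ->
  lebesgue_on i A = (\int[leb]_(x in A) (\1_([set` i]) x)%:E)%E.
Proof.
by move=> mA; rewrite integral_indic// setIC.
Qed.

Lemma integral_lebesgue_on (i : interval R) f : measurable_fun setT f ->
  (\int[lebesgue_on i]_x (f x)%:E = \int[leb]_(x in [set` i]) (f x)%:E)%E.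
Proof.
move=> mf; rewrite (@integral_density _ _ _ leb _ _ _ _ (@lebesgue_on_densityE i))//.
  rewrite [RHS]integral_mkcond; apply: eq_integral => x _.
  by rewrite patchE indicE; case: ifPn => /= xi; rewrite ?mulr1 ?mulr0.
Qed.

Lemma integrable_lebesgue_on (i : interval R) f : measurable_fun setT f ->
  (lebesgue_on i).-integrable setT (EFin \o f) <->
  leb.-integrable [set` i] (EFin \o f).
Proof.
move=> mf.
apply: (iff_trans (@integrable_density _ _ _ leb _ _ _ _ (@lebesgue_on_densityE i) _ mf)) => //.
suff -> : (fun x => (f x * \1_[set` i] x)%:E) = (EFin \o f) \_ [set` i].
  by apply: iff_sym; exact: integrable_mkcond.
apply/funext => x; rewrite patchE indicE.
by case: ifPn => /= xi; rewrite ?mulr1 ?mulr0.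
Qed.

Lemma weight_densityE (beta : R) (A : set (measurableTypeR R)) :
  measurable A -> weight beta A = (\int[leb]_(x in A) (ind01 beta x)%:E)%E.
Proof.
move=> mA; rewrite /weight/= /weight_fun [LHS]integral_mkcond.
have -> : (fun x : R => (x `^ beta)%:E) \_ A = EFin \o ((fun x => x `^ beta) \_ A).
  by rewrite restrict_EFin.
rewrite integral_lebesgue_on; last first.
  apply/(measurable_restrictT _ mA); apply: measurable_funTS.
  exact: measurable_powR.
rewrite integral_mkcond [RHS]integral_mkcond; apply: eq_integral => x _.
rewrite !patchE /ind01 indicE.
by case: ifPn => /= xi; case: ifPn => //= xA; rewrite ?mul1r ?mul0r.
Qed.

Let ind01_ge0 beta x : 0 <= ind01 beta x.
Proof. by rewrite mulr_ge0// powR_ge0. Qed.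

Let measurable_ind01 beta : measurable_fun setT (ind01 beta).
Proof. by apply: measurable_funM => //; exact: measurable_powR. Qed.

Lemma integral_weight (beta : R) f : measurable_fun setT f ->
  (\int[weight beta]_x (f x)%:E =
   \int[leb]_(x in `]0%R, 1%R[) (f x * x `^ beta)%:E)%E.
Proof.
move=> mf; rewrite (@integral_density _ _ _ leb _ _ (ind01_ge0 beta) (@measurable_ind01 beta)
  (@weight_densityE beta))//.
rewrite [RHS]integral_mkcond; apply: eq_integral => x _.
by rewrite patchE /ind01 indicE; case: ifPn => /= xi; rewrite ?mul1r// !mul0r mulr0.
Qed.

Lemma integrable_weight (beta : R) f : measurable_fun setT f ->
  (weight beta).-integrable setT (EFin \o f) <->
  leb.-integrable `]0, 1[ (fun x => (f x * x `^ beta)%:E).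
Proof.
move=> mf.
apply: (iff_trans (@integrable_density _ _ _ leb _ _ (ind01_ge0 beta)
  (@measurable_ind01 beta) (@weight_densityE beta) _ mf)) => //.
suff -> : (fun x => (f x * ind01 beta x)%:E) =
    (fun x => (f x * x `^ beta)%:E) \_ `]0, 1[.
  by apply: iff_sym; exact: integrable_mkcond.
apply/funext => x; rewrite patchE /ind01 indicE.
by case: ifPn => /= xi; rewrite ?mul1r// mul0r mulr0.
Qed.

Lemma weight_ae01 (beta : R) (P : R -> Prop) :
  (forall x : R, 0 < x < 1 -> P x) -> {ae weight beta, forall x, P x}.
Proof.
move=> P01; exists (~` `]0, 1[%classic); split => //.
- exact: measurableC.
- rewrite weight_densityE; last exact: measurableC.
  rewrite integral0_eq// => x /= x01; rewrite /ind01 indicE.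
  by rewrite memNset// mul0r.
- by move=> x /= nP; apply: contra_not nP; rewrite /= in_itv/=; exact: P01.
Qed.

(** Two continuous functions that differ at a point differ on an interval around it, and such an
    interval has positive weight. This is what makes the left limit at 1 a property of the class. *)
Lemma weight_ae_eq_continuous (beta : R) f g :
  {in `]0, 1[, continuous f} -> {in `]0, 1[, continuous g} ->
  f = g %[ae weight beta] -> forall x : R, 0 < x < 1 -> f x = g x.
Proof.
move=> cf cg [N [mN N0 fgN]] x x01; apply: contrapT => fgx.
have xI : x \in `]0%R, 1%R[ by rewrite in_itv.
have cfg : (f y - g y) @[y --> x] --> f x - g x.
  by apply: cvgB; [exact: cf|exact: cg].
have fgx0 : f x - g x != 0 by rewrite subr_eq0; apply/eqP.
have near0 : \forall y \near x, f y - g y != 0 by exact: (cvgr_neq0 _ cfg fgx0).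
have nearI : \forall y \near x, y \in `]0%R, 1%R[ by exact: near_in_itvoo.
have [e /= e0 eU] : nbhs x (fun y => f y - g y != 0 /\ y \in `]0%R, 1%R[).
  exact: filterI near0 nearI.
pose U : set (measurableTypeR R) := `]x - e, x + e[%classic.
have UI y : U y -> f y - g y != 0 /\ y \in `]0%R, 1%R[.
  rewrite /U/= in_itv/= => xy; apply: eU => /=.
  by rewrite ltr_distlC.
have mU : measurable U by exact: measurable_itv.
have UN : U `<=` N.
  move=> y Uy; apply: fgN => /= fgy; have [+ _] := UI _ Uy.
  by rewrite fgy ?subrr ?eqxx.
have U0 : weight beta U = 0%E by apply: (subset_measure0 _ _ UN N0).
move: U0; rewrite weight_densityE// => intU.
(* As the density x^beta is positive on [U], zero weight forces zero Lebesgue measure, whereas [U]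
   has length 2 e. *)
have : (\int[leb]_(x in U) `|(ind01 beta x)%:E| = 0)%E.
  by rewrite -[RHS]intU; apply: eq_integral => y _; rewrite gee0_abs// lee_fin.
have mi : measurable_fun U (fun x => (ind01 beta x)%:E).
  by apply/measurable_EFinP; apply: measurable_funTS; exact: measurable_ind01.
move=> /(ae_eq_integral_abs leb mU mi) [N' [mN' N'0 UN']].
have : (leb U <= leb N')%E.
  apply: le_measure; rewrite ?inE// => y Uy; apply: UN' => /= /(_ Uy) [].
  have [_ yI] := UI _ Uy; rewrite /ind01 indicE mem_set// mul1r => /eqP.
  rewrite powR_eq0; move: yI; rewrite in_itv/= => /andP[y0 _].
  by rewrite gt_eqF.
rewrite [X in (_ <= X)%E](_ : _ = 0%E)// /U /leb lebesgue_measure_itv/= lte_fin.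
rewrite ifT; last by lra.
by rewrite -EFinB lee_fin; apply/negP; rewrite -ltNge; lra.
Qed.

End weighted_measures.

(** * L2 spaces and orthonormal expansions *)

Section L2_theory.
Context {R : realType}.
Variable m : {measure set (measurableTypeR R) -> \bar R}.
Implicit Types (f g h : L2 m) (a : R).
Local Notation "'<<' f , g '>>'" := (L2inner m f g).

Lemma measurable_L2 f : measurable_fun setT (f : R -> R).
Proof. by have := LfunP f; rewrite inE => /andP[]; rewrite inE. Qed.

Lemma L2_integrableM f g : m.-integrable setT (EFin \o (fun x => f x * g x)).
Proof.
apply/Lfun1_integrable; exact: (Lfun2_mul_Lfun1 (LfunP f) (LfunP g)).
Qed.

Lemma mem_L2 (f : R -> R) : measurable_fun setT f ->
  m.-integrable setT (EFin \o (fun x => f x * f x)) -> f \in Lfun m 2%:E.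
Proof.
move=> mf /integrableP[_ fi]; rewrite inE; apply/andP; split; rewrite inE//=.
rewrite /finite_norm unlock poweR_lty//.
rewrite (_ : (\int[m]_x _)%E = (\int[m]_x `|(f x * f x)%:E|)%E)//.
by apply: eq_integral => x _; rewrite /= normrM powR_mulrn.
Qed.

Lemma L2innerC (f g : R -> R) : << f, g >> = << g, f >>.
Proof. by apply: eq_Rintegral => x _; rewrite mulrC. Qed.

Lemma L2innerDl f g h : << f + g, h >> = << f, h >> + << g, h >>.
Proof.
rewrite /L2inner -RintegralD//; try exact: L2_integrableM.
by apply: eq_Rintegral => x _; rewrite -mulrDl.
Qed.

Lemma L2innerZl a f h : << a *: f, h >> = a * << f, h >>.
Proof.
rewrite /L2inner -RintegralZl//; last exact: L2_integrableM.
by apply: eq_Rintegral => x _; rewrite mulrA.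
Qed.

Lemma L2innerZr a f h : << f, a *: h >> = a * << f, h >>.
Proof. by rewrite L2innerC L2innerZl L2innerC. Qed.

Lemma L2innerNl f h : << - f, h >> = - << f, h >>.
Proof. by rewrite -scaleN1r L2innerZl mulN1r. Qed.

Lemma L2innerBl f g h : << f - g, h >> = << f, h >> - << g, h >>.
Proof. by rewrite L2innerDl L2innerNl. Qed.

Lemma L2innerBr f g h : << f, g - h >> = << f, g >> - << f, h >>.
Proof. by rewrite L2innerC L2innerBl L2innerC [in X in _ - X]L2innerC. Qed.

Lemma L2inner0l h : << (0 : L2 m), h >> = 0.
Proof. by rewrite -(scale0r 0) L2innerZl mul0r. Qed.

Lemma L2inner_suml n (F : nat -> L2 m) h :
  << \sum_(k < n) F k, h >> = \sum_(k < n) << F k, h >>.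
Proof.
elim: n => [|n ih]; first by rewrite !big_ord0 L2inner0l.
by rewrite !big_ord_recr/= L2innerDl ih.
Qed.

Lemma L2inner_ge0 f : 0 <= << f, f >>.
Proof. by apply: Rintegral_ge0 => x _; rewrite -expr2 sqr_ge0. Qed.

Lemma integral_sqr_L2 f : (\int[m]_x (f x * f x)%:E = << f, f >>%:E)%E.
Proof. by rewrite /L2inner /Rintegral fineK//; apply: integrable_fin_num => //; exact: L2_integrableM. Qed.

Lemma L2norm_ge0 f : 0 <= L2norm f.
Proof. by rewrite fine_ge0// Lnorm_ge0. Qed.

Lemma L2norm_sqr f : L2norm f ^+ 2 = << f, f >>.
Proof.
apply: EFin_inj; rewrite -integral_sqr_L2 -powR_mulrn ?L2norm_ge0//.
rewrite -poweR_EFin /L2norm (finite_norm_fine f) powR_Lnorm//.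
by apply: eq_integral => x _ /=; rewrite powR_mulrn// -normrX ger0_norm// sqr_ge0.
Qed.

Lemma L2normE f : L2norm f = Num.sqrt << f, f >>.
Proof. by rewrite -L2norm_sqr sqrtr_sqr ger0_norm// L2norm_ge0. Qed.

Lemma L2normD f g : L2norm (f + g) <= L2norm f + L2norm g.
Proof. exact: ler_LnormD. Qed.

Lemma L2normN f : L2norm (- f) = L2norm f.
Proof. by rewrite !L2normE L2innerNl L2innerC L2innerNl opprK. Qed.

Lemma L2normB f g : L2norm (f - g) = L2norm (g - f).
Proof. by rewrite -L2normN opprB. Qed.

Lemma L2normZ a f : L2norm (a *: f) = `|a| * L2norm f.
Proof.
by rewrite !L2normE L2innerZl L2innerZr mulrA -expr2 sqrtrM ?sqr_ge0// sqrtr_sqr.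
Qed.

Lemma L2inner_le f g : `|<< f, g >>| <= L2norm f * L2norm g.
Proof.
have disc t : 0 <= << f, f >> - 2 * t * << f, g >> + t ^+ 2 * << g, g >>.
  suff -> : << f, f >> - 2 * t * << f, g >> + t ^+ 2 * << g, g >> =
      << f - t *: g, f - t *: g >> by exact: L2inner_ge0.
  by rewrite L2innerBl !L2innerBr !L2innerZl !L2innerZr (L2innerC g f); ring.
suff : << f, g >> ^+ 2 <= (L2norm f * L2norm g) ^+ 2.
  have ng := mulr_ge0 (L2norm_ge0 f) (L2norm_ge0 g).
  rewrite -[in X in _ -> X](ger0_norm ng) -!sqrtr_sqr; exact: ler_wsqrtr.
rewrite exprMn !L2norm_sqr.
have [g0|g0] := eqVneq << g, g >> 0.
  suff -> : << f, g >> = 0 by rewrite expr0n/= g0 mulr0.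
  apply: contrapT => /eqP fg0.
  (* With no quadratic term, this choice of t gives the polynomial the value -1. *)
  have := disc ((<< f, f >> + 1) / (2 * << f, g >>)).
  rewrite g0 mulr0 addr0.
  have -> : 2 * ((<< f, f >> + 1) / (2 * << f, g >>)) * << f, g >> = << f, f >> + 1.
    by field.
  by lra.
have ggt0 : 0 < << g, g >> by rewrite lt_neqAle eq_sym g0 L2inner_ge0.
(* The minimiser of the quadratic polynomial. *)
have := disc (<< f, g >> / << g, g >>).
rewrite -(pmulr_lge0 _ ggt0).
set F := << f, f >>; set G := << g, g >> in ggt0 g0 *; set H := << f, g >>.
have -> : (F - 2 * (H / G) * H + (H / G) ^+ 2 * G) * G = F * G - H ^+ 2 by field.
by rewrite subr_ge0.
Qed.

Lemma L2norm_eq0 f : L2norm f = 0 -> f = (0 : L2 m) %[ae m].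
Proof. exact: fine_Lnormr_eq0. Qed.

Lemma L2norm0_ae f g : L2norm (f - g) = 0 -> f = g %[ae m].
Proof.
move/L2norm_eq0; apply: filterS => x /= /(_ I) /eqP fg _.
by apply/eqP; rewrite -subr_eq0.
Qed.

Lemma L2inner_eql f f' g : f = f' %[ae m] -> << f, g >> = << f', g >>.
Proof.
move=> ff'; rewrite /L2inner /Rintegral; congr fine.
apply: ae_eq_integral => //.
- by have /integrableP[] := L2_integrableM f g.
- by have /integrableP[] := L2_integrableM f' g.
- by apply: filterS ff' => x /= + _ => ->.
Qed.

Lemma L2norm_ae f g : f = g %[ae m] -> L2norm f = L2norm g.
Proof.
move=> fg; rewrite !L2normE (L2inner_eql f fg) L2innerC (L2inner_eql _ fg).
by [].
Qed.

(** Lower semicontinuity of the squared norm under almost everywhere convergence. The bound is on an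
    extended integral, so it also serves to prove that a pointwise limit is square-integrable. *)
Lemma L2_fatou (u : nat -> L2 m) (w : R -> R) (e : R) : measurable_fun setT w ->
  {ae m, forall x, u n x @[n --> \oo] --> w x} ->
  (\forall n \near \oo, L2norm (u n) ^+ 2 <= e) ->
  (\int[m]_x (w x * w x)%:E <= e%:E)%E.
Proof.
move=> mw uw ue.
have mun n : measurable_fun setT (fun x => (u n x * u n x)%:E).
  by apply/measurable_EFinP; apply: measurable_funM.
have -> : (\int[m]_x (w x * w x)%:E = \int[m]_x limn_einf (fun n => (u n x * u n x)%:E))%E.
  apply: ae_eq_integral => //.
  - by apply/measurable_EFinP; exact: measurable_funM.
  - rewrite (_ : (fun x => _) = (fun x => - limn_esup (fun n => - (u n x * u n x)%:E))%E).
      apply: measurableT_comp => //; apply: measurable_fun_limn_esup => n.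
      exact: measurableT_comp.
    apply/funext => x; rewrite -limn_einfN; congr limn_einf.
    by apply/funext => n; rewrite /= opprK.
  - apply: filterS uw => x uwx _.
    have H : (u n x * u n x)%:E @[n --> \oo] --> (w x * w x)%:E.
      by apply: cvg_EFin; [exact: nearW|exact: cvgM].
    by have [-> _] := cvg_limn_einf_sup H.
apply: le_trans (fatou m measurableT mun _) _.
  by move=> n x _; rewrite lee_fin -expr2 sqr_ge0.
under eq_fun do rewrite integral_sqr_L2 -L2norm_sqr.
rewrite limn_einf_lim; apply: lime_le.
  exact: is_cvg_einfs.
near=> n; apply: (@le_trans _ _ (L2norm (u n) ^+ 2)%:E).
  by apply: ereal_inf_lbound; exists n => //=.
by rewrite lee_fin; near: n.
Unshelve. all: by end_near. Qed.



Lemma nneseries_EFin_lty (c : R^nat) : (forall k, 0 <= c k) ->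
  cvgn (series c) -> (\sum_(k <oo) (c k)%:E < +oo)%E.
Proof.
move=> c0 cc; apply: (@le_lt_trans _ _ (limn (series c))%:E); last exact: ltry.
apply: lime_le; first by apply: is_cvg_nneseries => k _ _; rewrite lee_fin.
near=> n; rewrite sumEFin lee_fin; apply: nondecreasing_cvgn_le => //.
by apply/nondecreasing_seqP => i; rewrite seriesSr lerDl.
Unshelve. all: by end_near. Qed.

(** Along a subsequence whose squared increments are at most 8^(-k), the sum of 2^k D_k^2 has finite
    integral, hence is finite almost everywhere. There |D_k| <= 2^(-k) + 2^k D_k^2 gives pointwise
    convergence, and Fatou's lemma turns it into convergence in norm. *)
Lemma L2_complete (u : nat -> L2 m) :
  (forall e : R, 0 < e -> exists N, forall i j, (N <= i)%N -> (N <= j)%N ->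
    L2norm (u i - u j) ^+ 2 <= e) ->
  exists w : L2 m, L2norm (u n - w) @[n --> \oo] --> (0 : R).
Proof.
move=> cu.
have /choice [N NP] k : exists N, forall i j, (N <= i)%N -> (N <= j)%N ->
    L2norm (u i - u j) ^+ 2 <= 8^-1 ^+ k.
  by apply: cu; rewrite exprn_gt0// invr_gt0.
(* Summing makes [nk] nondecreasing and at least [N k]; adding k makes it unbounded. *)
pose nk k := (\sum_(i < k.+1) N i + k)%N.
have nkN k : (N k <= nk k)%N by rewrite /nk big_ord_recr/= -addnA addnCA leq_addr.
have nkk k : (k <= nk k)%N by rewrite /nk leq_addl.
have nkS k : (nk k <= nk k.+1)%N.
  by rewrite /nk [X in (_ <= X + _)%N]big_ord_recr/= leq_add// leq_addr.
pose D k x := u (nk k.+1) x - u (nk k) x.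
pose g k x : \bar R := (2 ^+ k * (D k x * D k x))%:E.
have mD k : measurable_fun setT (D k).
  by apply: measurable_funB; exact: measurable_L2.
have mg k : measurable_fun setT (g k).
  apply/measurable_EFinP; apply: measurable_funM => //.
  exact: measurable_funM.
have g0 k x : (0 <= g k x)%E by rewrite lee_fin mulr_ge0 ?exprn_ge0// -expr2 sqr_ge0.
pose G x := (\sum_(k <oo) g k x)%E.
have mG : measurable_fun setT G.
  by apply: ge0_emeasurable_sum => // k x _ _; exact: g0.
have intg k : (\int[m]_x g k x <= (4^-1 ^+ k)%:E)%E.
  have -> : (\int[m]_x g k x = (2 ^+ k)%:E * \int[m]_x (D k x * D k x)%:E)%E.
    rewrite -ge0_integralZl//.
    + by apply/measurable_EFinP; exact: measurable_funM.
    + by move=> x _; rewrite lee_fin -expr2 sqr_ge0.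
  have -> : (\int[m]_x (D k x * D k x)%:E = (L2norm (u (nk k.+1) - u (nk k)) ^+ 2)%:E)%E.
    by rewrite L2norm_sqr -integral_sqr_L2.
  rewrite -EFinM lee_fin (@le_trans _ _ (2 ^+ k * 8^-1 ^+ k))//.
    rewrite ler_wpM2l ?exprn_ge0// NP// (leq_trans (nkN k))// nkS.
  by rewrite -exprMn (_ : 2 / 8 = 4^-1 :> R)//; field.
have Goo : {ae m, forall x, G x \is a fin_num}.
  have : m.-integrable setT G.
    apply/integrableP; split => //.
    have G0 x : (0 <= G x)%E by apply: nneseries_ge0 => k _ _; exact: g0.
    under eq_integral do rewrite gee0_abs//.
    rewrite integral_nneseries//.
    apply: (@le_lt_trans _ _ (\sum_(k <oo) (4^-1 ^+ k)%:E)%E).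
      by apply: lee_nneseries => k *; [exact: integral_ge0|exact: intg].
    apply: nneseries_EFin_lty => [k|]; first by rewrite exprn_ge0// invr_ge0.
    have := @is_cvg_geometric_series _ (1 : R) 4^-1.
    rewrite (_ : geometric 1 4^-1 = fun k => 4^-1 ^+ k); last first.
      by apply/funext => k; rewrite /= mul1r.
    by apply; rewrite ger0_norm ?invr_ge0// invf_lt1// ltr1n.
  move/integrable_ae => /(_ measurableT); apply: filterS => x; exact.
(* Both [w] and [v] are set to 0 on the exceptional null set, so that [v] converges everywhere and
   [w] is measurable. *)
pose w x := if G x == +oo%E then 0 else limn (fun k => u (nk k) x).
pose v k x := if G x == +oo%E then 0 else u (nk k) x.
have vw x : v k x @[k --> \oo] --> w x.
  rewrite /v /w; case: ifPn => Gx; first exact: cvg_cst.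
  have cD : cvgn (series (fun k => `|D k x|)).
    apply: (@series_le_cvg _ _ (fun k => 2^-1 ^+ k + 2 ^+ k * (D k x * D k x))) => //.
    - by move=> k; rewrite addr_ge0 ?exprn_ge0 ?invr_ge0// mulr_ge0 ?exprn_ge0// -expr2 sqr_ge0.
    - move=> k; set y := D k x; rewrite -[y * y]expr2 -(real_normK (num_real y)).
      have p0 : 0 < 2 ^+ k :> R by rewrite exprn_gt0.
      rewrite exprVn; set p := 2 ^+ k in p0 *.
      have -> : p^-1 + p * `|y| ^+ 2 = p^-1 * (1 + (p * `|y|) ^+ 2).
        by field; rewrite gt_eqF.
      rewrite ler_pdivlMl//; nra.
    - have h1 : cvgn (series (fun k => 2^-1 ^+ k : R)).
        have := @is_cvg_geometric_series _ (1 : R) 2^-1.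
        rewrite (_ : geometric 1 2^-1 = fun k => 2^-1 ^+ k); last first.
          by apply/funext => k; rewrite /= mul1r.
        by apply; rewrite ger0_norm ?invr_ge0// invf_lt1// ltr1n.
      have h2 : cvgn (series (fun k => 2 ^+ k * (D k x * D k x))).
        apply: nnseries_is_cvg => [k|]; last by rewrite ltey.
        by rewrite mulr_ge0 ?exprn_ge0// -expr2 sqr_ge0.
      exact: (is_cvg_seriesD h1 h2).
  have := normed_cvg cD.
  have -> : (fun k => D k x) = telescope (fun k => u (nk k) x) by [].
  rewrite telescopeK => cu'.
  have : cvgn (fun k => u (nk k) x).
    rewrite (_ : (fun k => u (nk k) x) = (fun k => (u (nk k) x - u (nk 0%N) x) + u (nk 0%N) x)); last first.
      by apply/funext => k; rewrite subrK.
    by apply: is_cvgD => //; exact: is_cvg_cst.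
  exact.
have mw : measurable_fun setT w.
  apply: (measurable_fun_cvg _ (fun x _ => vw x)) => k.
  apply: measurable_fun_if => //; first exact: measurable_fun_eqe.
  by apply: measurable_funTS; exact: measurable_L2.
have diff i e : (\forall k \near \oo, L2norm (u i - u (nk k)) ^+ 2 <= e) ->
    (\int[m]_x ((u i x - w x) * (u i x - w x))%:E <= e%:E)%E.
  move=> ie; apply: (@L2_fatou (fun k => u i - u (nk k)) (fun x => u i x - w x)) ie.
    by apply: measurable_funB => //; exact: measurable_L2.
  apply: filterS Goo => x Gx; apply: cvgB; first exact: cvg_cst.
  by have := vw x; rewrite /v; case: eqP Gx => [->|].
have nearD (e : R) : 0 < e -> exists M, forall i, (M <= i)%N ->
    \forall k \near \oo, L2norm (u i - u (nk k)) ^+ 2 <= e.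
  move=> e0; have [M MP] := cu e e0; exists M => i Mi; near=> k; apply: MP => //.
  apply: leq_trans (nkk k); near: k; exact: nbhs_infty_ge.
have [M0 M0P] := nearD 1 ltr01.
(* Membership of [w] in L2 is obtained from that of u_M0 - w, which Fatou's lemma controls. *)
have mdw : measurable_fun setT (fun x => u M0 x - w x).
  by apply: measurable_funB => //; exact: measurable_L2.
have dwL : (fun x => u M0 x - w x) \in Lfun m 2%:E.
  apply: mem_L2 => //; apply/integrableP; split.
    by apply/measurable_EFinP; exact: measurable_funM.
  under eq_integral do rewrite gee0_abs ?lee_fin -?expr2 ?sqr_ge0//=.
  exact: le_lt_trans (diff _ _ (M0P _ (leqnn _))) (ltry _).
pose W : L2 m := u M0 - Lfun_Sub (lee1n 2) dwL.
have WE x : W x = w x.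
  by rewrite /W -[RHS](subKr (u M0 x)).
exists W; apply/cvgrPdist_le => e e0.
have e20 : 0 < e ^+ 2 by rewrite exprn_gt0.
have [M MP] := nearD _ e20.
near=> i; rewrite sub0r normrN ger0_norm ?L2norm_ge0//.
rewrite -(@ler_pXn2r _ 2)// ?nnegrE ?L2norm_ge0 ?(ltW e0)// L2norm_sqr -lee_fin -integral_sqr_L2.
have Mi : (M <= i)%N by near: i; exact: nbhs_infty_ge.
apply: le_trans (diff _ _ (MP _ Mi)); rewrite le_eqVlt; apply/orP; left; apply/eqP.
by apply: eq_integral => x _; rewrite -WE.
Unshelve. all: by end_near. Qed.

End L2_theory.

Section L2_series.
Context {R : realType}.
Variable m : {measure set (measurableTypeR R) -> \bar R}.
Local Notation "'<<' f , g '>>'" := (L2inner m f g).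

(** Fatou's lemma for u_n - w bounds the integral of (g - w)^2 by every positive number. *)
Lemma L2_cvg_pointwise (u : nat -> L2 m) (w : L2 m) (g : R -> R) :
  L2norm (u n - w) @[n --> \oo] --> (0 : R) -> measurable_fun setT g ->
  {ae m, forall x, u n x @[n --> \oo] --> g x} -> w = g %[ae m].
Proof.
move=> uw mg ug.
have wg_int : (\int[m]_x ((g x - w x) * (g x - w x))%:E <= 0)%E.
  apply/lee_addgt0Pr => eps eps0; rewrite add0e.
  apply: (@L2_fatou _ _ (fun n => u n - w) (fun x => g x - w x)).
  - by apply: measurable_funB => //; exact: measurable_L2.
  - by apply: filterS ug => x cx; apply: cvgB; last exact: cvg_cst.
  - have se : 0 < Num.sqrt eps by rewrite sqrtr_gt0.
    move/cvgrPdist_le : uw => /(_ _ se); apply: filterS => n.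
    rewrite sub0r normrN ger0_norm ?L2norm_ge0// => le.
    by rewrite -[leRHS](sqr_sqrtr (ltW eps0)) lerXn2r// ?nnegrE ?L2norm_ge0 ?sqrtr_ge0.
have mgw : measurable_fun setT (fun x => ((g x - w x) * (g x - w x))%:E).
  apply/measurable_EFinP; apply: measurable_funM; apply: measurable_funB => //;
    exact: measurable_L2.
have : (\int[m]_x `|((g x - w x) * (g x - w x))%:E| = 0)%E.
  apply/eqP; rewrite eq_le integral_ge0// andbT.
  by under eq_integral do rewrite gee0_abs ?lee_fin -?expr2 ?sqr_ge0//=.
move/(ae_eq_integral_abs m measurableT mgw); apply: filterS => x /(_ I) /= [/eqP].
by rewrite mulf_eq0 orbb subr_eq0 => /eqP ->.
Qed.

Lemma L2_normal_cvg (v : nat -> L2 m) (M : R^nat) :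
  (forall k, L2norm (v k) <= M k) -> cvgn (series M) ->
  exists w : L2 m, L2norm (\sum_(k < n) v k - w) @[n --> \oo] --> (0 : R).
Proof.
move=> vM cM.
have M0 k : 0 <= M k by apply: le_trans (vM k); exact: L2norm_ge0.
have dist i j : (i <= j)%N ->
    L2norm (\sum_(k < j) v k - \sum_(k < i) v k) <= series M j - series M i.
  elim: j => [|j ih].
    by rewrite leqn0 => /eqP ->; rewrite !subrr -(scale0r 0) L2normZ normr0 mul0r.
  rewrite leq_eqVlt => /predU1P[->|].
    by rewrite !subrr -(scale0r 0) L2normZ normr0 mul0r.
  rewrite ltnS => ij; rewrite big_ord_recr/= seriesSr [X in L2norm X]addrAC [leRHS]addrAC.
  by rewrite (le_trans (L2normD _ _))// lerD// ih.
apply: L2_complete => eps eps0.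
have e2 : 0 < Num.sqrt eps / 2 by rewrite divr_gt0// sqrtr_gt0.
have /cvgrPdist_le/(_ _ e2) [N _ NP] := cM.
exists N => i j Ni Nj.
wlog ij : i j Ni Nj / (j <= i)%N.
  by move=> H; case: (leqP j i) => [|/ltnW] ij; [exact: H|rewrite L2normB; exact: H].
rewrite -[leRHS](sqr_sqrtr (ltW eps0)) lerXn2r// ?nnegrE ?L2norm_ge0 ?sqrtr_ge0//.
apply: (le_trans (dist _ _ ij)).
have /= := NP _ Ni; have /= := NP _ Nj.
rewrite !ler_norml; lra.
Qed.

Lemma L2inner_cvg (u : nat -> L2 m) (w f : L2 m) :
  L2norm (u n - w) @[n --> \oo] --> (0 : R) ->
  << f, u n >> @[n --> \oo] --> << f, w >>.
Proof.
move=> uw.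
have : << f, u n - w >> @[n --> \oo] --> (0 : R).
  apply: norm_cvg0; apply: (@squeeze_cvgr _ _ _ _ (fun=> 0) (fun n => L2norm f * L2norm (u n - w))).
  - by near=> n; rewrite normr_ge0 L2inner_le.
  - exact: cvg_cst.
  - by rewrite -(mulr0 (L2norm f)); apply: cvgMr.
move=> h; rewrite -[X in _ --> X]add0r.
rewrite (_ : (fun n => _) = (fun n => << f, u n - w >> + << f, w >>)); last first.
  by apply/funext => n; rewrite L2innerBr subrK.
by apply: cvgD; [exact: h|exact: cvg_cst].
Unshelve. all: by end_near. Qed.

(** Here [g] is a plain function, such as the sum of a pointwise series; its integrability against
    [f] is transferred from [w]. *)
Lemma L2inner_ae (f w : L2 m) (g : R -> R) :
  measurable_fun setT g -> w = g %[ae m] ->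
  m.-integrable setT (EFin \o (fun x => f x * g x)) /\ << f, w >> = << f, g >>.
Proof.
move=> mg wg.
have mfw := measurable_int _ (L2_integrableM f w).
have mfg : measurable_fun setT (EFin \o (fun x => f x * g x)).
  by apply/measurable_EFinP; apply: measurable_funM => //; exact: measurable_L2.
have fwg : ae_eq m setT (EFin \o (fun x => f x * w x)) (EFin \o (fun x => f x * g x)).
  by apply: filterS wg => x /= + _ => ->.
split; last by rewrite /L2inner /Rintegral; congr fine; exact: ae_eq_integral.
apply/integrableP; split => //.
have /integrableP[_] := L2_integrableM f w.
congr (_ < _)%E; apply: ae_eq_integral => //; try exact: measurableT_comp.
by apply: filterS fwg => x /= + _ => /(_ I) [->].
Qed.

Lemma L2continuousD (D : set R) (u v : R -> L2 m) :
  L2continuous D u -> L2continuous D v -> L2continuous D (fun t => u t + v t).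
Proof.
move=> cu cv s Ds; have us := cu s Ds; have vs := cv s Ds.
apply: (@squeeze_cvgr _ _ _ _ (fun=> 0)
  (fun t => L2norm (u t - u s) + L2norm (v t - v s))).
- near=> t; rewrite L2norm_ge0/=.
  by rewrite opprD addrACA L2normD.
- exact: cvg_cst.
- by rewrite -[X in _ --> X]addr0; exact: cvgD.
Unshelve. all: by end_near. Qed.

End L2_series.

Section tannery.
Context {R : realType}.

(** Tannery's theorem. Stated for an arbitrary filter, it serves for continuity inside (0,1), for
    left limits at 1 and for continuity relative to [0, T]. *)
Lemma series_cvg_dominated (T : Type) (F : set_system T) (FF : Filter F)
    (f : nat -> T -> R) (l M : R^nat) :
  cvgn (series M) -> (forall k, f k x @[x --> F] --> l k) ->
  (\forall x \near F, forall k, `|f k x| <= M k) -> (forall k, `|l k| <= M k) ->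
  limn (series (f ^~ x)) @[x --> F] --> limn (series l).
Proof.
move=> cM fl fM lM.
have M0 k : 0 <= M k by apply: le_trans (lM k).
have cvgM (g : R^nat) : (forall k, `|g k| <= M k) -> cvgn (series g).
  by move=> gM; apply: normed_cvg; apply: series_le_cvg gM cM.
have tail (g : R^nat) n : (forall k, `|g k| <= M k) ->
    `|limn (series g) - series g n| <= limn (series M) - series M n.
  move=> gM; have cg := cvgM g gM.
  have h1 : `|series g j - series g n| @[j --> \oo] --> `|limn (series g) - series g n|.
    by apply: cvg_norm; apply: cvgB; [exact: cg|exact: cvg_cst].
  have h2 : series M j - series M n @[j --> \oo] --> limn (series M) - series M n.
    by apply: cvgB; [exact: cM|exact: cvg_cst].
  rewrite -(cvg_lim (@norm_hausdorff _ R) h1) -(cvg_lim (@norm_hausdorff _ R) h2).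
  apply: ler_lim; [by apply: cvgP h1|by apply: cvgP h2|].
  near=> j; have nj : (n <= j)%N by near: j; exact: nbhs_infty_ge.
  rewrite !sub_series_geq// (le_trans (ler_norm_sum _ _ _))//.
  by apply: ler_sum => k _; exact: gM.
apply/cvgrPdist_le => e e0.
have e3 : 0 < e / 3 by rewrite divr_gt0.
have [n _ nP] : \forall n \near \oo, limn (series M) - series M n <= e / 3.
  have /cvgrPdist_le/(_ _ e3) := cM.
  by apply: filterS => n; apply: le_trans; exact: ler_norm.
have {}nP := nP n (leqnn n).
have fin : series (f ^~ x) n @[x --> F] --> series l n.
  rewrite /series /=; elim: n {nP} => [|n ih].
    by under eq_fun do rewrite big_nil; rewrite big_nil; exact: cvg_cst.
  under eq_fun do rewrite big_nat_recr//=; rewrite big_nat_recr//=.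
  exact: cvgD.
move/cvgrPdist_le : fin => /(_ _ e3) fin.
near=> x.
have fx k : `|f k x| <= M k by move: k; near: x.
have t1 := tail _ n lM; have t2 := tail _ n fx.
have t3 : `|series l n - series (f ^~ x) n| <= e / 3 by near: x.
set A := limn (series l) in t1 *; set B := limn (series (f ^~ x)) in t2 *.
have -> : A - B = (A - series l n) + (series l n - series (f ^~ x) n) - (B - series (f ^~ x) n).
  by ring.
rewrite (le_trans (ler_normB _ _))// (le_trans (lerD (ler_normD _ _) (lexx _)))//.
lra.
Unshelve. all: by end_near. Qed.

End tannery.

(** * Expansions in an orthonormal family *)

Section orthonormal_expansions.
Context {R : realType}.
Variable m : {measure set (measurableTypeR R) -> \bar R}.
Local Notation "'<<' f , g '>>'" := (L2inner m f g).
Variable e : nat -> L2 m.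
Hypothesis oe : forall i j, << e i, e j >> = (i == j)%:R.
Implicit Types (c : R^nat) (w z : L2 m).

Definition psum c n : L2 m := \sum_(k < n) c k *: e k.

Definition expansion c w := L2norm (psum c n - w) @[n --> \oo] --> (0 : R).

Lemma psumE c n x : psum c n x = \sum_(k < n) c k * e k x.
Proof.
rewrite /psum; elim: n => [|n ih]; first by rewrite !big_ord0.
by rewrite !big_ord_recr/= -ih.
Qed.

Lemma inner_psum c n z : << psum c n, z >> = \sum_(k < n) c k * << e k, z >>.
Proof.
rewrite /psum (L2inner_suml n (fun k => c k *: e k)); apply: eq_bigr => k _.
exact: L2innerZl.
Qed.

Lemma inner_e_psum c n i : << e i, psum c n >> = if (i < n)%N then c i else 0.
Proof.
rewrite L2innerC inner_psum; under eq_bigr do rewrite oe.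
case: ltnP => ni.
  rewrite (bigD1 (Ordinal ni))//= eqxx mulr1 big1 ?addr0// => k ki.
  by rewrite (_ : (k == i :> nat) = false) ?mulr0//; exact/negbTE.
by rewrite big1// => k _; rewrite ltn_eqF ?mulr0// (leq_trans (ltn_ord k)).
Qed.

Lemma inner_psum2 c i j : (i <= j)%N ->
  << psum c i, psum c j >> = \sum_(k < i) c k ^+ 2.
Proof.
move=> ij; rewrite inner_psum; apply: eq_bigr => k _.
by rewrite inner_e_psum (leq_trans (ltn_ord k) ij).
Qed.

Lemma psum_dist c i j : (i <= j)%N ->
  L2norm (psum c j - psum c i) ^+ 2 = \sum_(i <= k < j) c k ^+ 2.
Proof.
move=> ij; rewrite L2norm_sqr L2innerBl !L2innerBr.
rewrite (L2innerC m (psum c j) (psum c i)) !inner_psum2//.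
rewrite subrr subr0 -!(big_mkord xpredT (fun k => c k ^+ 2)).
by rewrite (@big_cat_nat _ _ _ i)//= addrC addrK.
Qed.

(** Expand the squared norm of [psum c n - z] for the Fourier coefficients [c] of [z]. *)
Lemma bessel_ineq z n : \sum_(k < n) << e k, z >> ^+ 2 <= << z, z >>.
Proof.
pose c k := << e k, z >>.
have := L2inner_ge0 (psum c n - z).
rewrite L2innerBl !L2innerBr (L2innerC m z (psum c n)) inner_psum2// inner_psum.
have -> : \sum_(k < n) c k * << e k, z >> = \sum_(k < n) c k ^+ 2.
  by apply: eq_bigr => k _; rewrite expr2.
by rewrite subrr sub0r opprB subr_ge0.
Qed.

Lemma bessel_cvg z : cvgn (series (fun k => << e k, z >> ^+ 2)).
Proof.
apply: nondecreasing_is_cvgn.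
  by apply/nondecreasing_seqP => n; rewrite seriesSr lerDl sqr_ge0.
exists << z, z >> => _ [n _ <-]; rewrite /series/= big_mkord.
exact: bessel_ineq.
Qed.

Lemma riesz_fischer c : cvgn (series (fun k => c k ^+ 2)) ->
  exists w, expansion c w.
Proof.
move=> cc; apply: L2_complete => eps eps0.
have e2 : 0 < eps / 2 by rewrite divr_gt0.
have /cvgrPdist_le/(_ _ e2) [N _ NP] := cc.
exists N => i j Ni Nj.
wlog ij : i j Ni Nj / (j <= i)%N.
  by move=> H; case: (leqP j i) => [|/ltnW] ij; [exact: H|rewrite L2normB; exact: H].
rewrite psum_dist// -sub_series_geq//.
have /= := NP _ Ni; have /= := NP _ Nj.
rewrite !ler_norml; lra.
Qed.

Lemma expansion_inner c w z : expansion c w ->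
  series (fun k => c k * << e k, z >>) @ \oo --> << w, z >>.
Proof.
move=> cw; have := @L2inner_cvg _ _ _ _ z cw; rewrite (L2innerC _ z w).
rewrite (_ : (fun n => _) = series (fun k => c k * << e k, z >>))//.
by apply/funext => n; rewrite L2innerC inner_psum /series/= big_mkord.
Qed.

Lemma expansion_coef c w k : expansion c w -> << e k, w >> = c k.
Proof.
move=> cw; rewrite L2innerC.
have := expansion_inner (z := e k) cw; move/(cvg_lim (@norm_hausdorff _ R)) => <-.
apply: lim_near_cst => //; near=> n.
have kn : (k < n)%N by near: n; exact: nbhs_infty_gt.
rewrite /series/= big_mkord (bigD1 (Ordinal kn))//= oe eqxx mulr1 big1 ?addr0//.
by move=> i ik; rewrite oe (_ : (i == k :> nat) = false) ?mulr0//; exact/negbTE.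
Unshelve. all: by end_near. Qed.

(** Parseval's identity for elements that are sums of an expansion; the norm estimates on the
    semigroup and the control operator go through it. *)
Lemma expansion_norm c w : expansion c w ->
  series (fun k => c k ^+ 2) @ \oo --> L2norm w ^+ 2.
Proof.
move=> cw; rewrite L2norm_sqr.
rewrite (_ : (fun k => c k ^+ 2) = (fun k => c k * << e k, w >>)).
  exact: expansion_inner.
by apply/funext => k; rewrite (expansion_coef k cw) expr2.
Qed.

Lemma expansion_linear a c c' w w' : expansion c w -> expansion c' w' ->
  expansion (fun k => a * c k + c' k) (a *: w + w').
Proof.
move=> cw cw'.
have E n : psum (fun k => a * c k + c' k) n - (a *: w + w') =
    a *: (psum c n - w) + (psum c' n - w').
  rewrite /psum scalerBr scaler_sumr opprD addrACA -big_split/=; congr (_ + _).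
  by apply: eq_bigr => k _; rewrite scalerDl scalerA.
rewrite /expansion; apply: (@squeeze_cvgr _ _ _ _ (fun=> 0)
  (fun n => `|a| * L2norm (psum c n - w) + L2norm (psum c' n - w'))).
- near=> n; rewrite L2norm_ge0/= E (le_trans (L2normD _ _))// L2normZ.
  by rewrite lerD2r.
- exact: cvg_cst.
- rewrite -[X in _ --> X]addr0 -[X in _ --> X + _](mulr0 `|a|).
  by apply: cvgD => //; apply: cvgMr.
Unshelve. all: by end_near. Qed.

(** The difference is the sum of the expansion with zero coefficients, so its norm vanishes by
    Parseval's identity. *)
Lemma expansion_unique c w w' : expansion c w -> expansion c w' -> w = w' %[ae m].
Proof.
move=> cw cw'; apply: L2norm0_ae.
have := expansion_linear (-1) cw cw'.
move/expansion_norm; rewrite (_ : (fun k => _) = fun=> 0); last first.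
  by apply/funext => k; rewrite mulN1r addNr expr0n.
have h : series (fun=> 0 : R) @ \oo --> (0 : R).
  by apply: cvg_near_cst; near=> n; rewrite /series/= big1.
move=> /(cvg_unique (@norm_hausdorff _ R) h)/esym/eqP.
by rewrite sqrf_eq0 scaleN1r addrC L2normB => /eqP.
Unshelve. all: by end_near. Qed.

Lemma expansion_pointwise c w (g : R -> R) : expansion c w ->
  measurable_fun setT g ->
  {ae m, forall x, series (fun k => c k * e k x) @ \oo --> g x} -> w = g %[ae m].
Proof.
move=> cw mg cg; apply: (L2_cvg_pointwise cw mg); apply: filterS cg => x cx.
rewrite (_ : (fun n => _) = series (fun k => c k * e k x))//.
by apply/funext => n; rewrite /series/= big_mkord; exact: psumE.
Qed.

End orthonormal_expansions.

Section expansion_continuity.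
Context {R : realType}.
Variable m : {measure set (measurableTypeR R) -> \bar R}.
Variable e : nat -> L2 m.
Hypothesis oe : forall i j, L2inner m (e i) (e j) = (i == j)%:R.

(** Parseval's identity writes the squared norm of w(t) - w(s) as a series in k, to which Tannery's
    theorem applies with majorant 4 M, from (x - y)^2 <= 2 x^2 + 2 y^2. *)
Lemma expansion_L2continuous (D : set R) (c : R -> R^nat) (w : R -> L2 m) (M : R^nat) :
  (forall t, D t -> expansion e (c t) (w t)) ->
  (forall k s, D s -> c t k @[t --> within D (nbhs s)] --> c s k) ->
  (forall k t, D t -> c t k ^+ 2 <= M k) -> cvgn (series M) -> L2continuous D w.
Proof.
move=> cw cc cM sM s Ds.
have DE t : D t -> L2norm (w t - w s) ^+ 2 = limn (series (fun k => (c t k - c s k) ^+ 2)).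
  move=> Dt.
  have := expansion_norm oe (expansion_linear (-1) (cw s Ds) (cw t Dt)).
  rewrite scaleN1r [- _ + _]addrC => /(cvg_lim (@norm_hausdorff _ R)) <-.
  congr (limn (series _)); apply/funext => k; by rewrite mulN1r [- _ + _]addrC.
have M4 k t : D t -> `|(c t k - c s k) ^+ 2| <= 4 * M k.
  move=> Dt; rewrite ger0_norm ?sqr_ge0//.
  have := cM k t Dt; have := cM k s Ds; have := sqr_ge0 (c t k + c s k).
  rewrite !expr2; lra.
have M0 k : 0 <= 4 * M k by rewrite mulr_ge0// (le_trans (sqr_ge0 _) (cM k s Ds)).
have s4M : cvgn (series (fun k => 4 * M k)) by exact: is_cvg_seriesZ.
have lim0 : limn (series (fun k => (c t k - c s k) ^+ 2)) @[t --> within D (nbhs s)]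
    --> limn (series (fun=> 0 : R)).
  apply: (@series_cvg_dominated _ R (within D (nbhs s)) _
    (fun k t => (c t k - c s k) ^+ 2) _ _ s4M) => [k||k].
  - rewrite (_ : 0 = (c s k - c s k) ^+ 2); last by rewrite subrr expr0n.
    by rewrite expr2; under eq_fun do rewrite expr2; apply: cvgM;
      apply: cvgB; [exact: cc|exact: cvg_cst|exact: cc|exact: cvg_cst].
  - by rewrite near_withinE; near=> t => Dt k; exact: M4.
  - by rewrite normr0.
have limE : limn (series (fun=> 0 : R)) = 0.
  apply: lim_near_cst => //; near=> n; by rewrite /series/= big1.
rewrite limE in lim0.
have sq0 : L2norm (w t - w s) ^+ 2 @[t --> within D (nbhs s)] --> (0 : R).
  apply: cvg_trans lim0; apply: near_eq_cvg; rewrite near_withinE.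
  by near=> t => Dt; rewrite DE.
rewrite -(sqrtr0 R).
rewrite (_ : (fun t => _) = (fun t => Num.sqrt (L2norm (w t - w s) ^+ 2))); last first.
  by apply/funext => t; rewrite sqrtr_sqr ger0_norm// L2norm_ge0.
by apply: (cvg_comp _ _ sq0); exact: sqrt_continuous.
Unshelve. all: by end_near. Qed.

End expansion_continuity.

(** * The Bessel basis *)

Section weighted_ftc.
Context {R : realType}.
Let leb := @lebesgue_measure R.
Variables (k beta : R).
Hypothesis k0 : 0 < k.

Lemma measurable_powR_comp (phi : R -> R) (s r : R) : continuous phi ->
  measurable_fun setT (fun x : R => x `^ s * phi (x `^ r)).
Proof.
move=> cphi; apply: measurable_funM; first exact: measurable_powR.
apply: (measurableT_comp _ (measurable_powR r)).
exact: continuous_measurable_fun.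
Qed.

Lemma integrable_powR01 (r : R) : 0 < r ->
  leb.-integrable `]0, 1[ (fun x => (x `^ (r - 1))%:E).
Proof.
move=> r0; pose F x := x `^ r / r.
have dF (x : R) : 0 < x < 1 -> is_derive x 1 F (x `^ (r - 1)).
  move=> /andP[x0 _]; have ? := is_derive1_powR r x0.
  apply: is_derive_eq; rewrite /GRing.scale/=; field.
  by rewrite gt_eqF.
apply: (@ge0_improper_FTC_01_integrable _ (fun x => x `^ (r - 1)) F 0 r^-1) => //.
- by move=> x /andP[x0 _]; exact: (is_derive_cvg (is_derive1_powR (r - 1) x0)).
- rewrite -[X in _ --> X](mul0r r^-1); apply: cvgMl; exact: powR_cvg0.
- apply: cvg_at_left_filter.
  have -> : r^-1 = F 1 by rewrite /F powR1 mul1r.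
  have ? := is_derive1_powR r (@ltr01 R).
  have dF1 : is_derive (1 : R) 1 F (r * 1 `^ (r - 1) / r).
    by apply: is_derive_eq; rewrite /GRing.scale/= ?mulr0 ?addr0 ?add0r mulrC.
  exact: (is_derive_cvg dF1).
- by move=> x _; exact: powR_ge0.
Qed.

(* x^(2kp) F(x^(2k)) / (2k) is a primitive of the integrand times x^beta *)
Lemma weight_FTC (p : R) (F dF phi : R -> R) : 0 < p ->
  (forall y : R, is_derive y 1 F (dF y)) -> continuous phi ->
  (forall y, p * F y + y * dF y = phi y) ->
  let f x := x `^ (2 * k * p - 1 - beta) * phi (x `^ (2 * k)) in
  (weight beta).-integrable setT (EFin \o f) /\
  (\int[weight beta]_x (f x)%:E = (F 1 / (2 * k))%:E)%E.
Proof.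
move=> p0 dFE cphi FE f.
have k20 : 0 < 2 * k by rewrite mulr_gt0.
have kp0 : 0 < 2 * k * p by rewrite mulr_gt0.
have mf : measurable_fun setT f by exact: measurable_powR_comp.
pose g x := x `^ (2 * k * p - 1) * phi (x `^ (2 * k)).
have fg : {in `]0%R, 1%R[%classic, (fun x => (f x * x `^ beta)%:E) =1 EFin \o g}.
  move=> x /set_mem /=; rewrite in_itv/= => /andP[x0 _].
  have E : x `^ (2 * k * p - 1) = x `^ (2 * k * p - 1 - beta) * x `^ beta.
    by rewrite -powRDgt0// subrK.
  by rewrite /= /f /g E; congr EFin; ring.
pose P x := x `^ (2 * k * p) * F (x `^ (2 * k)) / (2 * k).
have dP (x : R) : 0 < x -> is_derive x 1 P (g x).
  move=> x0; have ? := is_derive1_powR (2 * k * p) x0.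
  have d2 := @is_derive1_comp R F (fun x => x `^ (2 * k)) x _ _ (dFE _)
    (is_derive1_powR (2 * k) x0).
  have d3 : is_derive x 1 (fun x => F (x `^ (2 * k)))
    (dF (x `^ (2 * k)) * (2 * k * x `^ (2 * k - 1))) by exact: d2.
  move: d3; set G := fun x => F _ => d3.
  apply: is_derive_eq; rewrite /GRing.scale/= /g -FE /G.
  have -> : x `^ (2 * k * p) = x * x `^ (2 * k * p - 1).
    by rewrite -powRS// subrK.
  have -> : x `^ (2 * k) = x * x `^ (2 * k - 1) by rewrite -powRS// subrK.
  by field; rewrite gt_eqF.
have cF : continuous F by move=> y; exact: (is_derive_cvg (dFE y)).
have cg (x : R) : 0 < x < 1 -> {for x, continuous g}.
  move=> /andP[x0 _]; apply: cvgM.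
    exact: (is_derive_cvg (is_derive1_powR _ x0)).
  apply: (@continuous_comp _ _ _ (fun x => x `^ (2 * k)) phi).
    exact: (is_derive_cvg (is_derive1_powR _ x0)).
  exact: cphi.
have P0 : P x @[x --> 0^'+] --> (0 : R).
  rewrite -[X in _ --> X](mul0r (2 * k)^-1); apply: cvgMl.
  rewrite -[X in _ --> X](mul0r (F 0)); apply: cvgM; first exact: powR_cvg0.
  have h : x `^ (2 * k) @[x --> 0^'+] --> (0 : R) by exact: powR_cvg0.
  exact: (cvg_comp (fun x => x `^ (2 * k)) F h (cF 0)).
have P1 : P x @[x --> 1^'-] --> F 1 / (2 * k).
  apply: cvg_at_left_filter.
  have -> : F 1 / (2 * k) = P 1 by rewrite /P !powR1 mul1r.
  exact: (is_derive_cvg (dP _ ltr01)).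
(* As [phi] may change sign, integrability comes from comparison with M x^(2kp-1) and not from the
   criterion for nonnegative integrands. *)
have [M MP] : exists M : R, forall y : R, 0 <= y <= 1 -> `|phi y| <= M.
  have cn : {within `[0, 1], continuous (fun y => `|phi y|)}.
    by apply: continuous_subspaceT => y; apply: cvg_norm; exact: cphi.
  have [c _ cP] := EVT_max (@ler01 R) cn.
  by exists `|phi c| => y y01; apply: cP; rewrite in_itv.
have ig : leb.-integrable `]0, 1[ (EFin \o g).
  have i1 : leb.-integrable `]0, 1[ (fun x => (x `^ (2 * k * p - 1))%:E).
    exact: integrable_powR01.
  have i2 : leb.-integrable `]0, 1[ (fun x => M%:E * (x `^ (2 * k * p - 1))%:E)%E.
    exact: integrableZl.
  apply: (le_integrable _ _ _ i2) => //.
    apply/measurable_EFinP; apply: measurable_funTS; exact: measurable_powR_comp.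
  move=> x /=; rewrite in_itv/= => /andP[x0 x1].
  rewrite lee_fin normrM mulrC normrM; apply: ler_pM => //.
  apply: (le_trans (MP _ _)); last exact: ler_norm.
  rewrite powR_ge0/= -[leRHS](_ : 1 `^ (2 * k) = 1); last by rewrite powR1.
  by apply: ge0_ler_powR; rewrite ?nnegrE//; exact: ltW.
split.
  apply/integrable_weight => //.
  apply: eq_integrable ig; first exact: measurable_itv.
  by move=> x xI; rewrite fg.
rewrite integral_weight//.
transitivity (\int[leb]_(x in `]0%R, 1%R[) (g x)%:E)%E; first exact: eq_integral.
rewrite -[F 1 / (2 * k)]subr0.
apply: (@improper_FTC_01 _ g P 0 (F 1 / (2 * k))) => //.
by move=> x /andP[x0 _]; exact: dP.
Qed.

End weighted_ftc.

(** * Inner products of Bessel functions in closed form *)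

Section bessel_family.
Context {R : realType}.
Variables (k beta n : R).
Hypotheses (k0 : 0 < k) (n0 : 0 < n).
Implicit Types (q r x y : R).
Local Opaque Gamma.

Let n1 : 0 < n + 1. Proof. by rewrite ltr_wpDr. Qed.

(** The exponent is such that a product of two of these, times x^beta dx, becomes y^n C_n(q y) C_n(r
    y) dy / (2k) in y = x^(2k). For n = nu it equals -a. *)
Definition bessel_fun q x : R :=
  x `^ ((2 * k * (n + 1) - 1 - beta) / 2) * clifford n (q * x `^ (2 * k)).

Lemma powR_sqr x s : x `^ (s / 2) * x `^ (s / 2) = x `^ s.
Proof.
have [->|s0] := eqVneq s 0; first by rewrite mul0r powRr0 mulr1.
rewrite -powRD; last by rewrite -splitr (negPf s0).
by rewrite -splitr.
Qed.

Let continuous_clifford_mul q : continuous (fun y => clifford n (q * y)).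
Proof.
move=> y; apply: (@continuous_comp _ _ _ (fun y => q * y) (clifford n)).
  exact: mulrl_continuous.
exact: continuous_clifford.
Qed.

Lemma measurable_bessel_fun q : measurable_fun setT (bessel_fun q).
Proof. exact: (measurable_powR_comp _ _ (@continuous_clifford_mul q)). Qed.

Let bessel_funM q r x : bessel_fun q x * bessel_fun r x =
  x `^ (2 * k * (n + 1) - 1 - beta) *
  (fun y => clifford n (q * y) * clifford n (r * y)) (x `^ (2 * k)).
Proof.
by rewrite -(powR_sqr x (2 * k * (n + 1) - 1 - beta)) /bessel_fun; ring.
Qed.

Let continuousM q r : continuous (fun y => clifford n (q * y) * clifford n (r * y)).
Proof. by move=> y; apply: cvgM; exact: continuous_clifford_mul. Qed.

Let derive_mul (m q y : R) : 0 < m ->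
  is_derive y 1 (fun y => clifford m (q * y)) (- (q * clifford (m + 1) (q * y))).
Proof.
move=> m0; have d1 : is_derive y 1 (fun y : R => q * y) q.
  by apply: is_derive_eq; rewrite /GRing.scale/= ?mulr0 ?addr0 ?add0r mulr1.
have := @is_derive1_comp R (clifford m) (fun y => q * y) y _ _ (is_derive_clifford _ m0) d1.
by rewrite mulNr [X in - X]mulrC.
Qed.

(** Green's identity for (y^(n+1) w')' + q y^n w = 0: the primitive is the Wronskian y^(n+1) (w v' -
    v w') of w = C_n(q y) and v = C_n(r y), divided by q - r. *)
Let integral_diff q r : q != r ->
  (weight beta).-integrable setT (EFin \o (fun x => bessel_fun q x * bessel_fun r x)) /\
  (\int[weight beta]_x (bessel_fun q x * bessel_fun r x)%:E =
  ((q * clifford (n + 1) q * clifford n r - r * clifford n q * clifford (n + 1) r) /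
    (q - r) / (2 * k))%:E)%E.
Proof.
move=> qr; rewrite -subr_eq0 in qr.
under eq_integral do rewrite bessel_funM.
rewrite (_ : (fun x => _) = (fun x : R => x `^ (2 * k * (n + 1) - 1 - beta) *
  (fun y => clifford n (q * y) * clifford n (r * y)) (x `^ (2 * k)))); last first.
  by apply/funext => x; exact: bessel_funM.
have dG (s y : R) := @derive_mul n s y n0.
have dH (s y : R) := @derive_mul (n + 1) s y n1.
have rec y : clifford n y = (n + 1) * clifford (n + 1) y - y * clifford (n + 1 + 1) y.
  exact: clifford_rec.
have cGG   := @continuousM q r.
have := @weight_FTC _ k beta k0 (n + 1)
  (fun y => (q * clifford (n + 1) (q * y) * clifford n (r * y) -
    r * clifford n (q * y) * clifford (n + 1) (r * y)) / (q - r)) _ _ n1.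
move: (clifford n) (clifford (n + 1)) (clifford (n + 1 + 1)) dG dH rec cGG.
move=> G H K dG dH rec cGG /(_ (fun y => (- q ^+ 2 * K (q * y) * G (r * y) +
  r ^+ 2 * G (q * y) * K (r * y)) / (q - r)) _ _ cGG).
rewrite !mulr1; apply.
  move=> y.
  have dGq := dG q y; have dGr := dG r y; have dHq := dH q y; have dHr := dH r y.
  apply: is_derive_eq; rewrite /GRing.scale/=; field.
  by [].
move=> y; rewrite !rec; field.
by [].
Qed.

(** The primitive is the limit of the one for q != r as r tends to q, with C_(n+2) eliminated by the
    recurrence. *)
Let integral_same q :
  (weight beta).-integrable setT (EFin \o (fun x => bessel_fun q x * bessel_fun q x)) /\
  (\int[weight beta]_x (bessel_fun q x * bessel_fun q x)%:E =
  ((clifford n q ^+ 2 + q * clifford (n + 1) q ^+ 2 -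
    n * clifford (n + 1) q * clifford n q) / (2 * k))%:E)%E.
Proof.
under eq_integral do rewrite bessel_funM.
rewrite (_ : (fun x => _) = (fun x : R => x `^ (2 * k * (n + 1) - 1 - beta) *
  (fun y => clifford n (q * y) * clifford n (q * y)) (x `^ (2 * k)))); last first.
  by apply/funext => x; exact: bessel_funM.
have dG (y : R) := @derive_mul n q y n0.
have dH (y : R) := @derive_mul (n + 1) q y n1.
have rec y : clifford n y = (n + 1) * clifford (n + 1) y - y * clifford (n + 1 + 1) y.
  exact: clifford_rec.
have cGG   := @continuousM q q.
have := @weight_FTC _ k beta k0 (n + 1)
  (fun y => clifford n (q * y) ^+ 2 + q * y * clifford (n + 1) (q * y) ^+ 2 -
    n * clifford (n + 1) (q * y) * clifford n (q * y)) _ _ n1.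
move: (clifford n) (clifford (n + 1)) (clifford (n + 1 + 1)) dG dH rec cGG.
move=> G H K dG dH rec cGG /(_ (fun y => - 2 * q * G (q * y) * H (q * y) +
  q * H (q * y) ^+ 2 - 2 * q ^+ 2 * y * H (q * y) * K (q * y) +
  n * q * (K (q * y) * G (q * y) + H (q * y) ^+ 2)) _ _ cGG).
rewrite !mulr1; apply.
  move=> y; have dGq := dG y; have dHq := dH y.
  by apply: is_derive_eq; rewrite /GRing.scale/=; ring.
by move=> y; rewrite !rec; ring.
Qed.

Lemma bessel_fun_mem_L2 q : bessel_fun q \in Lfun (weight beta) 2%:E.
Proof.
by apply: mem_L2; [exact: measurable_bessel_fun|case: (integral_same q)].
Qed.

Definition bessel_L2 q : L2 (weight beta) := Lfun_Sub (lee1n 2) (bessel_fun_mem_L2 q).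

Lemma inner_bessel_L2_diff q r : q != r ->
  L2inner (weight beta) (bessel_L2 q) (bessel_L2 r) =
  (q * clifford (n + 1) q * clifford n r - r * clifford n q * clifford (n + 1) r) /
    (q - r) / (2 * k).
Proof. by move=> qr; rewrite /L2inner /Rintegral (integral_diff qr).2. Qed.

Lemma inner_bessel_L2_same q :
  L2inner (weight beta) (bessel_L2 q) (bessel_L2 q) =
  (clifford n q ^+ 2 + q * clifford (n + 1) q ^+ 2 -
    n * clifford (n + 1) q * clifford n q) / (2 * k).
Proof. by rewrite /L2inner /Rintegral (integral_same q).2. Qed.

End bessel_family.

(** * The orthonormal Bessel family and its uniform bounds *)

Section bessel_basis.
Context {R : realType}.
Variables (k beta nu : R).
Hypotheses (k0 : 0 < k) (nu0 : 0 < nu).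
Local Opaque Gamma.
Local Notation "'<<' f , g '>>'" := (L2inner (weight beta) f g).

Let nu1 : 0 < nu + 1. Proof. by rewrite ltr_wpDr. Qed.

Definition bessel_node (j : nat) : R := bessel_zero (nu + 1) j ^+ 2 / 4.
Local Notation q := bessel_node.

Lemma bessel_node0 : q 0 = 0.
Proof. by rewrite /q /= expr0n mul0r. Qed.

Lemma bessel_zero_gt0 j : 0 < bessel_zero (nu + 1) j.+1.
Proof. by have [z0 z1 _] := bessel_zero_spec j nu0; exact: le_lt_trans z1. Qed.

Lemma bessel_node_lt i j : (i < j)%N -> q i < q j.
Proof.
have mono l : bessel_zero (nu + 1) l < bessel_zero (nu + 1) l.+1.
  by case: (bessel_zero_spec l nu0).
have ge0 l : 0 <= bessel_zero (nu + 1) l by case: (bessel_zero_spec l nu0).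
move=> ij; rewrite /q ltr_pM2r ?invr_gt0// ltrXn2r//.
exact: (homo_ltn (r := <%R) (@lt_trans _ _) mono).
Qed.

Lemma bessel_node_gt0 j : 0 < q j.+1.
Proof. by rewrite -bessel_node0 bessel_node_lt. Qed.

Lemma bessel_node_ge0 j : 0 <= q j.
Proof. by rewrite /q divr_ge0// sqr_ge0. Qed.

Lemma bessel_node_neq i j : i != j -> q i != q j.
Proof.
by rewrite neq_ltn => /orP[] /bessel_node_lt h; rewrite ?(lt_eqF h)// gt_eqF.
Qed.

Lemma clifford_node j : clifford (nu + 1) (q j.+1) = 0.
Proof.
apply/eqP; rewrite /q -besselJ_eq0 ?bessel_zero_gt0//.
by have [_ _ ->] := bessel_zero_spec j nu0.
Qed.

(** Up to a constant factor this is the homogeneous boundary condition a Phi + Phi' = 0 at x = 1; it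
    removes both boundary terms in the inner product of two distinct modes. *)
Lemma clifford_node_mul j : q j * clifford (nu + 1) (q j) = 0.
Proof. by case: j => [|j]; rewrite ?bessel_node0 ?mul0r// clifford_node mulr0. Qed.

Lemma clifford_node_neq0 j : clifford nu (q j) != 0.
Proof.
case: j => [|j]; first by rewrite bessel_node0 gt_eqF// clifford0_gt0.
by apply: clifford_zero_neq0 => //; [exact: bessel_node_ge0|exact: clifford_node].
Qed.

(* Bessel's inequality for the orthogonal family of order nu+1 against its node 0. *)
Lemma bessel_node_summable : cvgn (series (fun j => (q j.+1)^-1)).
Proof.
pose G := clifford nu; pose H := clifford (nu + 1); pose K := clifford (nu + 1 + 1).
have Kn0 j : K (q j.+1) != 0.
  apply: contra_neq (clifford_node_neq0 j.+1) => Kj.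
  by rewrite clifford_rec// clifford_node -/K Kj !mulr0 subr0.
pose b r : L2 (weight beta) := bessel_L2 beta k0 nu1 r.
have bb i j : << b (q i.+1), b (q j.+1) >> =
    (i == j)%:R * (q j.+1 * K (q j.+1) ^+ 2 / (2 * k)).
  have [->|ij] := eqVneq i j.
    by rewrite inner_bessel_L2_same clifford_node expr0n/= mulr0 subr0 add0r mul1r.
  rewrite inner_bessel_L2_diff; last by rewrite bessel_node_neq.
  by rewrite !clifford_node mulr0 mulr0 mul0r subrr !mul0r.
have b0 j : << b (q j.+1), b 0 >> = K (q j.+1) * H 0 / (2 * k).
  rewrite inner_bessel_L2_diff ?(gt_eqF (bessel_node_gt0 j))//.
  rewrite -/K -/H mul0r mul0r !subr0; field.
  by rewrite !gt_eqF// bessel_node_gt0.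
pose s j := (q j.+1 * K (q j.+1) ^+ 2 / (2 * k)).
have s0 j : 0 < s j.
  have K2 : 0 < K (q j.+1) ^+ 2 by rewrite exprn_even_gt0//= Kn0.
  by rewrite divr_gt0 ?(mulr_gt0 (bessel_node_gt0 j) K2)// mulr_gt0.
pose e j : L2 (weight beta) := (Num.sqrt (s j))^-1 *: b (q j.+1).
have oe i j : << e i, e j >> = (i == j)%:R.
  rewrite L2innerZl L2innerZr bb -/(s j).
  have [->|ij] := eqVneq i j; last by rewrite mul0r !mulr0.
  rewrite mul1r mulrA -invfM -expr2 sqr_sqrtr ?ltW// mulVf//.
  by rewrite gt_eqF.
have : cvgn (series (fun j => << e j, b 0 >> ^+ 2)) by exact: bessel_cvg.
(* The unknown values K(q_j)^2 cancel between the squared inner product and the squared norm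
   [s j]. *)
have -> : (fun j => << e j, b 0 >> ^+ 2) = (H 0 ^+ 2 / (2 * k)) *: (fun j => (q j.+1)^-1).
  apply/funext => j; rewrite L2innerZl b0 exprMn exprVn sqr_sqrtr ?ltW//.
  rewrite /s -[RHS]/(H 0 ^+ 2 / (2 * k) * (q j.+1)^-1).
  have := Kn0 j; have := bessel_node_gt0 j.
  move: (q j.+1) (K _) (H 0) => p x y p0 x0; field.
  by rewrite x0 !gt_eqF.
move=> /(@is_cvg_seriesZ _ _ (H 0 ^+ 2 / (2 * k))^-1).
rewrite scalerA mulVf ?scale1r//.
have H0 : 0 < H 0 by exact: clifford0_gt0.
have H2 : 0 < H 0 ^+ 2 by rewrite exprn_gt0.
have k20 : 0 < 2 * k by rewrite mulr_gt0.
by rewrite gt_eqF// divr_gt0.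
Qed.

(** At the node 0 the function is C_nu(0) x^(-a), whence the division by C_nu(0). *)
Definition bessel_norm (j : nat) : R :=
  if j is 0 then Num.sqrt (2 * (nu + 1) * k) / clifford nu 0
  else Num.sqrt (2 * k) / `|clifford nu (q j)|.

Definition bessel_basis j : L2 (weight beta) :=
  bessel_norm j *: bessel_L2 beta k0 nu0 (q j).

Lemma bessel_basis_orthonormal i j :
  << bessel_basis i, bessel_basis j >> = (i == j)%:R.
Proof.
rewrite L2innerZl L2innerZr.
have [->|ij] := eqVneq i j; last first.
  rewrite inner_bessel_L2_diff; last exact: bessel_node_neq.
  rewrite clifford_node_mul mul0r (mulrAC (q j)) clifford_node_mul mul0r subrr.
  by rewrite !mul0r !mulr0.
rewrite inner_bessel_L2_same; case: j => [|j].
  rewrite bessel_node0 mul0r addr0 /bessel_norm mulrA.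
  have -> : clifford nu 0 = (nu + 1) * clifford (nu + 1) 0.
    by rewrite clifford_rec// mul0r subr0.
  have H0 := clifford0_gt0 nu1.
  have h : 0 <= 2 * (nu + 1) * k by rewrite !mulr_ge0// ltW.
  have n0 := lt0r_neq0 nu1; have k0' := lt0r_neq0 k0.
  move: (clifford (nu + 1) 0) H0 => c /lt0r_neq0 c0.
  have := sqr_sqrtr h; move: (Num.sqrt _) => t tE.
  have -> : t / ((nu + 1) * c) * (t / ((nu + 1) * c)) = t ^+ 2 / ((nu + 1) * c) ^+ 2.
    by field; rewrite c0.
  rewrite tE /=; field.
  by rewrite c0 k0'.
rewrite clifford_node expr0n/= !mulr0 mul0r subr0 addr0 /bessel_norm.
have k20 : 0 <= 2 * k by rewrite mulr_ge0// ltW.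
have g0 : `|clifford nu (q j.+1)| != 0 by rewrite normr_eq0 clifford_node_neq0.
have k0' := lt0r_neq0 k0.
rewrite -[clifford nu (q j.+1) ^+ 2](real_normK (num_real _)).
have := sqr_sqrtr k20; move: (Num.sqrt _) g0 => t g0 tE.
rewrite mulrA; move: `|_| g0 => c c0.
have -> : t / c * (t / c) = t ^+ 2 / c ^+ 2 by field.
by rewrite tE mulrA divfK ?expf_neq0// divff// mulf_neq0.
Qed.

Definition bessel_bound : R := Num.sqrt (2 * k) + Num.sqrt (2 * (nu + 1) * k).

Lemma bessel_norm_clifford j : `|bessel_norm j * clifford nu (q j)| <= bessel_bound.
Proof.
have g0 := clifford_node_neq0 j.
rewrite /bessel_bound /bessel_norm; case: j g0 => [|j] g0.
  rewrite bessel_node0 divfK; last by rewrite gt_eqF// clifford0_gt0.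
  by rewrite ger0_norm ?sqrtr_ge0// lerDr sqrtr_ge0.
rewrite normrM normrM normfV normr_id divfK ?normr_eq0// ger0_norm ?sqrtr_ge0//.
by rewrite lerDl sqrtr_ge0.
Qed.

(** The exponent of x in front of C_nu, less the power lost in the energy estimate. *)
Definition bessel_env : R := (2 * k * (nu + 1) - 1 - beta) / 2 - k * (2 * nu + 1).

(** Compare the energies at q_j x^(2k) and q_j. At q_j only C_nu(q_j)^2 remains, the powers of q_j
    cancel, and a square root is taken. For j = 0 the power of x is at least 1. *)
Lemma clifford_node_le j (x : R) : 0 < x <= 1 ->
  `|clifford nu (q j * x `^ (2 * k))| <= x `^ (- (k * (2 * nu + 1))) * `|clifford nu (q j)|.
Proof.
move=> /andP[x0 x1].
have xk0 : 0 < x `^ (k * (2 * nu + 1)) by rewrite powR_gt0.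
have kn0 : 0 < k * (2 * nu + 1) by rewrite mulr_gt0// addr_gt0// mulr_gt0.
have pow_le1 (r : R) : 0 < r -> x `^ r <= 1.
  move=> r0; rewrite -[leRHS](_ : 1 `^ r = 1); last by rewrite powR1.
  by apply: ge0_ler_powR; rewrite ?nnegrE// ltW.
rewrite powRN ler_pdivlMl//.
case: j => [|j].
  by rewrite bessel_node0 mul0r ler_piMl// pow_le1.
have qj := bessel_node_gt0 j.
have := @clifford_energy_le _ nu (q j.+1 * x `^ (2 * k)) (q j.+1) nu0.
rewrite mulr_gt0 ?powR_gt0//= ler_piMr ?(ltW qj)//; last first.
  by rewrite pow_le1// mulr_gt0.
move=> /(_ isT); rewrite clifford_node [0 ^+ 2]expr0n/= mulr0 addr0.
rewrite powRM ?(ltW qj) ?powR_ge0// -mulrA ler_pM2l ?powR_gt0//.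
rewrite -powRrM (_ : 2 * k * (2 * nu + 1) = k * (2 * nu + 1) * 2); last by ring.
rewrite powRrM powR_mulrn ?powR_ge0// => h.
rewrite -(@ler_pXn2r _ 2)// ?nnegrE ?mulr_ge0 ?powR_ge0// exprMn !real_normK ?num_real//.
apply: le_trans h; rewrite ler_wpM2l ?sqr_ge0// lerDl mulr_ge0 ?sqr_ge0//.
by rewrite mulr_ge0 ?powR_ge0// ltW.
Qed.

Lemma bessel_basis_le j (x : R) : 0 < x <= 1 ->
  `|bessel_basis j x| <= bessel_bound * x `^ bessel_env.
Proof.
move=> x01; have x0 : 0 < x by case/andP : x01.
have -> : bessel_basis j x = bessel_norm j * (x `^ ((2 * k * (nu + 1) - 1 - beta) / 2) *
  clifford nu (q j * x `^ (2 * k))) by [].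
rewrite /bessel_env powRDgt0// !normrM (ger0_norm (powR_ge0 _ _)) mulrCA [leRHS]mulrCA.
rewrite ler_wpM2l ?powR_ge0//.
apply: (@le_trans _ _ (`|bessel_norm j| * (x `^ (- (k * (2 * nu + 1))) * `|clifford nu (q j)|))).
  by rewrite ler_wpM2l// clifford_node_le.
rewrite mulrCA mulrC ler_wpM2r ?powR_ge0// -normrM.
exact: bessel_norm_clifford.
Qed.

Lemma continuous_bessel_basis j (x : R) : 0 < x -> {for x, continuous (bessel_basis j)}.
Proof.
move=> x0; apply: (@cvgMr _ _ _ _ (fun x => x `^ ((2 * k * (nu + 1) - 1 - beta) / 2) *
  clifford nu (q j * x `^ (2 * k)))).
apply: cvgM; first exact: (is_derive_cvg (is_derive1_powR _ x0)).
apply: (@continuous_comp _ _ _ (fun x => q j * x `^ (2 * k)) (clifford nu)).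
  by apply: cvgMr; exact: (is_derive_cvg (is_derive1_powR _ x0)).
exact: continuous_clifford.
Qed.

End bessel_basis.

(** * The semigroup and its boundary values *)

Section parameters.
Context {R : realType}.
Variables (alpha beta mu : R).
Hypotheses (alpha_lt2 : alpha < 2) (mu_lt : mu < mu_crit (alpha + beta)).

Lemma kappa_gt0 : 0 < kappa alpha.
Proof. by rewrite divr_gt0// subr_gt0. Qed.

Lemma bessel_order_gt0 : 0 < bessel_order alpha beta mu.
Proof. by rewrite divr_gt0 ?kappa_gt0// sqrtr_gt0 subr_gt0. Qed.

End parameters.

Lemma is_cvg_seriesS {R : realType} (f : R^nat) :
  cvgn (series (fun j => f j.+1)) -> cvgn (series f).
Proof.
move=> cf; apply: (cvgP (f 0%N + limn (series (fun j => f j.+1)))).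
rewrite -cvg_shiftS/=.
rewrite (_ : (fun n => _) = (fun n => f 0%N + series (fun j => f j.+1) n)).
  by apply: cvgD; [exact: cvg_cst|exact: cf].
by apply/funext => n; rewrite /series/= big_nat_recl.
Qed.

(** Used to replace [Phi] by [eigenbasis]: their agreement is proved for x > 0 only. *)
Lemma Lnorm_weight_eq {R : realType} (beta : R) (f g : R -> R) :
  measurable_fun setT f -> measurable_fun setT g ->
  (forall x : R, 0 < x < 1 -> f x = g x) ->
  Lnorm (weight beta) 2%:E (EFin \o f) = Lnorm (weight beta) 2%:E (EFin \o g).
Proof.
move=> mf mg fg; rewrite !Lnorm.unlock; congr (_ `^ _)%E.
have msq (h : R -> R) : measurable_fun setT h -> measurable_fun setT (fun x => `|h x| `^ 2).
  move=> mh; apply: (measurableT_comp (measurable_powR 2)).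
  exact: measurableT_comp.
transitivity (\int[weight beta]_x (`|f x| `^ 2)%:E)%E; first by [].
transitivity (\int[weight beta]_x (`|g x| `^ 2)%:E)%E; last by [].
rewrite !integral_weight; [|exact: msq|exact: msq].
by apply: eq_integral => x /set_mem/=; rewrite in_itv/= => /fg ->.
Qed.

Section eigenbasis.
Context {R : realType}.
Variables (alpha beta mu : R).
Hypotheses (alpha_lt2 : alpha < 2) (mu_lt : mu < mu_crit (alpha + beta)).
Local Opaque Gamma.
Local Notation "'<<' f , g '>>'" := (L2inner (weight beta) f g).
Local Notation k := (kappa alpha).
Local Notation nu := (bessel_order alpha beta mu).
Local Notation lam := (lambda alpha beta mu).
Let k0 : 0 < k := kappa_gt0 alpha_lt2.
Let nu0 : 0 < nu := bessel_order_gt0 alpha_lt2 mu_lt.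

Definition eigenbasis (j : nat) : L2 (weight beta) := bessel_basis beta k0 nu0 j.
Local Notation e := eigenbasis.

Lemma eigenbasis_orthonormal i j : << e i, e j >> = (i == j)%:R.
Proof. exact: bessel_basis_orthonormal. Qed.

Let exponentE : (2 * k * (nu + 1) - 1 - beta) / 2 = - exponent_a alpha beta mu.
Proof.
rewrite /exponent_a /bessel_order; set s := Num.sqrt _.
have := lt0r_neq0 k0; rewrite /kappa => h.
field; move: h; apply: contra_neq => ->; ring.
Qed.

Let exponentE2 : - exponent_a alpha beta mu = (1 - alpha - beta) / 2 + k * nu.
Proof.
rewrite /exponent_a /bessel_order; set s := Num.sqrt _.
have h := lt0r_neq0 k0.
by rewrite [k * _]mulrC divfK//; field.
Qed.

(** The factor (z/2)^nu of J_nu(z x^k) cancels against that of |J_nu(z)|, leaving x^(k nu), which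
    completes the exponent to -a. *)
Lemma Phi_eigenbasis j (x : R) : 0 < x -> Phi alpha beta mu j x = e j x.
Proof.
move=> x0.
have -> : e j x = bessel_norm k nu j *
    (x `^ ((2 * k * (nu + 1) - 1 - beta) / 2) *
     clifford nu (bessel_node nu j * x `^ (2 * k))) by [].
rewrite exponentE; case: j => [|j].
  rewrite bessel_node0 mul0r /bessel_norm /= [RHS]mulrCA divfK 1?mulrC//.
  by rewrite gt_eqF// clifford0_gt0.
rewrite exponentE2 /Phi.
have z0 := bessel_zero_gt0 nu0 j; set z := bessel_zero _ _ in z0 *.
have xk0 : 0 <= x `^ k by exact: powR_ge0.
rewrite (besselJE nu0 (ltW z0)) (besselJE nu0 (mulr_ge0 (ltW z0) xk0)).
rewrite /bessel_norm /bessel_node -/z.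
have z20 : 0 < z / 2 by rewrite divr_gt0.
have p0 : 0 < (z / 2) `^ nu by rewrite powR_gt0.
rewrite normrM (gtr0_norm p0).
have -> : z * x `^ k / 2 = z / 2 * x `^ k by ring.
rewrite (@powRM _ (z / 2) (x `^ k)) ?(ltW z20)// -powRrM powRDgt0//.
have -> : (z * x `^ k) ^+ 2 / 4 = z ^+ 2 / 4 * x `^ (2 * k).
  have -> : x `^ (2 * k) = (x `^ k) ^+ 2 by rewrite -powR_mulrn// -powRrM mulrC.
  by rewrite exprMn mulrAC.
have C0 : `|clifford nu (z ^+ 2 / 4)| != 0.
  by rewrite normr_eq0; exact: (clifford_node_neq0 nu0 j.+1).
move: (clifford nu (z ^+ 2 / 4 * _)) => A.
by field; rewrite C0 gt_eqF.
Qed.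

Lemma measurable_Phi j : measurable_fun setT (Phi alpha beta mu j).
Proof.
case: j => [|j].
  by apply: measurable_funM => //; exact: measurable_powR.
have z0 := bessel_zero_gt0 nu0 j.
rewrite /Phi; set z := bessel_zero _ _ in z0 *; set c := _ / _.
rewrite (_ : (fun x => _) = (fun x => c * x `^ ((1 - alpha - beta) / 2) *
  ((fun y => (y / 2) `^ nu * clifford nu (y ^+ 2 / 4)) (z * x `^ k)))); last first.
  apply/funext => x; rewrite besselJE// mulr_ge0 ?powR_ge0//; exact: ltW.
have mp : measurable_fun setT (fun x : R => z * x `^ k).
  by apply: measurable_funM => //; exact: measurable_powR.
apply: measurable_funM.
  by apply: measurable_funM => //; exact: measurable_powR.
suff mJ : measurable_fun setT (fun y : R => (y / 2) `^ nu * clifford nu (y ^+ 2 / 4)).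
  exact: (measurableT_comp mJ mp).
have m2 : measurable_fun setT (fun y : R => y / 2) by exact: measurable_funM.
have m4 : measurable_fun setT (fun y : R => y ^+ 2 / 4).
  by apply: measurable_funM => //; exact: measurable_funX.
apply: measurable_funM; first exact: (measurableT_comp (measurable_powR nu) m2).
apply: (measurableT_comp _ m4); apply: continuous_measurable_fun.
exact: continuous_clifford.
Qed.

Lemma lambdaE j : lam j = 4 * k ^+ 2 * bessel_node nu j.
Proof.
case: j => [|j]; first by rewrite bessel_node0 mulr0.
by rewrite /lambda /bessel_node; field.
Qed.

Let k4 : 0 < 4 * k ^+ 2. Proof. by rewrite mulr_gt0// exprn_gt0. Qed.

Lemma lambda_ge0 j : 0 <= lam j.
Proof. by rewrite lambdaE (mulr_ge0 (ltW k4))// bessel_node_ge0. Qed.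

Lemma lambda_gt0 j : 0 < lam j.+1.
Proof. by rewrite lambdaE (mulr_gt0 k4)// bessel_node_gt0. Qed.

(* 1 at j = 0, where lambda vanishes. *)
Definition inv_lambda (j : nat) : R := if j is 0 then 1 else (lam j)^-1.

Lemma inv_lambda_ge0 j : 0 <= inv_lambda j.
Proof. by case: j => [//|j]; rewrite /inv_lambda invr_ge0 lambda_ge0. Qed.

Lemma inv_lambda_summable : cvgn (series inv_lambda).
Proof.
apply: is_cvg_seriesS.
rewrite (_ : (fun j => _) = (4 * k ^+ 2)^-1 *: (fun j => (bessel_node nu j.+1)^-1)).
  by apply: is_cvg_seriesZ; exact: (bessel_node_summable beta k0 nu0).
apply/funext => j.
by rewrite /inv_lambda lambdaE invfM.
Qed.

(** For j >= 1 this weakens e^(-s) <= 1/s; the summand 1 accounts for the mode 0. *)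
Lemma expR_lambda_le j (t : R) : 0 < t ->
  expR (- lam j * t) <= (1 + t^-1) * inv_lambda j.
Proof.
move=> t0; have ti : 0 <= t^-1 by rewrite invr_ge0 ltW.
case: j => [|j].
  by rewrite /lambda /inv_lambda oppr0 mul0r expR0 mulr1 lerDl.
have l0 := lambda_gt0 j; have lt0 : 0 < lam j.+1 * t by rewrite mulr_gt0.
rewrite /inv_lambda mulNr expRN (@le_trans _ _ (lam j.+1 * t)^-1)//.
  rewrite lef_pV2 ?posrE ?expR_gt0//.
  by rewrite (le_trans _ (expR_ge1Dx _))// lerDr.
by rewrite invfM mulrC ler_wpM2r ?invr_ge0 ?(ltW l0)// lerDr.
Qed.

(** The weight does not charge the point 1; this is the value of the explicit formula, which is
    continuous there. *)
Definition boundary_value (j : nat) : R := e j 1.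

Lemma boundary_value_le j : `|boundary_value j| <= bessel_bound k nu.
Proof.
have h : 0 < (1 : R) <= 1 by rewrite ltr01 lexx.
by have := bessel_basis_le beta k0 nu0 j h; rewrite powR1 mulr1.
Qed.

Definition heat_coef (t : R) (z : L2 (weight beta)) (j : nat) : R :=
  expR (- lam j * t) * << e j, z >>.

Lemma inner_Phi (z : L2 (weight beta)) j : << z, Phi alpha beta mu j >> = << e j, z >>.
Proof.
rewrite L2innerC /L2inner /Rintegral; congr fine.
rewrite !integral_weight//.
- by apply: eq_integral => x /set_mem/=; rewrite in_itv/= => /andP[x0 _]; rewrite Phi_eigenbasis.
- by apply: measurable_funM; exact: measurable_L2.
- by apply: measurable_funM; [exact: measurable_Phi|exact: measurable_L2].
Qed.

Lemma expR_lambda_le1 j (t : R) : 0 <= t -> 0 < expR (- lam j * t) <= 1.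
Proof.
by move=> t0; rewrite expR_gt0 expR_le1 mulNr oppr_le0 mulr_ge0// lambda_ge0.
Qed.

Lemma heat_coef_summable (t : R) z : 0 <= t ->
  cvgn (series (fun j => heat_coef t z j ^+ 2)).
Proof.
move=> t0; apply: series_le_cvg (bessel_cvg eigenbasis_orthonormal (z := z)).
- by move=> j; exact: sqr_ge0.
- by move=> j; exact: sqr_ge0.
- move=> j; rewrite exprMn ler_piMl ?sqr_ge0//.
  have /andP[e0 e1] := expR_lambda_le1 j t0.
  by rewrite exprn_ile1// ltW.
Qed.

(** [semigroup] is a choice by [xget]; the Riesz-Fischer theorem shows that the set chosen from is
    inhabited. *)
Lemma semigroup_expansion (t : R) (z : L2 (weight beta)) : 0 <= t ->
  expansion e (heat_coef t z) (semigroup alpha mu t z).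
Proof.
move=> t0.
have E (w : L2 (weight beta)) n : Lnorm (weight beta) 2%:E (fun x : R =>
      (\sum_(j < n) expR (- lam j * t) * << z, Phi alpha beta mu j >> *
        Phi alpha beta mu j x - w x)%:E) =
    (L2norm (psum e (heat_coef t z) n - w))%:E.
  pose f x := \sum_(j < n) expR (- lam j * t) * << z, Phi alpha beta mu j >> *
        Phi alpha beta mu j x - w x.
  have -> : (L2norm (psum e (heat_coef t z) n - w))%:E =
      Lnorm (weight beta) 2%:E (EFin \o (psum e (heat_coef t z) n - w)).
    exact: finite_norm_fine.
  apply: (@Lnorm_weight_eq _ beta f).
  - apply: measurable_funB; last exact: measurable_L2.
    by apply: measurable_sum => j; apply: measurable_funM => //; exact: measurable_Phi.
  - exact: measurable_L2.
  - move=> x /andP[x0 _].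
    have -> : (psum e (heat_coef t z) n - w) x = psum e (heat_coef t z) n x - w x by [].
    rewrite psumE /f; congr (_ - _); apply: eq_bigr => j _.
    by rewrite Phi_eigenbasis// inner_Phi.
have [w0 w0P] := riesz_fischer eigenbasis_orthonormal (@heat_coef_summable t z t0).
have : [set w : L2 (weight beta) |
    Lnorm (weight beta) 2%:E (fun x : R =>
      (\sum_(j < n) expR (- lam j * t) *
         << z, Phi alpha beta mu j >> * Phi alpha beta mu j x - w x)%:E)
      @[n --> \oo] --> 0%E] (semigroup alpha mu t z).
  apply: xgetPex; exists w0 => /=; under eq_fun do rewrite E.
  by apply: cvg_EFin; [exact: nearW|exact: w0P].
by rewrite /=; under eq_fun do rewrite E; move=> /fine_cvgP[_].
Qed.

Lemma inner_eigenbasis_le (z : L2 (weight beta)) j : `|<< e j, z >>| <= L2norm z.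
Proof.
apply: (le_trans (L2inner_le _ _)).
by rewrite L2normE eigenbasis_orthonormal eqxx sqrtr1 mul1r.
Qed.

Lemma heat_coef_le (t : R) (z : L2 (weight beta)) j : 0 < t ->
  `|heat_coef t z j| <= L2norm z * (1 + t^-1) * inv_lambda j.
Proof.
move=> t0; rewrite normrM (ger0_norm (expR_ge0 _)) mulrC -mulrA.
by apply: ler_pM => //; [exact: inner_eigenbasis_le|exact: expR_lambda_le].
Qed.

Definition boundary_series (t : R) (z : L2 (weight beta)) : R :=
  limn (series (fun j => heat_coef t z j * boundary_value j)).

Lemma boundary_series_cvg (t : R) (z : L2 (weight beta)) : 0 < t ->
  series (fun j => heat_coef t z j * boundary_value j) @ \oo --> boundary_series t z.
Proof.
move=> t0; apply: normed_cvg.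
pose A := L2norm z * (1 + t^-1) * bessel_bound k nu.
apply: (@series_le_cvg _ _ (fun j => A * inv_lambda j)) => [j|j|j|].
- exact: normr_ge0.
- rewrite mulr_ge0 ?inv_lambda_ge0// !mulr_ge0 ?L2norm_ge0//.
    by rewrite addr_ge0// invr_ge0 ltW.
  exact: (le_trans (normr_ge0 _) (boundary_value_le 0)).
- rewrite /= normrM /A mulrAC; apply: ler_pM => //; first exact: heat_coef_le.
  exact: boundary_value_le.
- exact: (is_cvg_seriesZ inv_lambda_summable).
Qed.

Lemma left_limit1_semigroup (t : R) (z : L2 (weight beta)) : 0 < t ->
  left_limit1 beta (semigroup alpha mu t z) (boundary_series t z).
Proof.
move=> t0.
(* The uniform bound holds on (0,1] only; cutting off outside (0,1) makes the series converge
   everywhere, so that its sum is measurable on the line. *)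
pose p j x := heat_coef t z j * (\1_(`]0%R, 1%R[%classic : set R) x * e j x).
pose g x := limn (series (p ^~ x)).
pose A := L2norm z * (1 + t^-1).
have A0 : 0 <= A by rewrite mulr_ge0 ?L2norm_ge0// addr_ge0// invr_ge0 ltW.
have coefA j : `|heat_coef t z j| <= A * inv_lambda j by exact: heat_coef_le.
have Ai0 j : 0 <= A * inv_lambda j by rewrite mulr_ge0// inv_lambda_ge0.
have sumA (B : R) : cvgn (series (fun j => A * inv_lambda j * B)).
  have := is_cvg_seriesZ (k := A * B) inv_lambda_summable.
  rewrite (_ : (_ *: _) = (fun j => A * inv_lambda j * B))//.
  by apply/funext => j; exact: mulrAC.
have pE j x : 0 < x < 1 -> p j x = heat_coef t z j * e j x.
  by move=> x01; rewrite /p indicE mem_set ?mul1r//= in_itv.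
have p0 j x : ~~ (0 < x < 1) -> p j x = 0.
  by move=> x01; rewrite /p indicE memNset ?mul0r ?mulr0//= in_itv; exact/negP.
pose b x := bessel_bound k nu * x `^ bessel_env k beta nu.
have cb (x : R) : 0 < x -> b y @[y --> x] --> b x.
  by move=> x0; apply: cvgMr; exact: (is_derive_cvg (is_derive1_powR _ x0)).
have bb0 : 0 <= bessel_bound k nu by rewrite addr_ge0// sqrtr_ge0.
have b0 x : 0 <= b x by rewrite mulr_ge0// powR_ge0.
have pb j x : 0 < x <= 1 -> `|heat_coef t z j * e j x| <= A * inv_lambda j * b x.
  by move=> x01; rewrite normrM; apply: ler_pM => //; exact: bessel_basis_le.
(* Tannery's theorem asks for a majorant free of y: near x the power of y is absorbed into b(x) +
   1. *)
have near_b (x : R) : 0 < x -> \forall y \near x, b y <= b x + 1.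
  move=> x0; have /cvgrPdist_le/(_ _ ltr01) := cb x x0; apply: filterS => y.
  by rewrite ler_norml => /andP[h _]; lra.
have ce j (x : R) : 0 < x ->
    heat_coef t z j * e j y @[y --> x] --> heat_coef t z j * e j x.
  by move=> x0; apply: cvgMr; exact: continuous_bessel_basis.
have cvg_p x : cvgn (series (p ^~ x)).
  have [x01|x01] := boolP (0 < x < 1).
    apply: normed_cvg; apply: series_le_cvg (sumA (b x)) => j //=.
      exact: mulr_ge0.
    by rewrite pE// pb//; case/andP : x01 => ? ?; apply/andP; split => //; exact: ltW.
  have h : series (p ^~ x) @ \oo --> (0 : R).
    apply: cvg_near_cst; near=> n.
    by rewrite /series/= big1// => j _; rewrite p0.
  exact: (cvgP _ h).
have mg : measurable_fun setT g.
  apply: (measurable_fun_cvg (h := fun n x => series (p ^~ x) n)).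
    move=> n; rewrite /series/=; apply: measurable_sum => j.
    apply: measurable_funM => //; apply: measurable_funM => //.
    exact: measurable_L2.
  by move=> x _; exact: cvg_p.
exists g; split.
- apply: (expansion_pointwise (semigroup_expansion z (ltW t0)) mg).
  apply: weight_ae01 => x x01.
  rewrite (_ : (fun j => heat_coef t z j * e j x) = p ^~ x); first exact: cvg_p.
  by apply/funext => j; rewrite pE.
- move=> x; rewrite in_itv/= => x01; have x0 : 0 < x by case/andP : x01.
  have nx01 : \forall y \near x, 0 < y < 1.
    have : x \in `]0%R, 1%R[ by rewrite in_itv.
    by move/near_in_itvoo; apply: filterS => y; rewrite in_itv.
  suff : limn (series (p ^~ y)) @[y --> x] --> limn (series (p ^~ x)) by [].
  apply: (@series_cvg_dominated _ R (nbhs x) _ p (p ^~ x) _ (sumA (b x + 1))).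
  + move=> j; rewrite pE//.
    apply: (@cvg_trans _ (heat_coef t z j * e j y @[y --> x])).
      by apply: near_eq_cvg; near=> y; rewrite pE//; near: y.
    exact: ce.
  + near=> y; have y01 : 0 < y < 1 by near: y.
    move=> j; rewrite pE//; apply: (le_trans (pb _ _ _)).
      by case/andP : y01 => ? ?; apply/andP; split => //; exact: ltW.
    rewrite ler_wpM2l//; near: y; exact: near_b.
  + move=> j; rewrite pE//; apply: (le_trans (pb _ _ _)).
      by case/andP : x01 => ? ?; apply/andP; split => //; exact: ltW.
    by rewrite ler_wpM2l// lerDl.
- have nx01 : \forall y \near (1 : R)^'-, 0 < y < 1.
    near=> y; apply/andP; split; near: y; [exact: nbhs_left_gt|exact: nbhs_left_lt].
  suff : limn (series (p ^~ y)) @[y --> 1^'-] --> boundary_series t z by [].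
  apply: (@series_cvg_dominated _ R _ _ p _ _ (sumA (b 1 + 1))).
  + move=> j.
    apply: (@cvg_trans _ (heat_coef t z j * e j y @[y --> 1^'-])).
      by apply: near_eq_cvg; near=> y; rewrite pE//; near: y.
    exact: (cvg_at_left_filter (ce _ _ ltr01)).
  + near=> y; have y01 : 0 < y < 1 by near: y.
    move=> j; rewrite pE//; apply: (le_trans (pb _ _ _)).
      by case/andP : y01 => ? ?; apply/andP; split => //; exact: ltW.
    rewrite ler_wpM2l//; near: y.
    have /cvgrPdist_le/(_ _ ltr01) := cvg_at_left_filter (cb 1 ltr01).
    by apply: filterS => v; rewrite ler_norml => /andP[h _]; lra.
  + move=> j; apply: (le_trans (pb _ _ _)); first by rewrite ltr01 lexx.
    by rewrite ler_wpM2l// lerDl.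
Unshelve. all: by end_near. Qed.

(** Two continuous representatives coincide on (0,1), so the value chosen by [lim1] is
    determined. *)
Lemma left_limit1_unique (w : R -> R) (l l' : R) :
  left_limit1 beta w l -> left_limit1 beta w l' -> l = l'.
Proof.
move=> [g [wg cg gl]] [g' [wg' cg' gl']].
have gg' : g = g' %[ae weight beta] by exact: (ae_eq_trans (ae_eq_sym wg) wg').
have E := weight_ae_eq_continuous cg cg' gg'.
suff gl'' : g y @[y --> (1 : R)^'-] --> l'.
  exact: (cvg_unique (@norm_hausdorff _ R) gl gl'').
apply: (@cvg_trans _ (g' y @[y --> (1 : R)^'-])); last exact: gl'.
apply: near_eq_cvg; near=> y.
apply/esym/E/andP; split; near: y; [exact: nbhs_left_gt|exact: nbhs_left_lt].
Unshelve. all: by end_near. Qed.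

Lemma lim1_semigroup (t : R) (z : L2 (weight beta)) : 0 < t ->
  lim1 beta (semigroup alpha mu t z) = boundary_series t z.
Proof.
move=> t0; have h := left_limit1_semigroup z t0.
apply: (left_limit1_unique _ h).
by apply: xgetPex; exists (boundary_series t z).
Qed.

End eigenbasis.

(** * The control operator *)

Section duhamel_kernel.
Context {R : realType}.
Local Notation leb := (@lebesgue_measure R).
Variable T : R.
Hypothesis T0 : 0 < T.
Local Notation mT := (lebesgue_on `]0, T[).
Implicit Types (h : R -> R) (tau l : R).

Let restrE tau h : tau <= T ->
  (EFin \o (fun t : R => \1_`]0, tau[ t * h t)) \_ `]0, T[ = (EFin \o h) \_ `]0, tau[.
Proof.
move=> tauT; apply/funext => t; rewrite !patchE /= indicE.
have [tt|tt] := boolP (t \in `]0%R, tau[%classic); last by rewrite mul0r if_same.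
rewrite mul1r ifT//; move: tt; rewrite !inE/= !in_itv/= => /andP[-> tt].
exact: lt_le_trans tauT.
Qed.

Lemma integrable_lebesgue_on_sub tau h : tau <= T -> measurable_fun setT h ->
  mT.-integrable setT (EFin \o (fun t : R => \1_`]0, tau[ t * h t)) <->
  leb.-integrable `]0, tau[ (EFin \o h).
Proof.
move=> tauT mh.
have m1h : measurable_fun setT (fun t : R => \1_`]0, tau[ t * h t) by exact: measurable_funM.
apply: (iff_trans (integrable_lebesgue_on _ m1h)).
apply: (iff_trans (integrable_mkcond _ _)); first exact: measurable_itv.
rewrite restrE//; apply: iff_sym; apply: integrable_mkcond; exact: measurable_itv.
Qed.

Lemma Rintegral_lebesgue_on_sub tau h : tau <= T -> measurable_fun setT h ->
  (\int[mT]_t (\1_`]0, tau[ t * h t) = \int[leb]_(t in `]0, tau[) h t)%R.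
Proof.
move=> tauT mh; rewrite /Rintegral; congr fine.
rewrite integral_lebesgue_on; last exact: measurable_funM.
rewrite [LHS]integral_mkcond [RHS]integral_mkcond; congr integral.
exact: restrE.
Qed.

(** Extension by 0 beyond tau places the kernels of all tau in the one space L2(0,T). *)
Definition heat_kernel l tau (t : R) : R := \1_`]0, tau[ t * expR (- l * (tau - t)).

Let measurable_exp l tau : measurable_fun setT (fun t : R => expR (- l * (tau - t))).
Proof.
by apply: measurableT_comp => //; apply: measurable_funM => //; exact: measurable_funB.
Qed.

Lemma measurable_heat_kernel l tau : measurable_fun setT (heat_kernel l tau).
Proof. by apply: measurable_funM => //; exact: measurable_exp. Qed.

Let is_derive_exp l tau (t : R) :
  is_derive t 1 (fun t : R => expR (- l * (tau - t))) (l * expR (- l * (tau - t))).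
Proof.
by apply: is_derive_eq; rewrite /GRing.scale/=; ring.
Qed.

Let continuous_exp l tau (A : set R) :
  {within A, continuous (fun t : R => expR (- l * (tau - t)))}.
Proof.
by apply: continuous_subspaceT => t; exact: (is_derive_cvg (is_derive_exp l tau t)).
Qed.

Let heat_kernel_sqr l tau : (fun t : R => heat_kernel l tau t * heat_kernel l tau t) =
  (fun t : R => \1_`]0, tau[ t * expR (- (2 * l) * (tau - t))).
Proof.
apply/funext => t; rewrite /heat_kernel indicE; case: (t \in _); last by rewrite !mul0r.
by rewrite !mul1r -expRD; congr expR; ring.
Qed.

Let integrable_exp l tau :
  leb.-integrable `]0, tau[ (EFin \o (fun t : R => expR (- l * (tau - t)))).
Proof.
have h : leb.-integrable `[0, tau] (EFin \o (fun t : R => expR (- l * (tau - t)))).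
  apply: continuous_compact_integrable; last exact: continuous_exp.
  exact: segment_compact.
apply: integrableS h => //; exact: subset_itv_oo_cc.
Qed.

Lemma heat_kernel_mem_L2 l tau : heat_kernel l tau \in Lfun mT 2%:E.
Proof.
apply: mem_L2; first exact: measurable_heat_kernel.
rewrite heat_kernel_sqr; apply/integrable_lebesgue_on.
  by apply: measurable_funM => //; exact: measurable_exp.
have /integrable_mkcond h := integrable_exp (2 * l) tau.
apply: (integrableS measurableT) => //.
apply: eq_integrable (h (measurable_itv _)) => // t _.
by rewrite patchE /= indicE; case: ifP => _; rewrite ?mul1r ?mul0r.
Qed.

Definition heat_kernel_L2 l tau : L2 mT := Lfun_Sub (lee1n 2) (heat_kernel_mem_L2 l tau).

Lemma heat_kernel_sqr_norm l tau : tau <= T ->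
  L2inner mT (heat_kernel l tau) (heat_kernel l tau) =
  (\int[leb]_(t in `]0, tau[) expR (- (2 * l) * (tau - t)))%R.
Proof.
move=> tauT; rewrite /L2inner heat_kernel_sqr.
exact: Rintegral_lebesgue_on_sub.
Qed.

Lemma heat_kernel_sqr_norm0 tau : 0 <= tau <= T ->
  L2inner mT (heat_kernel 0 tau) (heat_kernel 0 tau) <= T.
Proof.
move=> /andP[tau0 tauT]; rewrite heat_kernel_sqr_norm//.
under eq_Rintegral do rewrite mulr0 oppr0 mul0r expR0.
rewrite Rintegral_cst//= lebesgue_measure_itv/= lte_fin.
by case: ifP => _ /=; rewrite mul1r ?subr0// ltW.
Qed.

(** The integral of e^(-2 l (tau - t)) over (0, tau) is (1 - e^(-2 l tau)) / (2 l). *)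
Lemma heat_kernel_sqr_norm_gt0 l tau : 0 < l -> 0 <= tau <= T ->
  L2inner mT (heat_kernel l tau) (heat_kernel l tau) <= l^-1.
Proof.
move=> l0 /andP[]; rewrite le_eqVlt => /predU1P[<-|tau0] tauT.
  rewrite heat_kernel_sqr_norm ?(ltW T0)// set_itvoo0 Rintegral_set0.
  by rewrite invr_ge0 ltW.
rewrite heat_kernel_sqr_norm// /Rintegral.
have l2 : 0 < 2 * l by rewrite mulr_gt0.
rewrite -(integral_itv_bndoo true false); last first.
  apply/measurable_EFinP; apply: measurable_funTS; exact: measurable_exp.
pose F (t : R) := (2 * l)^-1 * expR (- (2 * l) * (tau - t)).
have dF (t : R) : is_derive t 1 F (expR (- (2 * l) * (tau - t))).
  have h := is_derive_exp (2 * l) tau t.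
  have -> : expR (- (2 * l) * (tau - t)) =
      (2 * l)^-1 * ((2 * l) * expR (- (2 * l) * (tau - t))).
    by rewrite mulKf// gt_eqF.
  exact: is_deriveZ.
have dab x : x \in `[0, tau] -> derivable F x 1 by move=> _; case: (dF x).
rewrite (@continuous_FTC2 _ _ F)//.
- rewrite -EFinB /= /F subrr mulr0 expR0 mulr1.
  have : 0 < (2 * l)^-1 * expR (- (2 * l) * (tau - 0)).
    by rewrite mulr_gt0 ?expR_gt0// invr_gt0.
  have : (2 * l)^-1 <= l^-1 by rewrite lef_pV2 ?posrE//; lra.
  lra.
- have /(continuous_within_itvP _ tau0) [_ ? ?] := derivable_within_continuous dab.
  by split => // x /subset_itv_oo_cc; exact: dab.
- by move=> x _; rewrite derive1E; case: (dF x).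
Qed.

(** Splitting tau - t as (T - t) - (T - tau) separates the variables: tau survives in a continuous
    factor and in the upper end of an integral, which gives continuity in tau. *)
Lemma inner_heat_kernel l tau (f : L2 mT) : 0 <= tau <= T ->
  L2inner mT f (heat_kernel l tau) =
  expR (l * (T - tau)) * parameterized_integral leb 0 tau
    (fun t : R => \1_`]0, T[ t * (f t * expR (- l * (T - t)))).
Proof.
move=> /andP[tau0 tauT].
pose F (t : R) := \1_`]0, T[ t * (f t * expR (- l * (T - t))).
have mF : measurable_fun setT F.
  apply: measurable_funM => //; apply: measurable_funM; first exact: measurable_L2.
  exact: measurable_exp.
have iF : leb.-integrable `]0, tau[ (EFin \o F).
  have := L2_integrableM f (heat_kernel_L2 l T).
  rewrite (_ : (fun t : R => _) = F); last by apply/funext => t; rewrite /F mulrCA.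
  move/(integrable_lebesgue_on _ mF); apply: integrableS => //.
  by apply: subset_itv => //; rewrite leBSide.
transitivity (\int[mT]_t (\1_`]0, tau[ t * (expR (l * (T - tau)) * F t)))%R.
  apply: eq_Rintegral => t _; rewrite /heat_kernel /F !indicE.
  have [tt|tt] := boolP (t \in `]0%R, tau[%classic); last by rewrite !mul0r mulr0.
  rewrite mem_set ?mul1r; last first.
    move: tt; rewrite inE/= !in_itv/= => /andP[-> tt] /=; exact: lt_le_trans tauT.
  rewrite mulrCA -expRD; congr (_ * expR _); ring.
rewrite Rintegral_lebesgue_on_sub//; last exact: measurable_funM.
rewrite RintegralZl//; congr (_ * _).
rewrite /parameterized_integral /Rintegral; congr fine.
rewrite -(integral_itv_bndoo true false)//.
by apply/measurable_EFinP; exact: measurable_funTS.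
Qed.

Lemma continuous_inner_heat_kernel l (f : L2 mT) (s : R) : 0 <= s <= T ->
  L2inner mT f (heat_kernel l tau) @[tau --> within `[0, T] (nbhs s)] -->
  L2inner mT f (heat_kernel l s).
Proof.
move=> s0T.
pose F (t : R) := \1_`]0, T[ t * (f t * expR (- l * (T - t))).
have mF : measurable_fun setT F.
  apply: measurable_funM => //; apply: measurable_funM; first exact: measurable_L2.
  exact: measurable_exp.
have iF : leb.-integrable `[0, T] (EFin \o F).
  have := L2_integrableM f (heat_kernel_L2 l T).
  rewrite (_ : (fun t : R => _) = F); last by apply/funext => t; rewrite /F mulrCA.
  move/(integrable_lebesgue_on _ mF)/integrable_mkcond => h.
  apply: (integrableS measurableT) => //.
  apply: eq_integrable (h (measurable_itv _)) => // t _.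
  by rewrite patchE; case: ifPn => //= /negP tT; rewrite /F indicE memNset ?mul0r// => tT'; apply: tT; rewrite inE.
have := parameterized_integral_continuous (ltW T0) iF.
move=> /subspace_continuousP/(_ s) cP.
apply: (@cvg_trans _ (expR (l * (T - tau)) * parameterized_integral leb 0 tau F
   @[tau --> within `[0, T] (nbhs s)])).
  apply: near_eq_cvg; rewrite near_withinE; near=> tau => /=; rewrite in_itv/= => h.
  by rewrite inner_heat_kernel.
rewrite inner_heat_kernel//; apply: cvgM; last by apply: cP; rewrite /= in_itv.
have cE : {for s, continuous (fun tau : R => expR (l * (T - tau)))}.
  apply: (@is_derive_cvg _ _ _ (expR (l * (T - s)) * - l)).
  by apply: is_derive_eq; rewrite /GRing.scale/=; ring.
apply: cvg_trans cE; apply: cvg_app; exact: cvg_within.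
Unshelve. all: by end_near. Qed.

End duhamel_kernel.

Lemma Linf_norm_le {R : realType} (m : {measure set (measurableTypeR R) -> \bar R})
    (T c : R) (u : R -> L2 m) : 0 <= c ->
  (forall t : R, 0 <= t <= T -> L2norm (u t) <= c) -> (Linf_norm T u <= c%:E)%E.
Proof.
move=> c0 uc; rewrite /Linf_norm Lnorm.unlock; case: ifP => [_|_]; last by rewrite lee_fin.
apply/ess_sup_inf.ess_supP; exists (~` `[0, T]%classic); split => /=.
- exact: measurableC.
- by rewrite /lebesgue_on /mrestr/= setICl measure0.
- move=> t /=; apply: contra_not => /=; rewrite in_itv/= => h.
  by rewrite lee_fin ger0_norm ?L2norm_ge0// uc.
Qed.

Section control.
Context {R : realType}.
Variables (T alpha beta mu : R).
Hypotheses (T0 : 0 < T) (alpha_lt2 : alpha < 2) (mu_lt : mu < mu_crit (alpha + beta)).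
Local Opaque Gamma boundary_value.
Local Notation mT := (lebesgue_on `]0, T[).
Local Notation "'<<' f , g '>>'" := (L2inner (weight beta) f g).
Local Notation lam := (lambda alpha beta mu).
Local Notation e := (eigenbasis alpha_lt2 mu_lt).
Local Notation bv := (boundary_value alpha_lt2 mu_lt).
Local Notation il := (inv_lambda alpha beta mu).
Local Notation S := (semigroup alpha mu).
Let C := bessel_bound (kappa alpha) (bessel_order alpha beta mu).
Implicit Types (f : L2 mT) (z w : L2 (weight beta)) (tau t : R).

Local Notation eps := (fun j tau => heat_kernel_L2 T (lam j) tau).

(** T + 1 covers the bound T for the mode 0 and the bound 1/lambda_j for the others. *)
Lemma heat_kernel_eigen_le j tau : 0 <= tau <= T ->
  L2norm (eps j tau) ^+ 2 <= (T + 1) * il j.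
Proof.
move=> tauT; rewrite L2norm_sqr; case: j => [|j].
  rewrite mulr1; apply: (le_trans (heat_kernel_sqr_norm0 T0 tauT)).
  by rewrite lerDl.
have l0 := lambda_gt0 alpha_lt2 mu_lt j.
apply: (le_trans (heat_kernel_sqr_norm_gt0 T0 l0 tauT)).
by rewrite ler_peMl ?invr_ge0 ?(ltW l0)// lerDr ltW.
Qed.

Definition control_coef tau f (j : nat) : R := bv j * L2inner mT f (eps j tau).

Let C_ge0 : 0 <= C.
Proof. exact: (le_trans (normr_ge0 _) (boundary_value_le alpha_lt2 mu_lt 0)). Qed.

Lemma control_coef_sqr_le tau f j : 0 <= tau <= T ->
  control_coef tau f j ^+ 2 <= C ^+ 2 * (T + 1) * L2norm f ^+ 2 * il j.
Proof.
move=> tauT.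
have sq (x y : R) : 0 <= y -> `|x| <= y -> x ^+ 2 <= y ^+ 2.
  by move=> y0 xy; rewrite -(real_normK (num_real x)) lerXn2r.
have hb : bv j ^+ 2 <= C ^+ 2 by apply: sq C_ge0 _; exact: boundary_value_le.
have hi : L2inner mT f (eps j tau) ^+ 2 <= L2norm f ^+ 2 * ((T + 1) * il j).
  apply: (@le_trans _ _ (L2norm f ^+ 2 * L2norm (eps j tau) ^+ 2)).
    rewrite -exprMn; apply: sq; last exact: L2inner_le.
    by rewrite mulr_ge0 ?L2norm_ge0.
  by rewrite ler_wpM2l ?sqr_ge0// heat_kernel_eigen_le.
rewrite /control_coef exprMn.
apply: (@le_trans _ _ (C ^+ 2 * (L2norm f ^+ 2 * ((T + 1) * il j)))).
  by apply: ler_pM => //; exact: sqr_ge0.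
by rewrite le_eqVlt; apply/orP; left; apply/eqP; ring.
Qed.

Let sum_il (c : R) : cvgn (series (fun j => c * il j)).
Proof. exact: (is_cvg_seriesZ (inv_lambda_summable alpha_lt2 mu_lt)). Qed.

Lemma control_coef_summable tau f : 0 <= tau <= T ->
  cvgn (series (fun j => control_coef tau f j ^+ 2)).
Proof.
move=> tauT; apply: (@series_le_cvg _ _ (fun j => C ^+ 2 * (T + 1) * L2norm f ^+ 2 * il j)) => [j|j|j|].
- exact: sqr_ge0.
- by apply: (le_trans (sqr_ge0 _)); exact: control_coef_sqr_le tauT.
- exact: control_coef_sqr_le.
- exact: sum_il.
Qed.

Definition control tau f : L2 (weight beta) := xget 0 (expansion e (control_coef tau f)).

Lemma control_expansion tau f : 0 <= tau <= T ->
  expansion e (control_coef tau f) (control tau f).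
Proof.
move=> tauT; have [w wP] := riesz_fischer (eigenbasis_orthonormal alpha_lt2 mu_lt)
  (@control_coef_summable tau f tauT).
by apply: xgetPex; exists w.
Qed.

Definition control_bound : R := Num.sqrt (C ^+ 2 * (T + 1) * limn (series il)).

Lemma control_le tau f : 0 <= tau <= T -> L2norm (control tau f) <= control_bound * L2norm f.
Proof.
move=> tauT; pose K := C ^+ 2 * (T + 1).
have h := expansion_norm (eigenbasis_orthonormal alpha_lt2 mu_lt) (control_expansion f tauT).
have K0 : 0 <= K by rewrite mulr_ge0 ?sqr_ge0// addr_ge0 ?(ltW T0).
have le2 : L2norm (control tau f) ^+ 2 <= K * limn (series il) * L2norm f ^+ 2.
  rewrite -(cvg_lim (@norm_hausdorff _ R) h).
  have -> : K * limn (series il) * L2norm f ^+ 2 =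
      limn (series (fun j => K * L2norm f ^+ 2 * il j)).
    rewrite mulrAC; apply/esym.
    apply: (cvg_lim (@norm_hausdorff _ R)).
    rewrite (_ : series _ = fun n => K * L2norm f ^+ 2 * series il n); last first.
      by apply/funext => n; rewrite /series/= mulr_sumr.
    by apply: cvgMr; exact: (inv_lambda_summable alpha_lt2 mu_lt).
  apply: lim_series_le => //; first exact: (cvgP _ h).
  by move=> j; exact: control_coef_sqr_le.
have il0 : 0 <= limn (series il).
  rewrite (_ : 0 = series il 0); last by rewrite /series/= big_geq.
  apply: nondecreasing_cvgn_le; last exact: (inv_lambda_summable alpha_lt2 mu_lt).
  by apply/nondecreasing_seqP => n; rewrite seriesSr lerDl inv_lambda_ge0.
rewrite -(@ler_pXn2r _ 2) ?nnegrE ?mulr_ge0 ?L2norm_ge0 ?sqrtr_ge0//.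
by rewrite exprMn sqr_sqrtr// mulr_ge0.
Qed.

Lemma control_bounded tau : 0 <= tau <= T -> bounded_operator (control tau).
Proof.
move=> tauT; split; last by exists control_bound => f; exact: control_le.
move=> c f g; apply: (expansion_unique (eigenbasis_orthonormal alpha_lt2 mu_lt)
  (control_expansion _ tauT)).
rewrite (_ : control_coef tau _ =
    (fun j => c * control_coef tau f j + control_coef tau g j)).
  by apply: expansion_linear; exact: control_expansion.
apply/funext => j; rewrite /control_coef L2innerDl L2innerZl mulrDr.
by rewrite mulrCA.
Qed.

Lemma control_continuous f : L2continuous `[0, T] (control ^~ f).
Proof.
apply: (expansion_L2continuous (eigenbasis_orthonormal alpha_lt2 mu_lt)
  (c := control_coef ^~ f) (M := fun j => C ^+ 2 * (T + 1) * L2norm f ^+ 2 * il j)).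
- by move=> tau; rewrite /= in_itv/= => tauT; exact: control_expansion.
- move=> j s; rewrite /= in_itv/= => sT; apply: cvgMr.
  exact: continuous_inner_heat_kernel.
- by move=> j tau; rewrite /= in_itv/= => tauT; exact: control_coef_sqr_le.
- exact: sum_il.
Qed.

Lemma semigroup_continuous z : L2continuous `[0, T] (fun t => S t z).
Proof.
apply: (expansion_L2continuous (eigenbasis_orthonormal alpha_lt2 mu_lt)
  (c := fun t => heat_coef alpha_lt2 mu_lt t z) (M := fun j => << e j, z >> ^+ 2)).
- by move=> t; rewrite /= in_itv/= => /andP[t0 _]; exact: semigroup_expansion.
- move=> j s _; apply: cvgMl.
  have cE : {for s, continuous (fun t : R => expR (- lam j * t))}.
    apply: (@is_derive_cvg _ _ _ (expR (- lam j * s) * - lam j)).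
    by apply: is_derive_eq; rewrite /GRing.scale/=; ring.
  by apply: cvg_trans cE; apply: cvg_app; exact: cvg_within.
- move=> j t; rewrite /= in_itv/= => /andP[t0 _].
  have /andP[e0 e1] := expR_lambda_le1 beta mu alpha_lt2 j t0.
  by rewrite exprMn ler_piMl ?sqr_ge0// exprn_ile1// ltW.
- exact: (bessel_cvg (eigenbasis_orthonormal alpha_lt2 mu_lt)).
Qed.

Lemma semigroup_le t z : 0 <= t -> L2norm (S t z) <= L2norm z.
Proof.
move=> t0; have oe := eigenbasis_orthonormal alpha_lt2 mu_lt.
have h := expansion_norm oe (semigroup_expansion alpha_lt2 mu_lt z t0).
rewrite -(@ler_pXn2r _ 2) ?nnegrE ?L2norm_ge0//.
rewrite -(cvg_lim (@norm_hausdorff _ R) h) L2norm_sqr.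
apply: (@le_trans _ _ (limn (series (fun j => << e j, z >> ^+ 2)))).
  apply: lim_series_le; [exact: (cvgP _ h)|exact: bessel_cvg|move=> j].
  have /andP[e0 e1] := expR_lambda_le1 beta mu alpha_lt2 j t0.
  by rewrite exprMn ler_piMl ?sqr_ge0// exprn_ile1// ltW.
apply: limr_le; first exact: bessel_cvg.
by near=> n; rewrite /series/= big_mkord; exact: (bessel_ineq oe z n).
Unshelve. all: by end_near. Qed.

Lemma semigroup_symmetric t z w : 0 <= t -> << z, S t w >> = << S t z, w >>.
Proof.
move=> t0; have oe := eigenbasis_orthonormal alpha_lt2 mu_lt.
have h1 := expansion_inner (z := z) (semigroup_expansion alpha_lt2 mu_lt w t0).
have h2 := expansion_inner (z := w) (semigroup_expansion alpha_lt2 mu_lt z t0).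
have E : (fun j => heat_coef alpha_lt2 mu_lt t w j * << e j, z >>) =
    (fun j => heat_coef alpha_lt2 mu_lt t z j * << e j, w >>).
  by apply/funext => j; rewrite /heat_coef mulrAC.
rewrite E in h1; rewrite L2innerC.
exact: (cvg_unique (@norm_hausdorff _ R) h1 h2).
Qed.

(* The series of t |-> lim1 (S(tau - t)z) converges normally in L2(0,T), so it can be
   integrated against f term by term. *)
Lemma control_boundary tau f z : 0 <= tau <= T ->
  lebesgue_measure.-integrable `]0, tau[ (EFin \o boundary_integrand alpha mu tau f z) /\
  << control tau f, z >> = boundary_term alpha mu tau f z.
Proof.
move=> tauT; have oe := eigenbasis_orthonormal alpha_lt2 mu_lt.
have tau_le : tau <= T by case/andP : tauT.
pose c j := << e j, z >> * bv j.
pose v j : L2 mT := c j *: eps j tau.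
(* The coefficients of [z] and the norms of the kernels are both square-summable, and x y <= x^2 +
   y^2. *)
have vM j : L2norm (v j) <= C * (<< e j, z >> ^+ 2 + (T + 1) * il j).
  rewrite L2normZ normrM [`|_| * `|bv j|]mulrC -mulrA.
  apply: ler_pM => //; first by rewrite mulr_ge0// L2norm_ge0.
    exact: boundary_value_le.
  apply: le_trans (lerD (lexx _) (heat_kernel_eigen_le j tauT)).
  rewrite -(real_normK (num_real << e j, z >>)).
  have := sqr_ge0 (`|<< e j, z >>| - L2norm (eps j tau)).
  have := mulr_ge0 (normr_ge0 << e j, z >>) (L2norm_ge0 (eps j tau)).
  move: `|<< e j, z >>| (L2norm _) => x y; rewrite !expr2; lra.
have sM : cvgn (series (fun j => C * (<< e j, z >> ^+ 2 + (T + 1) * il j))).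
  apply: is_cvg_seriesZ; apply: is_cvg_seriesD; last exact: sum_il.
  exact: (bessel_cvg oe).
have [w wP] := L2_normal_cvg vM sM.
have vin j (t : R) : 0 < t < tau -> v j t = heat_coef alpha_lt2 mu_lt (tau - t) z j * bv j.
  move=> tt; have -> : v j t = c j * heat_kernel (lam j) tau t by [].
  rewrite /heat_kernel indicE mem_set ?mul1r ?/=; last by rewrite in_itv.
  by rewrite /c /heat_coef mulrC mulrA.
have vout j (t : R) : ~~ (0 < t < tau) -> v j t = 0.
  move=> tt; have -> : v j t = c j * heat_kernel (lam j) tau t by [].
  rewrite /heat_kernel indicE memNset ?mul0r ?mulr0//= in_itv; exact/negP.
pose g t := limn (series (fun j => v j t)).
have gin (t : R) : 0 < t < tau -> series (fun j => v j t) @ \oo -->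
    boundary_series alpha_lt2 mu_lt (tau - t) z.
  move=> tt; rewrite (_ : (fun j => v j t) =
      (fun j => heat_coef alpha_lt2 mu_lt (tau - t) z j * bv j)).
    by apply: boundary_series_cvg; rewrite subr_gt0; case/andP : tt.
  by apply/funext => j; exact: vin.
have gout (t : R) : ~~ (0 < t < tau) -> series (fun j => v j t) @ \oo --> (0 : R).
  move=> tt; apply: cvg_near_cst; near=> n.
  by rewrite -[LHS]/(\sum_(0 <= j < n) v j t) big1// => j _; exact: vout.
have vg t : series (fun j => v j t) @ \oo --> g t.
  have [tt|tt] := boolP (0 < t < tau).
    by apply: (cvgP _ (gin _ tt)).
  by apply: (cvgP _ (gout _ tt)).
have mg : measurable_fun setT g.
  apply: (measurable_fun_cvg (h := fun n t => series (fun j => v j t) n)).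
    move=> n; suff : measurable_fun setT (fun t => \sum_(0 <= j < n) v j t) by [].
    by apply: measurable_sum => j; exact: measurable_L2.
  by move=> t _; exact: vg.
(* The sum in L2 and the pointwise sum agree, so f g inherits integrability from f w. *)
have wg : w = g %[ae mT].
  apply: (L2_cvg_pointwise wP mg); apply: aeW => t.
  rewrite (_ : (fun n => _) = series (fun j => v j t)); first exact: vg.
  apply/funext => n; rewrite -[RHS]/(\sum_(0 <= j < n) v j t) big_mkord.
  exact: (psumE (fun j => eps j tau) c).
have [ifg Efg] := L2inner_ae f mg wg.
have g1 t : f t * g t = \1_`]0, tau[ t * (f t * g t).
  rewrite indicE; have [tt|tt] := boolP (0 < t < tau).
    by rewrite mem_set ?mul1r//= in_itv.
  have -> : g t = 0 by apply: (cvg_lim (@norm_hausdorff _ R)); exact: gout.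
  by rewrite !mulr0.
have gE t : `]0, tau[%classic t -> f t * g t = boundary_integrand alpha mu tau f z t.
  rewrite /= in_itv/= => tt; rewrite /boundary_integrand lim1_semigroup; last first.
    by rewrite subr_gt0; case/andP : tt.
  by congr (_ * _); apply: (cvg_lim (@norm_hausdorff _ R)); exact: gin.
have mfg : measurable_fun setT (fun t => f t * g t).
  by apply: measurable_funM => //; exact: measurable_L2.
split.
  have h : mT.-integrable setT (EFin \o (fun t => \1_`]0, tau[ t * (f t * g t))).
    by apply: eq_integrable ifg => // t _; rewrite /= -g1.
  have {}h := (integrable_lebesgue_on_sub tau_le mfg).1 h.
  by apply: eq_integrable h => // t /set_mem tt; rewrite /= gE.
transitivity (L2inner mT f g); last first.
  rewrite /L2inner; under eq_Rintegral do rewrite g1.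
  rewrite Rintegral_lebesgue_on_sub//; apply: eq_Rintegral => t /set_mem; exact: gE.
rewrite -Efg.
have h1 := expansion_inner (z := z) (control_expansion f tauT).
have h2 := @L2inner_cvg _ _ _ _ f wP.
(* Both sides of the identity are limits of the same partial sums. *)
have E : (fun n => L2inner mT f (\sum_(j < n) v j)) =
    series (fun j => control_coef tau f j * << e j, z >>).
  apply/funext => n; rewrite L2innerC (L2inner_suml n v).
  rewrite -[RHS]/(\sum_(0 <= j < n) control_coef tau f j * << e j, z >>) big_mkord.
  apply: eq_bigr => j _.
  rewrite (L2innerZl (c j) (eps j tau) f) L2innerC /c /control_coef.
  by rewrite -mulrA mulrC.
rewrite E in h2; exact: (cvg_unique (@norm_hausdorff _ R) h1 h2).
Unshelve. all: by end_near. Qed.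

End control.

(** * Solutions by transposition *)

Section transposition.
Context {R : realType}.
Variables (T alpha beta mu : R).
Hypotheses (T0 : 0 < T) (alpha_lt2 : alpha < 2) (mu_lt : mu < mu_crit (alpha + beta)).
Local Opaque Gamma.
Local Notation mT := (lebesgue_on `]0, T[).
Local Notation "'<<' f , g '>>'" := (L2inner (weight beta) f g).
Local Notation S := (semigroup alpha mu).
Local Notation B := (control alpha_lt2 mu_lt).
Implicit Types (f : L2 mT) (z u v w : L2 (weight beta)) (tau t : R).

Lemma transposition_exists f z tau : 0 <= tau <= T ->
  transposition alpha mu f z tau (S tau z + B tau f).
Proof.
move=> tauT w; have tau0 : 0 <= tau by case/andP : tauT.
rewrite L2innerDl (semigroup_symmetric alpha_lt2 mu_lt _ _ tau0).
by rewrite (control_boundary T0 alpha_lt2 mu_lt f w tauT).2.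
Qed.

(** Test both identities with u - v. *)
Lemma transposition_unique f z tau u v :
  transposition alpha mu f z tau u -> transposition alpha mu f z tau v ->
  u = v %[ae weight beta].
Proof.
move=> hu hv; apply: L2norm0_ae; apply/eqP; rewrite -sqrf_eq0 L2norm_sqr.
by rewrite L2innerBl hu hv subrr.
Qed.

Definition solution f z t : L2 (weight beta) := S t z + B t f.

Lemma solution_weak f z : weak_solution alpha mu T f z (solution f z).
Proof.
split.
  apply: L2continuousD; first exact: semigroup_continuous.
  exact: control_continuous.
move=> tau /andP[tau0 tauT]; apply: transposition_exists.
by rewrite (ltW tau0).
Qed.

(** The weak formulation is imposed for tau > 0 only; continuity carries uniqueness to time 0. *)
Lemma L2continuous_eq0 (m : {measure set (measurableTypeR R) -> \bar R})
    (u v : R -> L2 m) : L2continuous `[0, T] u -> L2continuous `[0, T] v ->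
  (forall t : R, 0 < t <= T -> u t = v t %[ae m]) -> u 0 = v 0 %[ae m].
Proof.
move=> cu cv uv; apply: L2norm0_ae; apply/eqP; rewrite eq_le L2norm_ge0 andbT.
have I0 : `[0, T]%classic (0 : R) by rewrite /= in_itv/= lexx ltW.
have : L2norm (u t - u 0) + L2norm (v t - v 0) @[t --> within `[0, T] (nbhs (0 : R))]
    --> (0 + 0 : R).
  by apply: cvgD; [exact: cu|exact: cv].
rewrite addr0 => /cvgrPdist_le h.
apply/ler_addgt0Pr => eps eps0; rewrite add0r.
have := h _ eps0; rewrite near_withinE => -[d /= d0 dP].
(* A time in (0, T] within distance d of 0. *)
pose t := Num.min (d / 2) T.
have t0 : 0 < t by rewrite lt_min T0 divr_gt0.
have tT : t <= T by rewrite ge_min lexx orbT.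
have td : t < d.
  by apply: (@le_lt_trans _ _ (d / 2)); [rewrite ge_min lexx|rewrite ltr_pdivrMr// ltr_pMr// ltr1n].
have := dP t; rewrite /= sub0r normrN gtr0_norm// => /(_ td).
rewrite in_itv/= (ltW t0) tT => /(_ isT).
rewrite sub0r normrN ger0_norm ?addr_ge0 ?L2norm_ge0// => le.
apply: le_trans le.
have -> : u 0 - v 0 = - (u t - u 0) + ((u t - v t) + (v t - v 0)).
  by rewrite (addrA (u t - v t)) subrK opprB addrA subrK.
apply: (le_trans (L2normD _ _)); rewrite L2normN lerD2l.
apply: (le_trans (L2normD _ _)).
have uv0 : u t - v t = (0 : L2 m) %[ae m].
  have uvt : u t = v t %[ae m] by apply: uv; rewrite t0.
  by apply: filterS uvt => x /= + _ => uvx; rewrite -[LHS]/(u t x - v t x) uvx// subrr.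
have -> : L2norm (u t - v t) = 0.
  by rewrite (L2norm_ae uv0) -(scale0r 0) L2normZ normr0 mul0r.
by rewrite add0r.
Qed.

Lemma solution_unique f z (v : R -> L2 (weight beta)) :
  weak_solution alpha mu T f z v ->
  forall t, 0 <= t <= T -> v t = solution f z t %[ae weight beta].
Proof.
move=> [cv hv]; have [cs hs] := solution_weak f z.
have pos t : 0 < t <= T -> v t = solution f z t %[ae weight beta].
  by move=> tT; apply: (transposition_unique (hv _ tT)); exact: hs.
move=> t /andP[]; rewrite le_eqVlt => /predU1P[<- _|t0 tT]; last first.
  by apply: pos; rewrite t0.
exact: L2continuous_eq0.
Qed.

Lemma solution_le f z t : 0 <= t <= T ->
  L2norm (solution f z t) <= (1 + control_bound T alpha beta mu) * (L2norm z + L2norm f).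
Proof.
move=> tT; have t0 : 0 <= t by case/andP : tT.
apply: (le_trans (L2normD _ _)).
have h1 := semigroup_le alpha_lt2 mu_lt z t0.
have h2 := control_le T0 alpha_lt2 mu_lt f tT.
have := L2norm_ge0 f; have := L2norm_ge0 z.
have : 0 <= control_bound T alpha beta mu by exact: sqrtr_ge0.
nra.
Qed.

End transposition.

Theorem proposition10 (R : realType) (T alpha beta mu : R)
    (T_gt0 : 0 < T) (alpha_ge0 : 0 <= alpha) (alpha_lt2 : alpha < 2)
    (mu_lt : mu < mu_crit (alpha + beta)) :
  [/\
    (* the right-hand side of the transposition formula is meaningful *)
    (forall (t : R) (z : L2 (weight beta)), 0 < t ->
       exists l : R, left_limit1 beta (semigroup alpha mu t z) l) /\
    (forall (tau : R) (f : L2 (lebesgue_on `]0, T[)) (z : L2 (weight beta)),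
       0 <= tau <= T ->
       lebesgue_measure.-integrable `]0, tau[
         (EFin \o boundary_integrand alpha mu tau f z)),
    exists B : R -> L2 (lebesgue_on `]0, T[) -> L2 (weight beta),
      [/\ forall tau : R, 0 <= tau <= T -> bounded_operator (B tau),
          forall f : L2 (lebesgue_on `]0, T[), L2continuous `[0, T] (B ^~ f),
          forall (tau : R) (f : L2 (lebesgue_on `]0, T[))
              (z : L2 (weight beta)), 0 <= tau <= T ->
            L2inner (weight beta) (B tau f) z = boundary_term alpha mu tau f z
        & forall (f : L2 (lebesgue_on `]0, T[)) (u0 : L2 (weight beta))
              (tau : R), 0 <= tau <= T ->
            [/\ exists u : L2 (weight beta), transposition alpha mu f u0 tau u,
                forall u v : L2 (weight beta),
                  transposition alpha mu f u0 tau u ->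
                  transposition alpha mu f u0 tau v ->
                  u = v %[ae weight beta]
              & forall u : L2 (weight beta), 0 < tau ->
                  transposition alpha mu f u0 tau u ->
                  u - semigroup alpha mu tau u0 = B tau f %[ae weight beta]]]
  & exists2 C : R, 0 < C &
      forall (f : L2 (lebesgue_on `]0, T[)) (u0 : L2 (weight beta)),
      exists u : R -> L2 (weight beta),
        [/\ weak_solution alpha mu T f u0 u,
            forall v : R -> L2 (weight beta),
              weak_solution alpha mu T f u0 v ->
              forall t : R, 0 <= t <= T -> v t = u t %[ae weight beta]
          & (Linf_norm T u <= (C * (L2norm u0 + L2norm f))%:E)%E]].
Proof.
have tr tau f z := transposition_exists T_gt0 alpha_lt2 mu_lt f z (tau := tau).
split.
- split=> [t z t0|tau f z tauT].
    by exists (boundary_series alpha_lt2 mu_lt t z); exact: left_limit1_semigroup.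
  exact: (control_boundary T_gt0 alpha_lt2 mu_lt f z tauT).1.
- exists (control alpha_lt2 mu_lt (T := T)); split.
  + by move=> tau; exact: control_bounded.
  + by move=> f; exact: control_continuous.
  + by move=> tau f z tauT; exact: (control_boundary T_gt0 alpha_lt2 mu_lt f z tauT).2.
  + move=> f u0 tau tauT; split.
    * by exists (semigroup alpha mu tau u0 + control alpha_lt2 mu_lt tau f); exact: tr.
    * by move=> u v; exact: transposition_unique.
    * move=> u _ hu; apply: filterS (transposition_unique hu (tr tau f u0 tauT)) => x /= h _.
      by rewrite -[LHS]/(u x - semigroup alpha mu tau u0 x) h// addrC addKr.
- exists (1 + control_bound T alpha beta mu); first by rewrite ltr_wpDr// sqrtr_ge0.
  move=> f u0; exists (solution alpha_lt2 mu_lt f u0); split.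
  + exact: solution_weak.
  + by move=> v hv t; exact: solution_unique.
  + apply: Linf_norm_le => [|t]; last exact: solution_le.
    by rewrite mulr_ge0 ?addr_ge0 ?sqrtr_ge0 ?L2norm_ge0.
Qed.
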